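(* (a) For each infinite field $\mathrm{k}$, each integer $n\ge 2$ and all $f,g\in \mathrm{Bir}_{\mathbb{P}^n}(\mathrm{k})$, there is a morphism $\rho\colon \mathbb{A}^1\to \mathrm{Bir}_{\mathbb{P}^n}$, defined over $\mathrm{k}$, such that $\rho(0)=f$ and $\rho(1)=g$. In particular, the group $\mathrm{Bir}_{\mathbb{P}^n}(\mathrm{k})$ is connected with respect to the Zariski topology. (b) For each infinite field $\mathrm{k}$, the group $\mathrm{Bir}_{\mathbb{P}^1}(\mathrm{k})$ is also connected with respect to the Zariski topology, whereas the first property in (a) does not hold in general for $n=1$: there exist an infinite field $\mathrm{k}$ and $f,g\in\mathrm{Bir}_{\mathbb{P}^1}(\mathrm{k})$ for which there is no morphism $\rho\colon\mathbb{A}^1\to\mathrm{Bir}_{\mathbb{P}^1}$ defined over $\mathrm{k}$ with $\rho(0)=f$ and $\rho(1)=g$. (c) For each $n\ge 2$, the groups $\mathrm{Bir}_{\mathbb{P}^n}(\mathbb{R})$ and $\mathrm{Bir}_{\mathbb{P}^n}(\mathbb{C})$ are path-connected, and thus connected, with respect to the Euclidean topology.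
   Context: For a field $\mathrm{k}$, $\mathrm{Bir}_{\mathbb{P}^n}(\mathrm{k})$ is the group of birational transformations of $\mathbb{P}^n$ defined over $\mathrm{k}$. Morphisms to $\mathrm{Bir}_X$. Let $\mathrm{k}$ be a field with algebraic closure $\overline{\mathrm{k}}$, let $X$ be a geometrically irreducible algebraic variety over $\mathrm{k}$, and let $A$ be an algebraic variety over $\mathrm{k}$. Consider an $A$-birational transformation $f$ of $A\times X$ which (over $\overline{\mathrm{k}}$) induces an isomorphism $U\to V$, where $U,V$ are open subsets of $A\times X$ whose projections to $A$ are surjective. For each $\overline{\mathrm{k}}$-point $a$ of $A$ it gives $f_a\in \mathrm{Bir}_X(\overline{\mathrm{k}})$, $x\mapsto p_2(f(a,x))$, where $p_2\colon A\times X\to X$ is the second projection. The map $a\mapsto f_a$ is called a $\overline{\mathrm{k}}$-morphism $A\to \mathrm{Bir}_X$. If $f$ is defined over $\mathrm{k}$, it is called a $\mathrm{k}$-morphism $A\to \mathrm{Bir}_X$ (a morphism defined over $\mathrm{k}$); it then yields a map $A(\mathrm{k}')\to \mathrm{Bir}_X(\mathrm{k}')$ for every field extension $\mathrm{k}\subset \mathrm{k}'$. Zariski topology. A subset $F\subseteq \mathrm{Bir}_X(\mathrm{k})$ is closed in the Zariski topology if for every algebraic variety $A$ over $\mathrm{k}$ and every $\mathrm{k}$-morphism $A\to \mathrm{Bir}_X$, the preimage of $F$ in $A(\mathrm{k})$ is closed (for the Zariski topology of $A(\mathrm{k})$). Euclidean topology. Let $\mathrm{k}$ be $\mathbb{R}$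 or $\mathbb{C}$. For $d\ge 1$, let $W_d(\mathrm{k})$ be the projective space of classes $[h_0:\dots:h_n]$, up to scaling by $\mathrm{k}^*$, of non-zero $(n+1)$-tuples of homogeneous polynomials $h_i\in \mathrm{k}[x_0,\dots,x_n]$ of degree $d$. Let $H_d(\mathrm{k})\subseteq W_d(\mathrm{k})$ be the subset of those $h=[h_0:\dots:h_n]$ such that the rational map $\psi_h\colon[x_0:\dots:x_n]\dashrightarrow[h_0(x_0,\dots,x_n):\dots:h_n(x_0,\dots,x_n)]$ of $\mathbb{P}^n$ is birational, and let $\pi_d\colon H_d(\mathrm{k})\to \mathrm{Bir}_{\mathbb{P}^n}(\mathrm{k})$, $h\mapsto \psi_h$. Its image is $\{f\in \mathrm{Bir}_{\mathbb{P}^n}(\mathrm{k})\mid \deg(f)\le d\}$. Put the classical Euclidean topology on $W_d(\mathrm{k})$, the induced topology on $H_d(\mathrm{k})$, and the quotient topology induced by $\pi_d$ on $\{f\mid \deg(f)\le d\}$. The Euclidean topology on $\mathrm{Bir}_{\mathbb{P}^n}(\mathrm{k})$ is the inductive limit topology induced by the inclusions $\{f\mid\deg(f)\le d\}\to\{f\mid\deg(f)\le d+1\}$. *)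

(* Defs.v *)
From HB Require Import structures.
From mathcomp Require Import ring.
From mathcomp.real_closed Require Export complex.
(* The notations of [mpoly] clash with those of MathComp-Analysis, and its
   [symmetric] must be shadowed by that of [ssrbool]. *)
From mathcomp Require Export -(notations) mpoly.
From mathcomp Require Export all_boot all_order all_algebra generic_quotient.
From mathcomp Require Export all_classical all_reals all_analysis.

Set Implicit Arguments.
Unset Strict Implicit.
Unset Printing Implicit Defensive.

Import Order.TTheory GRing.Theory Num.Theory.
Import numFieldNormedType.Exports.
Local Open Scope ring_scope.
Local Open Scope classical_set_scope.
Local Open Scope quotient_scope.

Definition homogeneous (m : nat) (R : nzRingType) (d : nat) (p : mpoly m R) :
  bool := p \is ishomog1 d (@mdeg m).

Definition nonzero (k : fieldType) (V : lmodType k) : Type :=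
  set_type [set v : V | v != 0].

HB.instance Definition _ (k : fieldType) (V : lmodType k) :=
  Choice.on (nonzero V).

Definition proportional (k : fieldType) (V : lmodType k) (v w : V) : Prop :=
  exists2 c : k, c != 0 & v = c *: w.

Definition proj_eq (k : fieldType) (V : lmodType k) : rel (nonzero V) :=
  fun v w => `[< proportional (set_val v) (set_val w) >].

Lemma proj_eq_refl (k : fieldType) (V : lmodType k) :
  reflexive (@proj_eq k V).
Proof. by move=> v; apply/asboolP; exists 1; rewrite ?oner_eq0 ?scale1r. Qed.

Lemma proj_eq_sym (k : fieldType) (V : lmodType k) : symmetric (@proj_eq k V).
Proof.
have H v w : proj_eq (V := V) v w -> proj_eq w v.
  move=> /asboolP[c c0 e]; apply/asboolP; exists c^-1; first by rewrite invr_eq0.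
  by rewrite e scalerA mulVf // scale1r.
by move=> v w; apply/idP/idP; exact: H.
Qed.

Lemma proj_eq_trans (k : fieldType) (V : lmodType k) :
  transitive (@proj_eq k V).
Proof.
move=> w v u /asboolP[c c0 e] /asboolP[d d0 e']; apply/asboolP.
by exists (c * d); [rewrite mulf_neq0 | rewrite e e' scalerA].
Qed.

Canonical proj_equiv (k : fieldType) (V : lmodType k) :=
  EquivRel (@proj_eq k V) (@proj_eq_refl k V) (@proj_eq_sym k V)
    (@proj_eq_trans k V).

Definition proj (k : fieldType) (V : lmodType k) : Type :=
  {eq_quot @proj_eq k V}.

HB.instance Definition _ (k : fieldType) (V : lmodType k) :=
  Choice.on (proj V).
HB.instance Definition _ (k : fieldType) (V : lmodType k) :=
  EqQuotient.on (proj V).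

(* A chosen non-zero vector on the line [x]; it is only used in conditions
   that are invariant under scaling. *)
Definition hcoord (k : fieldType) (V : lmodType k) (x : proj V) : V :=
  set_val (repr x).

Definition pspace (n : nat) (k : fieldType) : Type := proj ('rV[k]_n.+1).

(* A rational map from [P^n] to itself over [k] is given by [n + 1] forms of the
   same degree, not all zero, up to the relation [same_ratmap]. *)
Definition tforms (n : nat) (k : fieldType) : Type :=
  n.+1.-tuple (mpoly n.+1 k).

HB.instance Definition _ n (k : fieldType) := Choice.on (tforms n k).

Definition ratmap (n : nat) (k : fieldType) (h : tforms n k) : Prop :=
  (exists d : nat, forall i, homogeneous d (tnth h i)) /\
  (exists i, tnth h i != 0).

Definition same_ratmap (n : nat) (k : fieldType) (g h : tforms n k) : bool :=
  [forall i, forall j, tnth g i * tnth h j == tnth g j * tnth h i].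

Definition forms_id (n : nat) (k : fieldType) : tforms n k :=
  [tuple mpolyX k (mnm1 i) | i < n.+1].

Definition forms_comp (n : nat) (k : fieldType) (g h : tforms n k) :
  tforms n k := [tuple comp_mpoly h (tnth g i) | i < n.+1].

(* [forms_comp g h] may vanish identically, in which case the composite of the
   two rational maps is not defined; [ratmap] excludes this. *)
Definition mutually_inverse (n : nat) (k : fieldType) (g h : tforms n k) :
  Prop :=
  [/\ ratmap (forms_comp g h), same_ratmap (forms_comp g h) (forms_id n k),
      ratmap (forms_comp h g) & same_ratmap (forms_comp h g) (forms_id n k)].

Definition birational (n : nat) (k : fieldType) (h : tforms n k) : Prop :=
  ratmap h /\ exists g : tforms n k, ratmap g /\ mutually_inverse g h.

Definition bforms (n : nat) (k : fieldType) : Type :=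
  set_type [set h : tforms n k | birational h].

HB.instance Definition _ n (k : fieldType) := Choice.on (bforms n k).

Definition bir_eq (n : nat) (k : fieldType) : rel (bforms n k) :=
  fun g h => same_ratmap (set_val g) (set_val h).

Lemma bir_eq_refl n (k : fieldType) : reflexive (@bir_eq n k).
Proof. by move=> g; apply/forallP=> i; apply/forallP=> j; rewrite mulrC. Qed.

Lemma bir_eq_sym n (k : fieldType) : symmetric (@bir_eq n k).
Proof.
have H g h : bir_eq (n := n) (k := k) g h -> bir_eq h g.
  move=> /forallP gh; apply/forallP=> i; apply/forallP=> j.
  by move/forallP: (gh j) => /(_ i) /eqP e; rewrite mulrC e mulrC.
by move=> g h; apply/idP/idP; exact: H.
Qed.

Lemma bir_eq_trans n (k : fieldType) : transitive (@bir_eq n k).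
Proof.
move=> h g f /forallP gh /forallP hf.
apply/forallP=> i; apply/forallP=> j.
have [[_ [l hl]] _] : birational (set_val h) by exact: (set_valP h).
have e a b : tnth (set_val g) a * tnth (set_val h) b
           = tnth (set_val g) b * tnth (set_val h) a.
  by move/forallP: (gh a) => /(_ b) /eqP.
have e' a b : tnth (set_val h) a * tnth (set_val f) b
            = tnth (set_val h) b * tnth (set_val f) a.
  by move/forallP: (hf a) => /(_ b) /eqP.
apply/eqP/(mulIf hl); apply/(mulIf hl).
set G := tnth (set_val g) in e *; set F := tnth (set_val f) in e' *.
set H := tnth (set_val h) in e e' hl *.
transitivity ((G i * H l) * (H l * F j)); first by ring.
rewrite e (e' l j).
transitivity ((G j * H l) * (H l * F i)); last by ring.
by rewrite (e j l) (e' l i); ring.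
Qed.

Canonical bir_equiv n (k : fieldType) :=
  EquivRel (@bir_eq n k) (@bir_eq_refl n k) (@bir_eq_sym n k)
    (@bir_eq_trans n k).

Definition Bir (n : nat) (k : fieldType) : Type := {eq_quot @bir_eq n k}.

HB.instance Definition _ n (k : fieldType) := Choice.on (Bir n k).
HB.instance Definition _ n (k : fieldType) := EqQuotient.on (Bir n k).

Definition bir_class (n : nat) (k : fieldType) (h : tforms n k)
  (hb : birational h) : Bir n k :=
  \pi_(Bir n k) (SigSub (mem_set hb) : bforms n k).

Definition forms_of (n : nat) (k : fieldType) (f : Bir n k) : tforms n k :=
  set_val (repr f).

Definition is_algebraic_closure (k : fieldType) (K : closedFieldType)
  (iota : {rmorphism k -> K}) : Prop := forall z : K, algebraicOver iota z.

Definition evalp (L : fieldType) (K : fieldType) (iota : L -> K) (m : nat)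
  (v : 'rV[K]_m) (p : mpoly m L) : K := mmap iota (fun i => v 0 i) p.

Definition zeros (L : fieldType) (K : fieldType) (iota : L -> K) (m : nat)
  (E : set (mpoly m L)) : set 'rV[K]_m :=
  [set v | forall p, E p -> evalp iota v p = 0].

(* [K] is meant to be an algebraic closure of [k], embedded by [iota].  A
   (reduced, not necessarily irreducible) variety over [k] is described by its
   set of [K]-points, covered by finitely many affine charts defined over [k].
   [vchart i] is only meaningful on the affine algebraic set
   [zeros iota (veqs i)].  [vregular] says at once that the overlap of two
   charts is open in each of them and that the change of charts is regular,
   both over [k]; [vseparated] says that the diagonal is closed. *)
Record variety (k : fieldType) (K : closedFieldType)
  (iota : {rmorphism k -> K}) := Variety {
  vpoint :> Type;
  nchart : nat;
  vdim : 'I_nchart -> nat;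
  veqs : forall i, set (mpoly (vdim i) k);
  vchart : forall i, 'rV[K]_(vdim i) -> vpoint;
  vchart_inj : forall i, {in zeros iota (@veqs i) &, injective (@vchart i)};
  vchart_cover : forall a : vpoint,
    exists i, exists2 v, zeros iota (@veqs i) v & a = vchart v;
  vregular : forall i j v w,
    zeros iota (@veqs i) v -> zeros iota (@veqs j) w -> vchart v = vchart w ->
    exists (q : mpoly (vdim i) k) (p : 'I_(vdim j) -> mpoly (vdim i) k),
      evalp iota v q != 0 /\
      forall v', zeros iota (@veqs i) v' -> evalp iota v' q != 0 ->
        let w' := \row_l (evalp iota v' (p l) / evalp iota v' q) in
        zeros iota (@veqs j) w' /\ vchart v' = vchart w';
  vseparated : forall i j,
    exists E : set (mpoly (vdim i + vdim j) k),
      forall v w, zeros iota (@veqs i) v -> zeros iota (@veqs j) w ->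
        (vchart v = vchart w <-> zeros iota E (row_mx v w))
}.

Arguments vdim {k K iota v} i : rename.
Arguments veqs {k K iota v} i : rename.
Arguments vchart {k K iota v} {i} _ : rename.

Definition var_closed (k : fieldType) (K : closedFieldType)
  (iota : {rmorphism k -> K}) (A : variety iota) (Z : set A) : Prop :=
  forall i, exists E : set (mpoly (vdim (v := A) i) k),
    forall v, zeros iota (veqs i) v -> (Z (vchart v) <-> zeros iota E v).

Definition rational_point (k : fieldType) (K : closedFieldType)
  (iota : {rmorphism k -> K}) (A : variety iota) : set A :=
  [set a | exists i, exists2 v : 'rV[k]_(vdim i),
     zeros iota (veqs i) (map_mx iota v) & a = vchart (map_mx iota v)].

Definition kpoints (k : fieldType) (K : closedFieldType)
  (iota : {rmorphism k -> K}) (A : variety iota) : Type :=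
  set_type (@rational_point k K iota A).

Definition kpoints_closed (k : fieldType) (K : closedFieldType)
  (iota : {rmorphism k -> K}) (A : variety iota) (S : set (kpoints A)) : Prop :=
  exists2 Z : set A, var_closed Z & S = [set a | Z (set_val a)].

Section AffineLine.
Variables (k : fieldType) (K : closedFieldType) (iota : {rmorphism k -> K}).

Let dim1 (i : 'I_1) : nat := 1.
Let noeq (i : 'I_1) : set (mpoly (dim1 i) k) := set0.
Let chart1 (i : 'I_1) (v : 'rV[K]_(dim1 i)) : K := v 0 0.

Lemma affine_line_inj i :
  {in zeros iota (@noeq i) &, injective (@chart1 i)}.
Proof.
by move=> v w _ _ vw; apply/rowP => j; rewrite (ord1 j); exact: vw.
Qed.

Lemma affine_line_cover (a : K) :
  exists i, exists2 v, zeros iota (@noeq i) v & a = chart1 v.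
Proof. by exists ord0, (\row__ a); rewrite /chart1 ?mxE. Qed.

Lemma affine_line_regular i j v w :
  zeros iota (@noeq i) v -> zeros iota (@noeq j) w -> chart1 v = chart1 w ->
  exists (q : mpoly (dim1 i) k) (p : 'I_(dim1 j) -> mpoly (dim1 i) k),
    evalp iota v q != 0 /\
    forall v', zeros iota (@noeq i) v' -> evalp iota v' q != 0 ->
      let w' := \row_l (evalp iota v' (p l) / evalp iota v' q) in
      zeros iota (@noeq j) w' /\ chart1 v' = chart1 w'.
Proof.
move=> _ _ _; exists 1, (fun l => mpolyX k (mnm1 l)); rewrite /evalp.
split; first by rewrite rmorph1 oner_eq0.
move=> v' _ _ /=; split=> //.
rewrite /chart1 mxE rmorph1 mmapX divr1 mmap1U //.
Qed.

Lemma affine_line_separated i j :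
  exists E : set (mpoly (dim1 i + dim1 j) k),
    forall v w, zeros iota (@noeq i) v -> zeros iota (@noeq j) w ->
      (chart1 v = chart1 w <-> zeros iota E (row_mx v w)).
Proof.
exists [set mpolyX k (mnm1 (lshift 1 ord0)) - mpolyX k (mnm1 (rshift 1 ord0))].
move=> v w _ _; rewrite /chart1; split.
  move=> e _ ->; rewrite /evalp rmorphB /= !mmapX !mmap1U.
  by rewrite row_mxEl row_mxEr e subrr.
move=> /(_ _ erefl); rewrite /evalp rmorphB /= !mmapX !mmap1U.
by rewrite row_mxEl row_mxEr => /eqP; rewrite subr_eq0 => /eqP.
Qed.

Definition affine_line : variety iota :=
  Variety affine_line_inj affine_line_cover affine_line_regular
    affine_line_separated.

Lemma affine_line_rational (t : k) : rational_point (iota t : affine_line).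
Proof.
by exists ord0, (\row__ t) => //; rewrite /= /chart1 !mxE.
Qed.

Definition affine_line_point (t : k) : kpoints affine_line :=
  SigSub (mem_set (affine_line_rational t)).

End AffineLine.

(* Polynomials in the coordinates of [P^n] whose coefficients are polynomials in
   the coordinates of an affine chart. *)
Definition evalf (L : fieldType) (K : fieldType) (iota : L -> K) (m n : nat)
  (v : 'rV[K]_m) (x : pspace n K) (p : mpoly n.+1 (mpoly m L)) : K :=
  mmap (evalp iota v) (fun i => hcoord x 0 i) p.

Section Families.
Variables (k : fieldType) (K : closedFieldType) (iota : {rmorphism k -> K}).
Variables (A : variety iota) (n : nat).

(* Open subsets of [A x P^n] over [K]. *)
Definition prod_open (U : set (A * pspace n K)) : Prop :=
  forall i (v : 'rV[K]_(vdim i)) x, zeros iota (veqs i) v -> U (vchart v, x) ->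
    exists d (q : mpoly n.+1 (mpoly (vdim i) K)),
      [/\ homogeneous d q, evalf idfun v x q != 0 &
          forall v' x', zeros iota (veqs i) v' -> evalf idfun v' x' q != 0 ->
            U (vchart v', x')].

(* [F : U -> P^n] is a morphism defined over [k]: near each point of [U] it is
   given by forms with coefficients in [k]. *)
Definition regular_on (U : set (A * pspace n K))
  (F : A -> pspace n K -> pspace n K) : Prop :=
  forall i (v : 'rV[K]_(vdim i)) x, zeros iota (veqs i) v -> U (vchart v, x) ->
    exists d (h : 'I_n.+1 -> mpoly n.+1 (mpoly (vdim i) k)),
      [/\ forall j, homogeneous d (h j),
          exists j, evalf iota v x (h j) != 0 &
          forall v' x', zeros iota (veqs i) v' -> U (vchart v', x') ->
            (exists j, evalf iota v' x' (h j) != 0) ->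
            proportional (\row_j evalf iota v' x' (h j))
                         (hcoord (F (vchart v') x'))].

(* An [A]-birational transformation of [A x P^n] defined over [k] and inducing
   an isomorphism [(a, x) |-> (a, bf_fun a x)] from [bf_dom] to [bf_cod]. *)
Record bir_family := BirFamily {
  bf_dom : set (A * pspace n K);
  bf_cod : set (A * pspace n K);
  bf_fun : A -> pspace n K -> pspace n K;
  bf_inv : A -> pspace n K -> pspace n K;
  bf_dom_open : prod_open bf_dom;
  bf_cod_open : prod_open bf_cod;
  bf_dom_surj : forall a, exists x, bf_dom (a, x);
  bf_cod_surj : forall a, exists x, bf_cod (a, x);
  bf_funK : forall a x, bf_dom (a, x) ->
    bf_cod (a, bf_fun a x) /\ bf_inv a (bf_fun a x) = x;
  bf_invK : forall a x, bf_cod (a, x) ->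
    bf_dom (a, bf_inv a x) /\ bf_fun a (bf_inv a x) = x;
  bf_fun_regular : regular_on bf_dom bf_fun;
  bf_inv_regular : regular_on bf_cod bf_inv
}.

(* The rational map [x |-> p_2 (f (a, x))] of [P^n] is [g]: the two agree on the
   intersection of the fibre of [bf_dom f] over [a] with the open set where the
   forms defining [g] do not all vanish, which is dense in [P^n]. *)
Definition fiber_is (f : bir_family) (a : A) (g : Bir n k) : Prop :=
  forall x, bf_dom f (a, x) ->
    let w := \row_j evalp iota (hcoord x) (tnth (forms_of g) j) in
    w != 0 -> proportional w (hcoord (bf_fun f a x)).

(* A [k]-morphism from [A] to [Bir] is seen through the map [A(k) -> Bir(k)] that
   it induces, which is what both the topology and [rho(0)], [rho(1)] refer to. *)
Definition is_bir_morphism (rho : kpoints A -> Bir n k) : Prop :=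
  exists f : bir_family, forall a, fiber_is f (set_val a) (rho a).

End Families.

Definition bir_zariski_closed (n : nat) (k : fieldType) (K : closedFieldType)
  (iota : {rmorphism k -> K}) (F : set (Bir n k)) : Prop :=
  forall (A : variety iota) (rho : kpoints A -> Bir n k),
    is_bir_morphism rho -> kpoints_closed (rho @^-1` F).

Definition bir_zariski (n : nat) (k : fieldType) (K : closedFieldType)
  (iota : {rmorphism k -> K}) : Type := Bir n k.

Section ZariskiTopology.
Variables (n : nat) (k : fieldType) (K : closedFieldType).
Variable iota : {rmorphism k -> K}.

Lemma evalpM m (v : 'rV[K]_m) (p q : mpoly m k) :
  evalp iota v (p * q) = evalp iota v p * evalp iota v q.
Proof. exact: rmorphM. Qed.

Lemma kpoints_closed0 (A : variety iota) : kpoints_closed (@set0 (kpoints A)).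
Proof.
exists set0 => //; move=> i; exists setT => v _; split=> // /(_ 1 I)/eqP.
by rewrite /evalp rmorph1 oner_eq0.
Qed.

Lemma kpoints_closedU (A : variety iota) (S T : set (kpoints A)) :
  kpoints_closed S -> kpoints_closed T -> kpoints_closed (S `|` T).
Proof.
move=> [Y cY ->] [Z cZ ->]; exists (Y `|` Z) => // i.
have [E hE] := cY i; have [F hF] := cZ i.
exists [set r | exists p q, [/\ E p, F q & r = p * q]] => v hv; split.
  move=> [/(hE _ hv) z|/(hF _ hv) z] _ [p [q [Ep Fq ->]]].
    by rewrite evalpM (z _ Ep) mul0r.
  by rewrite evalpM (z _ Fq) mulr0.
move=> z; have [?|nY] := pselect (Y (vchart v)); [by left|right].
apply/(hF _ hv) => q Fq; apply: contrapT => /eqP q0; apply: nY.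
apply/(hE _ hv) => p Ep; apply/eqP.
have /eqP := z (p * q) (ex_intro _ p (ex_intro _ q (And3 Ep Fq erefl))).
by rewrite evalpM mulf_eq0 (negbTE q0) orbF.
Qed.

Lemma kpoints_closed_bigI (A : variety iota) (I : Type)
  (S : I -> set (kpoints A)) :
  (forall i, kpoints_closed (S i)) -> kpoints_closed (\bigcap_i S i).
Proof.
move=> cS.
have {}cS i : {Z : set A | var_closed Z & S i = [set a | Z (set_val a)]}.
  by apply: cid2; exact: cS.
have SE i a : S i a = s2val (cS i) (set_val a) by case: (cS i) => Z /= _ ->.
have SC i : var_closed (s2val (cS i)) by case: (cS i).
exists (\bigcap_i s2val (cS i)); last first.
  by apply/seteqP; split=> a /= h i J; have := h i J; rewrite SE.
move=> j.
exists [set p | exists i, forall v, zeros iota (veqs j) v ->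
                  s2val (cS i) (vchart v) -> evalp iota v p = 0].
move=> v hv; split=> [h p [i pi]|z i _]; first by apply: pi => //; exact: h.
have [E hE] := SC i j; apply/(hE _ hv) => p Ep; apply: z.
by exists i => w hw /(hE _ hw) hZ; exact: hZ.
Qed.

Let zopen (U : set (bir_zariski n iota)) : Prop :=
  bir_zariski_closed iota (~` U).

Lemma zopenT : zopen setT.
Proof.
by move=> A rho _; rewrite setCT preimage_set0; exact: kpoints_closed0.
Qed.

Lemma zopenI : setI_closed zopen.
Proof.
move=> U V hU hV A rho hrho; rewrite setCI preimage_setU.
by apply: kpoints_closedU; [exact: hU | exact: hV].
Qed.

Lemma zopen_bigU (I : Type) (U : I -> set (bir_zariski n iota)) :
  (forall i, zopen (U i)) -> zopen (\bigcup_i U i).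
Proof.
move=> hU A rho hrho; rewrite setC_bigcup preimage_bigcap.
by apply: kpoints_closed_bigI => i; exact: hU.
Qed.

HB.instance Definition _ := Choice.on (bir_zariski n iota).
HB.instance Definition _ :=
  isOpenTopological.Build (bir_zariski n iota) zopenT zopenI zopen_bigU.

End ZariskiTopology.

Definition path_connected (R : realType) (T : topologicalType) : Prop :=
  forall x y : T, exists gamma : R -> T,
    [/\ {within `[0, 1], continuous gamma}, gamma 0 = x & gamma 1 = y].

Definition monomial (n d : nat) : Type :=
  {m : bmultinom n.+1 d.+1 | mdeg m == d}.

HB.instance Definition _ n d := Finite.on (monomial n d).

(* The vector space of [n + 1]-tuples of forms of degree [d], given by their
   coefficients. *)
Notation coefs n k d := 'M[k]_(n.+1, #|{: monomial n d}|).

Definition tforms_of_coefs (n : nat) (k : fieldType) (d : nat)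
  (c : coefs n k d) : tforms n k :=
  [tuple \sum_(m : monomial n d)
     c i (enum_rank m) *: mpolyX k (bmnm (val m)) | i < n.+1].

Section Euclidean.
Variables (n : nat) (k : numFieldType).

Definition Wspace (d : nat) : Type :=
  quotient_topology (proj (coefs n k d)).

HB.instance Definition _ d := Topological.on (Wspace d).

Definition Hspace (d : nat) : set (Wspace d) :=
  [set w | birational (tforms_of_coefs (hcoord w))].

Definition bir_pi (d : nat) (w : set_type (@Hspace d)) : Bir n k :=
  bir_class (set_valP w).

(* The transformations of degree at most [d]: a form of higher degree can be
   obtained from one of lower degree by multiplying by a common factor. *)
Definition bir_deg_le (d : nat) : set (Bir n k) := range (@bir_pi d).

(* [S] is open for the quotient topology on [bir_deg_le d]. *)
Definition bir_deg_open (d : nat) (S : set (Bir n k)) : Prop :=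
  open (@bir_pi d @^-1` S).

Definition bir_euclidean : Type := Bir n k.

Let eopen (S : set bir_euclidean) : Prop :=
  forall d, (0 < d)%N -> bir_deg_open d (S `&` bir_deg_le d).

Lemma bir_deg_preimage d S :
  @bir_pi d @^-1` (S `&` bir_deg_le d) = @bir_pi d @^-1` S.
Proof. by apply/seteqP; split=> [w []//|w Sw]; split=> //; exists w. Qed.

Lemma eopenT : eopen setT.
Proof.
by move=> d _; rewrite /bir_deg_open bir_deg_preimage preimage_setT; exact: openT.
Qed.

Lemma eopenI : setI_closed eopen.
Proof.
move=> S T hS hT d d0; rewrite /bir_deg_open bir_deg_preimage preimage_setI.
move: (hS d d0) (hT d d0); rewrite /bir_deg_open !bir_deg_preimage.
exact: openI.
Qed.

Lemma eopen_bigU (I : Type) (S : I -> set bir_euclidean) :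
  (forall i, eopen (S i)) -> eopen (\bigcup_i S i).
Proof.
move=> hS d d0; rewrite /bir_deg_open bir_deg_preimage preimage_bigcup.
apply: bigcup_open => i _; move: (hS i d d0).
by rewrite /bir_deg_open bir_deg_preimage.
Qed.

HB.instance Definition _ := Choice.on bir_euclidean.
HB.instance Definition _ :=
  isOpenTopological.Build bir_euclidean eopenT eopenI eopen_bigU.

End Euclidean.

(* Main.v *)
From HB Require Import structures.
Require Import Defs.
From mathcomp Require Import ring.
From mathcomp Require Import Rstruct.

Set Implicit Arguments.
Unset Strict Implicit.
Unset Printing Implicit Defensive.

Import Order.TTheory GRing.Theory Num.Theory.
Import numFieldNormedType.Exports.
Local Open Scope ring_scope.
Local Open Scope classical_set_scope.
Local Open Scope quotient_scope.

(** Birational transformations are handled through pairs of mutually inverse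
    tuples of forms [H] and [G]: [G o H = P . id] and [H o G = Q . id] for some
    multipliers [P] and [Q].  Over the ring [k[t]] such a pair is a family of
    birational transformations, provided that [P] vanishes identically on no
    geometric fibre ([family]).  Two transformations are linked when they are
    the fibres at [0] and [1] of such a family; families can be composed, so
    everything reduces to linking each [h] with the identity ([linked_all]).

    If [h] fixes the point [e_0] and is a local isomorphism there, conjugating
    it by [diag(1, t, ..., t)] gives a family over the whole affine line: on
    forms, the conjugate of [h] is divisible by [t] exactly where needed, and
    its fibre at [t = 0] is the differential of [h] at [e_0], a linear map
    ([contract_family], [fiber_contract0]).  A general [h] is moved to this
    situation by linear maps on both sides.  The linear group is generated by
    the pseudo-reflections [x + v(x) u] ([unitmx_pseudorefl_ind]); the one with
    multiplier [la = 1 + v(u)] is linked to the identity by letting the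
    multiplier run through [1 + (la - 1) t + (la - 1) t (t - 1) y / z], where
    [y] and [z] are independent linear forms that vanish on [u].  As a function
    on projective space this is never identically zero, whatever [t].  Such
    forms exist as soon as [n >= 2] ([linked_pseudorefl]); for [n = 1] one uses
    [1 + (la - 1) t], whose zero has to be removed from the line
    ([linked_pseudorefl_line]).

    A link over the line, or over the complement of finitely many points, is a
    morphism to the Cremona group ([linked_morphism]): the open sets of the
    definition are the loci where [P] and [Q] do not vanish.  A closed subset of
    the rational points of such a curve is finite or everything, whence
    connectedness for the Zariski topology for every [n >= 1]
    ([zariski_connected]).  Over the real and complex numbers the coefficients
    of the forms depend polynomially on [t] in [[0, 1]], whence a continuous
    path ([euclidean_path_continuous]).

    On the real projective line [id] and [x |-> - x] are not joined by a
    morphism from the affine line.  A birational map of the line is given by a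
    matrix ([birational_line_linear]).  The sign of its determinant is the
    effect of the map on the cyclic orientation of three points, and hence is
    locally constant in a family over the real line ([sg_det_constant]). *)
(** * Evaluation and substitution of forms *)

Local Notation forms n A := (n.+1.-tuple (mpoly n.+1 A)).
Local Notation mX i := (mpolyX _ (mnm1 i)).
Local Notation "p \mPo h" := (comp_mpoly h p) (at level 50).

(** Evaluation, substitution and change of coefficients are all instances of
    [mmap]; their mutual compatibilities all come from this one. *)
Lemma rmorph_mmap m (A S T : nzRingType) (g : A -> S) (v : 'I_m -> S)
    (f : {rmorphism S -> T}) p :
  f (mmap g v p) = mmap (f \o g) (f \o v) p.
Proof.
rewrite /mmap raddf_sum /=; apply: eq_bigr => m' _.
rewrite rmorphM; congr (_ * _); rewrite /mmap1 rmorph_prod.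
by apply: eq_bigr => i _; rewrite rmorphXn.
Qed.

Lemma eq_mmap m (A S : nzRingType) (g g' : A -> S) (v v' : 'I_m -> S) p :
  g =1 g' -> v =1 v' -> mmap g v p = mmap g' v' p.
Proof.
move=> eg ev; rewrite /mmap; apply: eq_bigr => m' _.
by rewrite eg; congr (_ * _); apply: mmap1_eq.
Qed.

Lemma map_mpolyEmmap m (A S : nzRingType) (f : A -> S) (p : mpoly m A) :
  map_mpoly f p = mmap (@mpolyC m S \o f) (fun i => mX i) p.
Proof. by []. Qed.

Section Substitution.
Variables (m : nat) (A : comNzRingType).

Lemma mmap_comp l (S : comNzRingType) (g : {rmorphism A -> S}) (v : 'I_l -> S)
    (h : m.-tuple (mpoly l A)) (p : mpoly m A) :
  mmap g v (p \mPo h) = mmap g (fun i => mmap g v (tnth h i)) p.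
Proof.
by rewrite /comp_mpoly rmorph_mmap; apply: eq_mmap => // c; exact: mmapC.
Qed.

Lemma mmap_map (B S : comNzRingType) (f : {rmorphism A -> B})
    (g : {rmorphism B -> S}) (v : 'I_m -> S) (p : mpoly m A) :
  mmap g v (map_mpoly f p) = mmap (g \o f) v p.
Proof.
rewrite map_mpolyEmmap rmorph_mmap; apply: eq_mmap => [c|i] /=.
  exact: mmapC.
by rewrite mmapX mmap1U.
Qed.

Lemma map_map_mpoly (B C : comNzRingType) (f : {rmorphism A -> B})
    (g : {rmorphism B -> C}) (p : mpoly m A) :
  map_mpoly g (map_mpoly f p) = map_mpoly (g \o f) p.
Proof. by apply/mpolyP => u; rewrite !mcoeff_map_mpoly. Qed.

Lemma eq_map_mpoly (B : comNzRingType) (f g : {rmorphism A -> B}) :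
  f =1 g -> map_mpoly f =1 @map_mpoly m A B g.
Proof. by move=> e p; apply/mpolyP => u; rewrite !mcoeff_map_mpoly; exact: e. Qed.

Lemma comp_mpolyA l r (h : m.-tuple (mpoly l A)) (g : l.-tuple (mpoly r A)) p :
  (p \mPo h) \mPo g = p \mPo [tuple (tnth h i) \mPo g | i < m].
Proof.
rewrite {3}/comp_mpoly {2}/comp_mpoly rmorph_mmap; apply: eq_mmap => [c|i] /=.
  exact: comp_mpolyC.
by rewrite tnth_mktuple.
Qed.

Lemma map_comp_mpoly (B : comNzRingType) l (f : {rmorphism A -> B})
    (h : m.-tuple (mpoly l A)) p :
  map_mpoly f (p \mPo h) =
  map_mpoly f p \mPo [tuple map_mpoly f (tnth h i) | i < m].
Proof.
rewrite map_mpolyEmmap mmap_comp /comp_mpoly mmap_map; apply: eq_mmap => // i.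
by rewrite tnth_mktuple.
Qed.

Lemma comp_mX l (h : m.-tuple (mpoly l A)) i : mX i \mPo h = tnth h i.
Proof. by rewrite /comp_mpoly mmapX mmap1U. Qed.

Lemma map_mX (B : comNzRingType) (f : {rmorphism A -> B}) i :
  map_mpoly f (mX i) = mX i :> mpoly m B.
Proof. exact: map_mpolyX. Qed.

Lemma comp_mpoly_forms_id (p : mpoly m A) : p \mPo [tuple mX i | i < m] = p.
Proof. exact: comp_mpoly_id. Qed.

Lemma meval_mmap v (p : mpoly m A) : meval v p = mmap idfun v p.
Proof. by []. Qed.

End Substitution.

Lemma homogeneousP m (A : nzRingType) d (p : mpoly m A) :
  reflect (forall u, mcoeff u p != 0 -> mdeg u = d) (homogeneous d p).
Proof.
apply: (iffP (dhomogP _ _ _)) => h u; last by rewrite mcoeff_msupp; exact: h.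
by rewrite -mcoeff_msupp; exact: h.
Qed.

Section Homogeneous.
Variables (m : nat) (A : comNzRingType).

Lemma homogeneous_mX i : homogeneous 1 (mX i : mpoly m A).
Proof. by rewrite /homogeneous dhomogX /= mdeg1. Qed.

Lemma homogeneousM d e (p q : mpoly m A) :
  homogeneous d p -> homogeneous e q -> homogeneous (d + e) (p * q).
Proof. exact: dhomogM. Qed.

Lemma homogeneousX d k (p : mpoly m A) :
  homogeneous d p -> homogeneous (d * k) (p ^+ k).
Proof. exact: dhomogMn. Qed.

Lemma homogeneousD d (p q : mpoly m A) :
  homogeneous d p -> homogeneous d q -> homogeneous d (p + q).
Proof. exact: dhomogD. Qed.

Lemma homogeneousZ d (c : A) (p : mpoly m A) :
  homogeneous d p -> homogeneous d (c *: p).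
Proof. exact: dhomogZ. Qed.

Lemma homogeneous_sum d I (r : seq I) (P : pred I) (F : I -> mpoly m A) :
  (forall i, P i -> homogeneous d (F i)) ->
  homogeneous d (\sum_(i <- r | P i) F i).
Proof.
move=> h; elim/big_rec: _ => [|i x Pi hx]; first exact: dhomog0.
exact: homogeneousD (h i Pi) hx.
Qed.

End Homogeneous.

Section HomogeneousSubstitution.
Variables (m : nat) (A : comNzRingType).

Lemma homogeneous_map (B : comNzRingType) (f : {rmorphism A -> B}) d (p : mpoly m A) :
  homogeneous d p -> homogeneous d (map_mpoly f p : mpoly m B).
Proof.
move/homogeneousP => h; apply/homogeneousP => u; rewrite mcoeff_map_mpoly => nz.
by apply: h; apply: contraNneq nz => ->; rewrite raddf0.
Qed.

Lemma homogeneous_comp l d e (p : mpoly m A) (h : m.-tuple (mpoly l A)) :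
  homogeneous d p -> (forall i, homogeneous e (tnth h i)) ->
  homogeneous (d * e) (p \mPo h).
Proof.
move=> hp hh; rewrite /comp_mpoly /mmap big_seq; apply: homogeneous_sum => u.
move=> /(dhomog_mf hp) /= udeg; rewrite mul_mpolyC; apply: homogeneousZ.
rewrite /mmap1 -udeg mdegE big_distrl /=.
elim/big_rec2: _ => [|i a b _ ab]; first exact: dhomog1.
by apply: homogeneousM => //; rewrite mulnC; exact: homogeneousX.
Qed.

Lemma mmap_scale (S : comNzRingType) (f : {rmorphism A -> S}) (c : S) v d p :
  homogeneous d p -> mmap f (fun i : 'I_m => c * v i) p = c ^+ d * mmap f v p.
Proof.
move=> hp; rewrite /mmap mulr_sumr big_seq [RHS]big_seq; apply: eq_bigr => u.
move=> /(dhomog_mf hp) /= <-; rewrite mulrCA; congr (_ * _).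
rewrite /mmap1 mdegE -prodrXr -big_split /=.
by apply: eq_bigr => i _; rewrite exprMn.
Qed.

End HomogeneousSubstitution.

Lemma comp_scale m l (A : comNzRingType) d (p : mpoly m A) (c : mpoly l A)
    (h : m.-tuple (mpoly l A)) :
  homogeneous d p ->
  p \mPo [tuple c * tnth h i | i < m] = c ^+ d * (p \mPo h).
Proof.
move=> hp; rewrite /comp_mpoly -(mmap_scale (mpolyC l (R:=A)) _ _ hp).
by apply: eq_mmap => // i; rewrite tnth_mktuple.
Qed.

Section MonomialFactor.
Variables (m : nat) (A : comNzRingType) (w : multinom m).

(** A polynomial all of whose monomials are multiples of [X^w] is divisible by
    [X^w]; this replaces unique factorisation below. *)
Lemma mpolyX_factor (q : mpoly m A) :
  (forall u, u \in msupp q -> mpoly.lem w u) -> exists p, q = p * mpolyX A w.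
Proof.
move=> le_wq.
exists (\sum_(u <- msupp q) mcoeff u q *: mpolyX A (mnm_sub u w)).
rewrite [LHS]mpolyE mulr_suml big_seq [RHS]big_seq; apply: eq_bigr => u /le_wq wu.
by rewrite -scalerAl -mpolyXD submK.
Qed.

Lemma homogeneous_factor d (p : mpoly m A) :
  homogeneous d (p * mpolyX A w) -> p != 0 ->
  (mdeg w <= d)%N /\ homogeneous (d - mdeg w) p.
Proof.
move/homogeneousP => hp p0.
have {}hp u : mcoeff u p != 0 -> (mdeg w + mdeg u)%N = d.
  by move=> up; rewrite -mdegD; apply: hp; rewrite mcoeffMX.
split; last by apply/homogeneousP => u /hp <-; rewrite addKn.
have := mlead_supp p0; rewrite mcoeff_msupp => /hp <-; exact: leq_addr.
Qed.

End MonomialFactor.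

(** * Pairs of mutually inverse tuples of forms *)

Section FormsOperations.
Variables (n : nat) (A : comNzRingType).
Implicit Types (p : mpoly n.+1 A) (g h : forms n A).

Definition fid : forms n A := [tuple mX i | i < n.+1].
Definition fcomp g h : forms n A := [tuple tnth g i \mPo h | i < n.+1].
Definition fscale p h : forms n A := [tuple p * tnth h i | i < n.+1].
Definition fmap (B : comNzRingType) (f : A -> B) h : forms n B :=
  [tuple map_mpoly f (tnth h i) | i < n.+1].

Lemma tnth_fid i : tnth fid i = mX i.
Proof. exact: tnth_mktuple. Qed.

Lemma tnth_fcomp g h i : tnth (fcomp g h) i = tnth g i \mPo h.
Proof. exact: tnth_mktuple. Qed.

Lemma tnth_fscale p h i : tnth (fscale p h) i = p * tnth h i.
Proof. exact: tnth_mktuple. Qed.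

Lemma tnth_fmap (B : comNzRingType) (f : A -> B) h i :
  tnth (fmap f h) i = map_mpoly f (tnth h i).
Proof. exact: tnth_mktuple. Qed.

Lemma comp_fcomp p g h : p \mPo fcomp g h = (p \mPo g) \mPo h.
Proof. by rewrite comp_mpolyA. Qed.

Lemma comp_fid p : p \mPo fid = p.
Proof. exact: comp_mpoly_forms_id. Qed.

Lemma comp_fscale d p c h : homogeneous d p -> p \mPo fscale c h = c ^+ d * (p \mPo h).
Proof. exact: comp_scale. Qed.

Lemma map_fmap (B : comNzRingType) (f : {rmorphism A -> B}) p h :
  map_mpoly f (p \mPo h) = map_mpoly f p \mPo fmap f h.
Proof. exact: map_comp_mpoly. Qed.

End FormsOperations.

Arguments fid {n A}.

(** Two tuples of forms that are inverse to each other up to the multipliers [P]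
    and [Q].  The condition is an identity between polynomials, which makes
    sense over any ring and is preserved by specialisation; only the
    non-vanishing of [P] has to be checked separately. *)
Record cremona_pair n (A : comNzRingType) (d e : nat) (H G : forms n A)
    (P Q : mpoly n.+1 A) : Prop := CremonaPair {
  cp_deg_gt0 : (0 < d)%N;
  cp_inv_deg_gt0 : (0 < e)%N;
  cp_homog : forall i, homogeneous d (tnth H i);
  cp_inv_homog : forall i, homogeneous e (tnth G i);
  cp_mult_homog : homogeneous (d * e).-1 P;
  cp_inv_mult_homog : homogeneous (d * e).-1 Q;
  cp_compl : fcomp G H = fscale P fid;
  cp_compr : fcomp H G = fscale Q fid
}.

Lemma cremona_pair_sym n (A : comNzRingType) d e (H G : forms n A) P Q :
  cremona_pair d e H G P Q -> cremona_pair e d G H Q P.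
Proof. by case=> d0 e0 hH hG hP hQ GH HG; split; rewrite // mulnC. Qed.

Lemma cremona_pair_map n (A B : comNzRingType) (f : {rmorphism A -> B}) d e
    (H G : forms n A) P Q :
  cremona_pair d e H G P Q ->
  cremona_pair d e (fmap f H) (fmap f G) (map_mpoly f P) (map_mpoly f Q).
Proof.
have comp_map (K L : forms n A) R : fcomp K L = fscale R fid ->
    fcomp (fmap f K) (fmap f L) = fscale (map_mpoly f R) fid.
  move=> KL; apply: eq_from_tnth => i.
  rewrite tnth_fcomp tnth_fmap -map_fmap -tnth_fcomp KL !tnth_fscale !tnth_fid.
  by rewrite rmorphM /= map_mX.
case=> d0 e0 hH hG hP hQ GH HG; split=> // [i|i||||].
- by rewrite tnth_fmap; exact: homogeneous_map.
- by rewrite tnth_fmap; exact: homogeneous_map.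
- exact: homogeneous_map.
- exact: homogeneous_map.
- exact: comp_map.
- exact: comp_map.
Qed.

(** Both [G2 o (G1 o H1) o H2] and its mirror image collapse from the inside:
    the multiplier of the inner pair comes out of the outer form raised to the
    degree of that form. *)
Lemma cremona_pair_comp n (A : comNzRingType) d1 e1 d2 e2
    (H1 G1 H2 G2 : forms n A) P1 Q1 P2 Q2 :
  cremona_pair d1 e1 H1 G1 P1 Q1 -> cremona_pair d2 e2 H2 G2 P2 Q2 ->
  cremona_pair (d1 * d2) (e2 * e1) (fcomp H1 H2) (fcomp G2 G1)
    ((P1 \mPo H2) ^+ e2 * P2) ((Q2 \mPo G1) ^+ d1 * Q1).
Proof.
have key : forall d1 e1 d2 e2 (H1 G1 H2 G2 : forms n A) P1 Q1 P2 Q2,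
    cremona_pair d1 e1 H1 G1 P1 Q1 -> cremona_pair d2 e2 H2 G2 P2 Q2 ->
    homogeneous (d1 * d2 * (e2 * e1)).-1 ((P1 \mPo H2) ^+ e2 * P2) /\
    fcomp (fcomp G2 G1) (fcomp H1 H2) = fscale ((P1 \mPo H2) ^+ e2 * P2) fid.
  move=> {}d1 {}e1 {}d2 {}e2 {}H1 {}G1 {}H2 {}G2 {}P1 {}Q1 {}P2 {}Q2.
  case=> d10 e10 hH1 hG1 hP1 _ GH1 _ [d20 e20 hH2 hG2 hP2 _ GH2 _].
  split.
    have -> : ((d1 * d2 * (e2 * e1)).-1
               = (d1 * e1).-1 * d2 * e2 + (d2 * e2).-1)%N.
      have de1 : (0 < d1 * e1)%N by rewrite muln_gt0 d10.
      have de2 : (0 < d2 * e2)%N by rewrite muln_gt0 d20.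
      rewrite (mulnC e2) mulnACA; case: (d1 * e1)%N de1 => // a _.
      by rewrite -mulnA; case: (d2 * e2)%N de2 => // b _; rewrite mulSn addSn addnC.
    apply: homogeneousM => //; apply: homogeneousX; exact: homogeneous_comp.
  apply: eq_from_tnth => i.
  rewrite !tnth_fcomp comp_mpolyA.
  have -> : [tuple tnth G1 i0 \mPo fcomp H1 H2 | i0 < n.+1]
            = fscale (P1 \mPo H2) H2.
    apply: eq_from_tnth => j; rewrite tnth_mktuple comp_fcomp -tnth_fcomp GH1.
    by rewrite !tnth_fscale tnth_fid rmorphM /= comp_mX.
  rewrite (comp_fscale _ _ (hG2 i)) -tnth_fcomp GH2 !tnth_fscale.
  by rewrite mulrA.
move=> p1 p2.
have [hP compP] := key _ _ _ _ _ _ _ _ _ _ _ _ p1 p2.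
have [hQ compQ] := key _ _ _ _ _ _ _ _ _ _ _ _ (cremona_pair_sym p2)
  (cremona_pair_sym p1).
split=> // [|| i | i |].
- by rewrite muln_gt0 (cp_deg_gt0 p1) (cp_deg_gt0 p2).
- by rewrite muln_gt0 (cp_inv_deg_gt0 p1) (cp_inv_deg_gt0 p2).
- rewrite tnth_fcomp; exact: homogeneous_comp (cp_homog p1 i) (cp_homog p2).
- rewrite tnth_fcomp.
  exact: homogeneous_comp (cp_inv_homog p2 i) (cp_inv_homog p1).
- by rewrite mulnC.
Qed.

Section Domain.
Variables (n : nat) (A : idomainType).

Lemma comp_homog0 d (p : mpoly n.+1 A) (h : forms n A) :
  homogeneous d p -> (0 < d)%N -> (forall i, tnth h i = 0) -> p \mPo h = 0.
Proof.
move=> hp d0 h0; have -> : h = fscale 0 h.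
  by apply: eq_from_tnth => i; rewrite tnth_fscale h0 mul0r.
by rewrite (comp_fscale _ _ hp) expr0n gtn_eqF // mul0r.
Qed.

Lemma mX_neq0 i : mX i != 0 :> mpoly n.+1 A.
Proof.
apply/eqP => /(congr1 (mcoeff (mnm1 i))); rewrite mcoeffX eqxx mcoeff0.
by apply/eqP; rewrite oner_eq0.
Qed.

Lemma cremona_pair_neq0 d e (H G : forms n A) P Q :
  cremona_pair d e H G P Q -> P != 0 -> exists i, tnth H i != 0.
Proof.
move=> p P0; apply: contrapT => /forallNP nH.
have := congr1 (fun h => tnth h ord0) (cp_compl p).
rewrite tnth_fcomp (comp_homog0 (cp_inv_homog p ord0)).
- rewrite tnth_fscale tnth_fid => /esym/eqP.
  by rewrite mulf_eq0 (negbTE P0) (negbTE (mX_neq0 _)).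
- exact: (cp_inv_deg_gt0 p).
- by move=> i; apply/eqP; apply: contrapT => /negP; exact: nH.
Qed.

(** Computing [H o G o H] in the two possible ways. *)
Lemma cremona_pair_mult_comp d e (H G : forms n A) P Q :
  cremona_pair d e H G P Q -> P != 0 -> Q \mPo H = P ^+ d.
Proof.
move=> p P0; have [i Hi] := cremona_pair_neq0 p P0.
apply: (mulIf Hi); rewrite -{1}(comp_mX H i) -rmorphM /=.
have := tnth_fscale Q fid i; rewrite -(cp_compr p) tnth_fcomp tnth_fid => <-.
rewrite -comp_fcomp (cp_compl p) (comp_fscale _ _ (cp_homog p i)).
by rewrite comp_fid.
Qed.

Lemma cremona_pair_inv_mult_neq0 d e (H G : forms n A) P Q :
  cremona_pair d e H G P Q -> P != 0 -> Q != 0.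
Proof.
move=> p P0; apply/eqP => Q0; have := cremona_pair_mult_comp p P0.
by rewrite Q0 rmorph0 => /esym/eqP; rewrite expf_eq0 (negbTE P0) andbF.
Qed.

(** Substituting a dominant tuple into a non-zero form cannot give zero, since
    substituting its inverse recovers the form up to a non-zero factor. *)
Lemma cremona_pair_comp_neq0 d e (H G : forms n A) P Q r (p : mpoly n.+1 A) :
  cremona_pair d e H G P Q -> P != 0 -> homogeneous r p -> p != 0 ->
  p \mPo H != 0.
Proof.
move=> hp P0 homp p0; apply/eqP => /(congr1 (comp_mpoly G)).
rewrite rmorph0 -comp_fcomp (cp_compr hp) (comp_fscale _ _ homp) comp_fid.
move/eqP; rewrite mulf_eq0 (negbTE p0) orbF expf_eq0.
by rewrite (negbTE (cremona_pair_inv_mult_neq0 hp P0)) andbF.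
Qed.

End Domain.

(** ** Birational tuples over a field *)

Section Field.
Variables (n : nat) (k : fieldType).
Implicit Types (f g h : tforms n k).

Lemma same_ratmapP g h :
  reflect (forall i j, tnth g i * tnth h j = tnth g j * tnth h i)
          (same_ratmap g h).
Proof.
apply: (iffP forallP) => [e i j|e i]; first by move/forallP: (e i) => /(_ j)/eqP.
by apply/forallP => j; apply/eqP.
Qed.

Lemma same_ratmap_refl g : same_ratmap g g.
Proof. by apply/same_ratmapP => i j; rewrite mulrC. Qed.

Lemma same_ratmap_sym g h : same_ratmap g h -> same_ratmap h g.
Proof. by move/same_ratmapP => e; apply/same_ratmapP => i j; rewrite mulrC e mulrC. Qed.

Lemma same_ratmap_trans g h f l : tnth h l != 0 ->
  same_ratmap g h -> same_ratmap h f -> same_ratmap g f.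
Proof.
move=> hl /same_ratmapP e /same_ratmapP e'; apply/same_ratmapP => i j.
apply/(mulIf hl)/(mulIf hl).
transitivity ((tnth g i * tnth h l) * (tnth h l * tnth f j)); first by ring.
rewrite e (e' l j).
transitivity ((tnth g j * tnth h l) * (tnth h l * tnth f i)); last by ring.
by rewrite (e j l) (e' l i); ring.
Qed.

Lemma same_ratmap_scale (p : mpoly n.+1 k) h : same_ratmap (fscale p h) h.
Proof. by apply/same_ratmapP => i j; rewrite !tnth_fscale; ring. Qed.

Lemma same_ratmap_compl g g' h :
  same_ratmap g g' -> same_ratmap (fcomp g h) (fcomp g' h).
Proof.
move/same_ratmapP => e; apply/same_ratmapP => i j.
by rewrite !tnth_fcomp -!rmorphM e.
Qed.

(** Substituting proportional tuples in a form of degree [d]: with [g_l] and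
    [h_l] as the factors of proportionality, the two results differ by the
    [d]-th powers of these. *)
Lemma same_ratmap_compr d f g h l :
  (forall i, homogeneous d (tnth f i)) -> tnth g l != 0 ->
  same_ratmap g h -> same_ratmap (fcomp f g) (fcomp f h).
Proof.
move=> hf gl /same_ratmapP e.
have key i : tnth g l ^+ d * (tnth f i \mPo h) = tnth h l ^+ d * (tnth f i \mPo g).
  rewrite -!(comp_fscale _ _ (hf i)); congr (comp_mpoly _ _).
  by apply: eq_from_tnth => j; rewrite !tnth_fscale e mulrC.
apply/same_ratmapP => i j; rewrite !tnth_fcomp.
have gd : tnth g l ^+ d != 0 by rewrite expf_eq0 negb_and gl orbT.
have := key i; have := key j; move: gd.
move: (tnth f i \mPo g) (tnth f i \mPo h) (tnth f j \mPo g) (tnth f j \mPo h).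
move: (tnth g l ^+ d) (tnth h l ^+ d) => a b gi hi gj hj a0 ej ei; apply: (mulfI a0).
transitivity (gi * (a * hj)); first by ring.
rewrite ej; transitivity (gj * (b * gi)); first by ring.
by rewrite -ei; ring.
Qed.

Lemma cremona_pair_birational d e h g P Q :
  cremona_pair d e h g P Q -> P != 0 -> birational h.
Proof.
have key d' e' (h' g' : tforms n k) P' Q' : cremona_pair d' e' h' g' P' Q' ->
    P' != 0 -> [/\ ratmap h', ratmap (forms_comp g' h') &
                   same_ratmap (forms_comp g' h') (forms_id n k)].
  move=> p P0; have gh : forms_comp g' h' = fscale P' fid by exact: (cp_compl p).
  rewrite gh; split.
  - split; first by exists d'; exact: (cp_homog p).
    exact: cremona_pair_neq0 p P0.
  - split; first exists ((d' * e').-1 + 1)%N => i.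
      rewrite tnth_fscale tnth_fid; apply: homogeneousM (homogeneous_mX _ _).
      exact: (cp_mult_homog p).
    by exists ord0; rewrite tnth_fscale tnth_fid mulf_neq0 ?mX_neq0.
  - exact: same_ratmap_scale.
move=> p P0; have [? ? ?] := key _ _ _ _ _ _ p P0.
have [? ? ?] := key _ _ _ _ _ _ (cremona_pair_sym p)
  (cremona_pair_inv_mult_neq0 p P0).
by split=> //; exists g; split.
Qed.

(** [X_0] divides every monomial of [q_0]: otherwise the product of such a
    monomial by [X_1] would be a monomial of [q_1 X_0]. *)
Lemma proportional_to_id (q : forms n k) : (0 < n)%N ->
  same_ratmap q fid -> exists P, q = fscale P fid.
Proof.
move=> n0 /same_ratmapP e.
have {}e i j : tnth q i * mX j = tnth q j * mX i by have := e i j; rewrite !tnth_fid.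
pose j1 : 'I_n.+1 := inord 1.
have j10 : j1 != ord0 by rewrite -val_eqE /= inordK.
have supp u : u \in msupp (tnth q ord0) -> mpoly.lem (mnm1 ord0) u.
  move=> uq; apply/mnm_lepP => i; rewrite mnm1E; case: eqVneq => // <- {i}.
  have: mnm_add (mnm1 j1) u \in msupp (tnth q ord0 * mX j1).
    by rewrite (perm_mem (msuppMX _ _)); apply/mapP; exists u.
  rewrite e (perm_mem (msuppMX _ _)) => /mapP[w _].
  move/(congr1 (fun m => fun_of_multinom m ord0)).
  by rewrite !mnmDE !mnm1E eqxx (negbTE j10) add0n => ->.
have [P q0] := mpolyX_factor supp.
exists P; apply: eq_from_tnth => i; rewrite tnth_fscale tnth_fid.
by apply/(mulIf (mX_neq0 k ord0)); rewrite e q0; ring.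
Qed.

Lemma birational_cremona_pair h : (0 < n)%N -> birational h ->
  exists d e g P Q, cremona_pair d e h g P Q /\ P != 0.
Proof.
move=> n0 [[[d hd] _] [g [[[e he] _] [[_ [i gh0]] gh [_ [i' hg0]] hg]]]].
have [P eP] := proportional_to_id n0 gh; have [Q eQ] := proportional_to_id n0 hg.
have hcomp d' e' (h' g' : tforms n k) R j : (forall l, homogeneous d' (tnth h' l)) ->
    (forall l, homogeneous e' (tnth g' l)) -> tnth (fcomp h' g') j != 0 ->
    fcomp h' g' = fscale R fid ->
    [/\ (0 < d' * e')%N, homogeneous (d' * e').-1 R & R != 0].
  move=> hh' hg' nz eR; have R0 : R != 0.
    by apply: contraNneq nz => R0; rewrite eR R0 tnth_fscale mul0r.
  have: homogeneous (d' * e') (R * mX j).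
    rewrite -tnth_fid -tnth_fscale -eR tnth_fcomp; exact: homogeneous_comp.
  move/homogeneous_factor => hR; rewrite mdeg1 in hR.
  by have [le1 hR1] := hR R0; split; rewrite // -subn1.
have [de0 hP P0] := hcomp _ _ _ _ _ _ he hd gh0 eP.
have [_ hQ Q0] := hcomp _ _ _ _ _ _ hd he hg0 eQ.
move: de0; rewrite muln_gt0 => /andP[e0 d0].
by exists d, e, g, P, Q; split=> //; split=> //; rewrite mulnC.
Qed.

End Field.

(** * Families of birational tuples over the affine line *)

Section Specialisation.
Variables (k K : fieldType) (iota : {rmorphism k -> K}).

Definition spec (t : K) : {rmorphism {poly k} -> K} :=
  GRing.RMorphism.clone _ _ (horner_eval t \o map_poly iota) _.

Lemma specE t c : spec t c = (map_poly iota c).[t].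
Proof. by []. Qed.

Lemma specC t c : spec t c%:P = iota c.
Proof. by rewrite specE map_polyC /= hornerC. Qed.

Lemma specX t : spec t 'X = t.
Proof. by rewrite specE map_polyX hornerX. Qed.

Lemma spec_iota t c : spec (iota t) c = iota c.[t].
Proof. by rewrite specE horner_map. Qed.

End Specialisation.

Lemma spec_id (k : fieldType) (t : k) c : spec idfun t c = c.[t].
Proof. by rewrite specE map_poly_id. Qed.

(** The multiplier of a family may not vanish identically on any fibre outside
    the zeros of [D].  Fibres over all extension fields are considered, because
    a morphism to the Cremona group is a condition on all geometric points. *)
Definition family n (k : fieldType) (D : {poly k}) (H : forms n {poly k}) : Prop :=
  exists d e G P Q, cremona_pair d e H G P Q /\
    forall (K : fieldType) (iota : {rmorphism k -> K}) t,
      spec iota t D != 0 -> map_mpoly (spec iota t) P != 0.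

Definition fiber n (k : fieldType) (H : forms n {poly k}) (t : k) : tforms n k :=
  fmap (horner_eval t) H.

Section Families.
Variables (n : nat) (k : fieldType).
Implicit Types (H : forms n {poly k}) (h : tforms n k).

Lemma map_spec_id m t (p : mpoly m {poly k}) :
  map_mpoly (spec idfun t) p = map_mpoly (horner_eval t) p.
Proof. by apply: eq_map_mpoly => c; exact: spec_id. Qed.

Lemma fiberE H t : fiber H t = fmap (spec idfun t) H.
Proof. by apply: eq_from_tnth => i; rewrite !tnth_fmap map_spec_id. Qed.

Lemma fiber_fcomp F H t : fiber (fcomp F H) t = fcomp (fiber F t) (fiber H t).
Proof.
by apply: eq_from_tnth => i; rewrite tnth_fmap !tnth_fcomp tnth_fmap map_fmap.
Qed.

Lemma family_fiber D H t : family D H -> D.[t] != 0 ->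
  exists d e g P Q, cremona_pair d e (fiber H t) g P Q /\ P != 0.
Proof.
move=> [d [e [G [P [Q [p nz]]]]]] Dt; rewrite fiberE.
exists d, e, (fmap (spec idfun t) G), (map_mpoly (spec idfun t) P),
  (map_mpoly (spec idfun t) Q); split; first exact: cremona_pair_map.
by apply: nz; rewrite spec_id.
Qed.

Lemma family_fiber_birational D H t : family D H -> D.[t] != 0 ->
  birational (fiber H t).
Proof.
move=> fH Dt; have [d [e [g [P [Q [p P0]]]]]] := family_fiber fH Dt.
exact: cremona_pair_birational p P0.
Qed.

(** The multiplier of a composite is [P1(H2)^e2 P2].  On a fibre where [P1] and
    [P2] do not vanish it is non-zero, since [H2] is dominant there. *)
Lemma family_comp D1 D2 (H1 H2 : forms n {poly k}) :
  family D1 H1 -> family D2 H2 -> family (D1 * D2) (fcomp H1 H2).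
Proof.
move=> [d1 [e1 [G1 [P1 [Q1 [p1 nz1]]]]]] [d2 [e2 [G2 [P2 [Q2 [p2 nz2]]]]]].
exists (d1 * d2)%N, (e2 * e1)%N, (fcomp G2 G1), ((P1 \mPo H2) ^+ e2 * P2),
  ((Q2 \mPo G1) ^+ d1 * Q1); split; first exact: cremona_pair_comp.
move=> K iota t; rewrite rmorphM mulf_eq0 negb_or => /andP[Dt1 Dt2].
rewrite rmorphM mulf_neq0 ?nz2 //= rmorphXn expf_eq0 negb_and /= map_fmap.
rewrite (cremona_pair_comp_neq0 (cremona_pair_map (spec iota t) p2) (nz2 _ _ _ Dt2)
  (homogeneous_map _ (cp_mult_homog p1))) ?orbT //.
exact: nz1.
Qed.

Lemma map_mpoly_neq0 m (K : fieldType) (iota : {rmorphism k -> K})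
    (p : mpoly m k) : p != 0 -> map_mpoly iota p != 0.
Proof.
apply: contra_neq => e0; apply/mpolyP => u; apply/eqP.
by rewrite mcoeff0 -(fmorph_eq0 iota) -mcoeff_map_mpoly e0 mcoeff0.
Qed.

Lemma family_const d e h g P Q : cremona_pair d e h g P Q -> P != 0 ->
  family 1 (fmap polyC h).
Proof.
move=> p P0; exists d, e, (fmap polyC g), (map_mpoly polyC P), (map_mpoly polyC Q).
split=> [|K iota t _]; first exact: cremona_pair_map.
rewrite map_map_mpoly (eq_map_mpoly (g := iota)); last by move=> c; exact: specC.
exact: map_mpoly_neq0.
Qed.

Lemma fiber_const h t : fiber (fmap polyC h) t = h.
Proof.
apply: eq_from_tnth => i; rewrite !tnth_fmap; apply/mpolyP => u.
by rewrite !mcoeff_map_mpoly; exact: hornerC.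
Qed.

End Families.

(** ** Linked birational tuples *)

(** The denominators allowed in a link: [D = 1] gives families over the whole
    affine line, and all [D] that do not vanish at the two end points give
    families over an open subset. *)
Record admissible (k : fieldType) (S : set {poly k}) : Prop := Admissible {
  adm1 : S 1;
  admM : forall D D', S D -> S D' -> S (D * D');
  adm_end0 : forall D, S D -> D.[0] != 0;
  adm_end1 : forall D, S D -> D.[1] != 0
}.

Lemma admissible1 (k : fieldType) : admissible [set 1 : {poly k}].
Proof.
by split=> // [D D' -> ->|D ->|D ->]; rewrite ?hornerC ?oner_eq0 //= mulr1.
Qed.

Definition nonzero_ends (k : fieldType) : set {poly k} :=
  [set D | D.[0] != 0 /\ D.[1] != 0].

Lemma admissible_ends (k : fieldType) : admissible (@nonzero_ends k).
Proof.
split=> [|D D' [? ?] [? ?]|D []|D []] //; rewrite /nonzero_ends /=.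
  by rewrite !hornerC oner_eq0.
by rewrite !hornerM !mulf_neq0.
Qed.

(** End points are compared as rational maps, so that a link may end in a tuple
    with common factors. *)
Definition linked n (k : fieldType) (S : set {poly k}) (h h' : tforms n k) : Prop :=
  exists D H, [/\ S D, family D H, same_ratmap (fiber H 0) h &
                  same_ratmap (fiber H 1) h'].

Section Linked.
Variables (n : nat) (k : fieldType) (S : set {poly k}).
Hypothesis admS : admissible S.
Implicit Types f g h : tforms n k.

Lemma linked_refl h : (0 < n)%N -> birational h -> linked S h h.
Proof.
move=> n0 /(birational_cremona_pair n0)[d [e [g [P [Q [p P0]]]]]].
exists 1, (fmap polyC h); split; first exact: adm1 admS.
- exact: family_const p P0.
- by rewrite fiber_const same_ratmap_refl.
- by rewrite fiber_const same_ratmap_refl.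
Qed.

Lemma linked_same f f' g g' : ratmap f -> ratmap f' ->
  same_ratmap f g -> same_ratmap f' g' -> linked S f f' -> linked S g g'.
Proof.
move=> [_ [i fi]] [_ [j fj]] fg fg' [D [H [SD fH H0 H1]]].
exists D, H; split; [exact: SD | exact: fH | |].
- exact: same_ratmap_trans fi H0 fg.
- exact: same_ratmap_trans fj H1 fg'.
Qed.

(** On the left a composite may be changed within its class at no cost; on the
    right the forms that are substituted must not all vanish. *)
Lemma same_ratmap_fcomp f f' g g' : (0 < n)%N -> ratmap f' -> birational g ->
  same_ratmap f f' -> same_ratmap g g' ->
  same_ratmap (fcomp f g) (fcomp f' g').
Proof.
move=> n0 [[d hf'] [i fi]] /(birational_cremona_pair n0).
move=> [a [b [gi [P [Q [p P0]]]]]] ff' gg'.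
have [l gl] := cremona_pair_neq0 p P0.
apply: (@same_ratmap_trans _ _ _ (fcomp f' g) _ i).
- rewrite tnth_fcomp; exact: cremona_pair_comp_neq0 p P0 (hf' i) fi.
- exact: same_ratmap_compl.
- exact: same_ratmap_compr hf' gl gg'.
Qed.

Lemma linked_comp f f' g g' : (0 < n)%N -> ratmap f -> ratmap f' ->
  linked S f f' -> linked S g g' -> linked S (fcomp f g) (fcomp f' g').
Proof.
move=> n0 rf rf' [D1 [F [SD1 fF F0 F1]]] [D2 [G [SD2 fG G0 G1]]].
exists (D1 * D2), (fcomp F G); split.
- exact: (admM admS).
- exact: family_comp.
- rewrite fiber_fcomp; apply: same_ratmap_fcomp => //.
  exact: (family_fiber_birational fG (adm_end0 admS SD2)).
- rewrite fiber_fcomp; apply: same_ratmap_fcomp => //.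
  exact: (family_fiber_birational fG (adm_end1 admS SD2)).
Qed.

End Linked.

(** * Linear maps *)

Section Linear.
Variables (n : nat) (A : comNzRingType).

Definition linf (M : 'M[A]_n.+1) : forms n A :=
  [tuple \sum_j M i j *: mX j | i < n.+1].

Lemma tnth_linf M i : tnth (linf M) i = \sum_j M i j *: mX j.
Proof. exact: tnth_mktuple. Qed.

Lemma homogeneous_linf M i : homogeneous 1 (tnth (linf M) i).
Proof.
rewrite tnth_linf; apply: homogeneous_sum => j _; apply: homogeneousZ.
exact: homogeneous_mX.
Qed.

Lemma comp_linf M (h : forms n A) i :
  tnth (linf M) i \mPo h = \sum_j M i j *: tnth h j.
Proof.
rewrite tnth_linf raddf_sum /=; apply: eq_bigr => j _.
by rewrite comp_mpolyZ comp_mX.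
Qed.

Lemma fcomp_linf M N : fcomp (linf M) (linf N) = linf (M *m N).
Proof.
apply: eq_from_tnth => i; rewrite tnth_fcomp comp_linf tnth_linf.
under eq_bigr do rewrite tnth_linf scaler_sumr.
rewrite exchange_big; apply: eq_bigr => j _ /=; rewrite mxE scaler_suml.
by apply: eq_bigr => l _; rewrite scalerA.
Qed.

Lemma linf1 : linf 1%:M = fid.
Proof.
apply: eq_from_tnth => i; rewrite tnth_linf tnth_fid (bigD1 i) //= mxE eqxx scale1r.
by rewrite big1 ?addr0 // => j ne; rewrite mxE eq_sym (negbTE ne) scale0r.
Qed.

Lemma mcoeff_linear_form (a : 'I_n.+1 -> A) l :
  mcoeff (mnm1 l) (\sum_i a i *: mX i) = a l.
Proof.
rewrite raddf_sum /= (bigD1 l) //= mcoeffZ mcoeffX eqxx mulr1 big1 ?addr0 // => j jl.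
by rewrite mcoeffZ mcoeffX eq_mnm1 (negbTE jl) mulr0.
Qed.

Lemma homogeneous1E (p : mpoly n.+1 A) :
  homogeneous 1 p -> p = \sum_j mcoeff (mnm1 j) p *: mX j.
Proof.
move/homogeneousP => hp; apply/mpolyP => u.
have [/eqP/mdeg1P[j /eqP ->]|u1] := eqVneq (mdeg u) 1%N.
  by rewrite mcoeff_linear_form.
rewrite raddf_sum big1 => [|j _]; last first.
  rewrite /= mcoeffZ mcoeffX (_ : _ == _ = false) ?mulr0 //.
  by apply: contra_neqF u1 => /eqP <-; rewrite mdeg1.
by apply/eqP; apply: contra_neqT u1 => /hp.
Qed.

End Linear.

Lemma linf_cremona_pair n (k : fieldType) (M : 'M[k]_n.+1) :
  M \in unitmx -> cremona_pair 1 1 (linf M) (linf (invmx M)) 1 1.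
Proof.
move=> uM; have id1 : fid = fscale 1 fid :> tforms n k.
  by apply: eq_from_tnth => i; rewrite tnth_fscale mul1r.
split=> // [i|i||||]; try exact: homogeneous_linf; try exact: dhomog1.
- by rewrite fcomp_linf mulVmx // linf1.
- by rewrite fcomp_linf mulmxV // linf1.
Qed.

Lemma linf_birational n (k : fieldType) (M : 'M[k]_n.+1) :
  M \in unitmx -> birational (linf M).
Proof.
by move=> /linf_cremona_pair/cremona_pair_birational; apply; exact: oner_neq0.
Qed.

(** A vector killed by [M] on the left would give a linear relation between the
    components of [q M], and, after substitution of [g], between the [Q X_i]. *)
Lemma cremona_pair_linf_unit n (k : fieldType) d e (g : tforms n k) q M P Q :
  cremona_pair d e (fscale q (linf M)) g P Q -> Q != 0 -> M \in unitmx.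
Proof.
move=> p Q0; rewrite unitmxE unitfE; apply/negP => /det0P[v v0 vM].
have rel : \sum_i v 0 i *: tnth (fscale q (linf M)) i = 0.
  under eq_bigr do rewrite tnth_fscale tnth_linf scalerAr scaler_sumr.
  rewrite -mulr_sumr exchange_big /= big1 ?mulr0 // => j _.
  under eq_bigr do rewrite scalerA.
  rewrite -scaler_suml; move/rowP/(_ j): vM; rewrite !mxE => ->.
  by rewrite scale0r.
have : \sum_i v 0 i *: (Q * mX i) = 0.
  have := congr1 (comp_mpoly g) rel; rewrite raddf_sum raddf0 /= => relg; rewrite -[RHS]relg.
  apply: eq_bigr => i _; rewrite comp_mpolyZ -tnth_fcomp (cp_compr p).
  by rewrite tnth_fscale tnth_fid.
under eq_bigr do rewrite scalerAr; rewrite -mulr_sumr => /eqP.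
rewrite mulf_eq0 (negbTE Q0) /= => /eqP rel0.
case/eqP: v0; apply/rowP => i; rewrite mxE.
by have := congr1 (mcoeff (mnm1 i)) rel0; rewrite mcoeff_linear_form mcoeff0.
Qed.

(** * Contraction towards a fixed point *)

Section Contraction.
Variables (n : nat) (k : fieldType).
Implicit Types (p : mpoly n.+1 k) (h g : tforms n k) (u : multinom n.+1).

(** The degree in the coordinates other than [X_0]; it is the power of [t] that
    the substitution of [t X_i] for [X_i] produces. *)
Definition weight u : nat := \sum_(i < n) u (lift ord0 i).

Lemma mdeg_weight u : mdeg u = (u ord0 + weight u)%N.
Proof. by rewrite mdegE big_ord_recl. Qed.

(** The substitution of [t X_i] for [X_i], [i <> 0], followed by a division by
    [t ^ s]. *)
Definition dilate (s : nat) p : mpoly n.+1 {poly k} :=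
  \sum_(u <- msupp p) (mcoeff u p *: 'X^(weight u - s)) *: mpolyX _ u.

Lemma mcoeff_dilate s p u :
  mcoeff u (dilate s p) = mcoeff u p *: 'X^(weight u - s).
Proof.
rewrite /dilate raddf_sum /=; under eq_bigr do rewrite mcoeffZ mcoeffX.
have [up|up] := boolP (u \in msupp p).
  rewrite (bigD1_seq u) ?msupp_uniq //= eqxx mulr1 big1 ?addr0 // => v vu.
  by rewrite (negbTE vu) mulr0.
rewrite (memN_msupp_eq0 up) scale0r big_seq big1 // => v vp.
by rewrite (_ : _ == _ = false) ?mulr0 //; apply: contraNF up => /eqP <-.
Qed.

Lemma homogeneous_dilate s d p : homogeneous d p -> homogeneous d (dilate s p).
Proof.
move=> /homogeneousP hp; apply/homogeneousP => u; rewrite mcoeff_dilate => nz.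
by apply: hp; apply: contraNneq nz => ->; rewrite scale0r.
Qed.

Definition dilation : forms n {poly k} :=
  [tuple 'X^(i != ord0) *: mX i | i < n.+1].

Lemma tnth_dilation i : tnth dilation i = 'X^(i != ord0) *: mX i.
Proof. exact: tnth_mktuple. Qed.

Lemma comp_dilation p : map_mpoly polyC p \mPo dilation = dilate 0 p.
Proof.
rewrite /comp_mpoly mmap_map /dilate /mmap; apply: eq_bigr => u _.
rewrite /= mul_mpolyC subn0 -mul_polyC -scalerA; congr (_ *: _).
rewrite /mmap1; under eq_bigr do rewrite tnth_mktuple exprZn -exprM.
rewrite scaler_prod -mpolyXE_id; congr (_ *: _).
rewrite big_ord_recl mul1r -prodrXr.
by apply: eq_bigr => i _; rewrite mul1n.
Qed.

Lemma dilate_shift s p : (forall u, mcoeff u p != 0 -> (s <= weight u)%N) ->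
  'X^s *: dilate s p = dilate 0 p.
Proof.
move=> hs; apply/mpolyP => u; rewrite mcoeffZ !mcoeff_dilate -scalerAr -exprD.
have [->|/hs su] := eqVneq (mcoeff u p) 0; first by rewrite !scale0r.
by rewrite subn0 subnKC.
Qed.

(** The conjugate of [h] by [diag(1, t, ..., t)].  The division by [t], for the
    components other than the first, is possible when [h] fixes [e_0]. *)
Definition contract h : forms n {poly k} :=
  [tuple dilate (i != ord0) (tnth h i) | i < n.+1].

Lemma tnth_contract h i : tnth (contract h) i = dilate (i != ord0) (tnth h i).
Proof. exact: tnth_mktuple. Qed.

Lemma fiber_contract1 h : fiber (contract h) 1 = h.
Proof.
apply: eq_from_tnth => i; rewrite !tnth_mktuple; apply/mpolyP => u.
rewrite mcoeff_map_mpoly mcoeff_dilate /= /horner_eval hornerZ.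
by rewrite hornerXn expr1n mulr1.
Qed.

Definition fixes_e0 d h := forall i, i != ord0 ->
  mcoeff (mnm_muln (mnm1 ord0) d) (tnth h i) = 0.

Lemma weight0 d p u : homogeneous d p -> mcoeff u p != 0 -> weight u = 0%N ->
  u = mnm_muln (mnm1 ord0) d.
Proof.
move=> /homogeneousP hp /hp; rewrite mdeg_weight => ud w0.
move: ud; rewrite w0 addn0 => u0; apply/mnmP => i; rewrite mulmnE mnm1E.
have [->|i0] := eqVneq i ord0; first by rewrite mul1n.
move/eqP: w0; rewrite mul0n sum_nat_eq0 => /forallP.
by case: (unliftP ord0 i) i0 => [j -> _ /(_ j)/eqP ->|->]; rewrite ?eqxx.
Qed.

Lemma contract_weight d h i u : fixes_e0 d h ->
  (forall j, homogeneous d (tnth h j)) ->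
  mcoeff u (tnth h i) != 0 -> ((i != ord0) <= weight u)%N.
Proof.
move=> fh hh ui; case: eqVneq => // i0; rewrite lt0n.
apply: contra_neq ui => w0; have [//|ui] := eqVneq (mcoeff u (tnth h i)) 0.
by rewrite (weight0 (hh i) ui w0) fh.
Qed.

Lemma contractE d h i : fixes_e0 d h -> (forall j, homogeneous d (tnth h j)) ->
  'X^(i != ord0) *: tnth (contract h) i = map_mpoly polyC (tnth h i) \mPo dilation.
Proof.
move=> fh hh; rewrite tnth_contract comp_dilation dilate_shift // => u.
exact: contract_weight fh hh.
Qed.

(** With [S = diag(1, t, ..., t)] this is [S^-1 h S S^-1 g S = S^-1 (h g) S].  As
    [S] is not invertible over [k[t]], the identity is proved after composing
    with [S] on the left, which only multiplies components by powers of [t]. *)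
Lemma contract_comp d e h g Q : fixes_e0 d h -> fixes_e0 e g ->
  (forall j, homogeneous d (tnth h j)) -> (forall j, homogeneous e (tnth g j)) ->
  fcomp h g = fscale Q fid ->
  fcomp (contract h) (contract g) = fscale (dilate 0 Q) fid.
Proof.
move=> fh fg hh hg hgQ; apply: eq_from_tnth => i.
have a0 : mpolyC n.+1 ('X^(i != ord0) : {poly k}) != 0.
  by rewrite mpolyC_eq0 expf_eq0 polyX_eq0 andbF.
apply: (mulfI a0); rewrite !mul_mpolyC tnth_fcomp -comp_mpolyZ.
rewrite (contractE _ fh hh) -comp_fcomp.
have -> : fcomp dilation (contract g) = fcomp (fmap polyC g) dilation.
  apply: eq_from_tnth => j; rewrite [LHS]tnth_fcomp [RHS]tnth_fcomp.
  rewrite [in RHS]tnth_fmap.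
  by rewrite -(contractE _ fg hg) tnth_dilation comp_mpolyZ comp_mX.
rewrite comp_fcomp -map_fmap -tnth_fcomp hgQ (tnth_fscale Q) (tnth_fscale (dilate 0 Q)).
rewrite !tnth_fid !rmorphM /= [in LHS]comp_dilation map_mX.
by rewrite (comp_mX dilation) tnth_dilation scalerAr.
Qed.

(** The multiplier of the contracted family is [P] evaluated at [S x].  Its
    coefficient on the power of [X_0] does not involve [t], so that it is
    non-zero on all fibres. *)
Lemma contract_family d e h g P Q : cremona_pair d e h g P Q ->
  fixes_e0 d h -> fixes_e0 e g ->
  mcoeff (mnm_muln (mnm1 ord0) (d * e).-1) P != 0 ->
  family 1 (contract h).
Proof.
move=> [d0 e0 hh hg hP hQ hgh hhg] fh fg P0.
exists d, e, (contract g), (dilate 0 P), (dilate 0 Q); split.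
  split=> //.
  - by move=> i; rewrite tnth_contract; exact: homogeneous_dilate.
  - by move=> i; rewrite tnth_contract; exact: homogeneous_dilate.
  - exact: homogeneous_dilate.
  - exact: homogeneous_dilate.
  - exact: (contract_comp fg fh hg hh hgh).
  - exact: (contract_comp fh fg hh hg hhg).
move=> K iota t _; apply: contra_neq P0.
move/(congr1 (mcoeff (mnm_muln (mnm1 ord0) (d * e).-1))).
rewrite mcoeff_map_mpoly mcoeff_dilate mcoeff0.
rewrite (_ : weight _ = 0)%N.
  move: (mcoeff _ P) => c; have -> : c *: 'X^(0 - 0) = c%:P by rewrite -mul_polyC mulr1.
  by move=> /(etrans (esym (specC iota t c)))/eqP; rewrite fmorph_eq0 => /eqP.
by rewrite /weight big1 // => i _; rewrite mulmnE mnm1E mul0n.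
Qed.

(** At [t = 0] only the monomials [X_0^d], in the first component, and
    [X_0^(d-1) X_j], in the others, survive: the fibre is the linear part of [h]
    at [e_0], up to the common factor [X_0^(d-1)]. *)
Lemma fiber_contract0 d h : (0 < d)%N -> fixes_e0 d h ->
  (forall j, homogeneous d (tnth h j)) ->
  exists M q, fiber (contract h) 0 = fscale q (linf M).
Proof.
move=> d0 fh hh; pose w : multinom n.+1 := mnm_muln (mnm1 ord0) d.-1.
have hfac i : exists L, tnth (fiber (contract h) 0) i = L * mpolyX k w /\ homogeneous 1 L.
  have hc : homogeneous d (tnth (fiber (contract h) 0) i).
    by rewrite tnth_fmap tnth_contract; apply/homogeneous_map/homogeneous_dilate.
  have [u|L eL] := @mpolyX_factor _ _ w (tnth (fiber (contract h) 0) i).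
    rewrite mcoeff_msupp tnth_fmap tnth_mktuple mcoeff_map_mpoly mcoeff_dilate.
    rewrite /= /horner_eval hornerZ hornerXn expr0n mulf_eq0 negb_or.
    case/andP=> ui; case: (_ =P 0%N) => [/eqP|_]; last by rewrite mulr0n eqxx.
    rewrite subn_eq0 => wu _.
    apply/mnm_lepP => j; rewrite mulmnE mnm1E.
    case: eqVneq => [<-|_]; rewrite ?mul0n // mul1n.
    move/homogeneousP: (hh i) => /(_ u ui); rewrite mdeg_weight => <-.
    have w1 : (weight u <= 1)%N by apply: leq_trans wu _; case: (i != _).
    rewrite -subn1 leq_subLR addnC; exact: leq_add.
  exists L; split=> //; have [->|L0] := eqVneq L 0; first exact: dhomog0.
  rewrite eL in hc; have [_] := homogeneous_factor hc L0.
  by rewrite mdegMn mdeg1 mul1n -[in (d - _)%N](prednK d0) subSnn.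
have [L hL] := choice hfac.
exists (\matrix_(i, j) mcoeff (mnm1 j) (L i)), (mpolyX k w).
apply: eq_from_tnth => i; have [eL hL1] := hL i; rewrite eL tnth_fscale mulrC.
congr (_ * _); rewrite tnth_linf [LHS]homogeneous1E //.
by apply: eq_bigr => j _; rewrite mxE.
Qed.

End Contraction.

(** * Pseudo-reflections *)

Section PseudoReflection.
Variables (n : nat) (k : fieldType).
Implicit Types (u w : 'cV[k]_n.+1) (v : 'rV[k]_n.+1) (M : 'M[k]_n.+1).

(** The map [x |-> x + v(x) u]: a transvection if [v(u) = 0], and otherwise
    diagonalisable with eigenvalues [1] and [1 + v(u)]. *)
Definition pseudorefl u v : 'M[k]_n.+1 := 1%:M + u *m v.

Lemma ord_ltn_eqF m (i l : 'I_m) : (i < l)%N -> (i == l) = false.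
Proof. by move=> il; rewrite -val_eqE ltn_eqF. Qed.

Lemma mulmx11 v u : v *m u = ((v *m u) 0 0)%:M.
Proof. exact: mx11_scalar. Qed.

Lemma pseudorefl_inv u v : 1 + (v *m u) 0 0 != 0 ->
  pseudorefl (- (1 + (v *m u) 0 0)^-1 *: u) v *m pseudorefl u v = 1%:M.
Proof.
set c := (v *m u) 0 0 => la0.
have sq : u *m v *m (u *m v) = c *: (u *m v).
  by rewrite mulmxA -(mulmxA u v u) (mulmx11 v u) mul_mx_scalar -scalemxAl.
rewrite /pseudorefl -scalemxAl mulmxDl mul1mx mulmxDr mulmx1 -scalemxAl sq.
rewrite -addrA -[in X in _ + (X + _)](scale1r (u *m v)) scalerA -!scalerDl.
rewrite (_ : 1 + _ = 0) ?scale0r ?addr0 //.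
by field.
Qed.

Lemma pseudorefl_unit u v : 1 + (v *m u) 0 0 != 0 -> pseudorefl u v \in unitmx.
Proof. by move=> /pseudorefl_inv/mulmx1_unit[]. Qed.

Lemma pseudorefl_move v w w' : (v *m w) 0 0 != 0 ->
  pseudorefl (((v *m w) 0 0)^-1 *: (w' - w)) v *m w = w'.
Proof.
set c := (v *m w) 0 0 => c0.
rewrite /pseudorefl mulmxDl mul1mx -mulmxA (mulmx11 v w) -/c mul_mx_scalar.
by rewrite scalerA divff // scale1r addrC subrK.
Qed.

Lemma pseudorefl_move_mult v w w' : (v *m w) 0 0 != 0 ->
  1 + (v *m (((v *m w) 0 0)^-1 *: (w' - w))) 0 0
  = (v *m w') 0 0 / (v *m w) 0 0.
Proof.
move=> vw; rewrite -scalemxAr mxE mulmxBr !mxE.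
by rewrite !mxE in vw; field.
Qed.

(** If [w_l] is not zero then the [l]-th coordinate will do; otherwise a coordinate
    that does not vanish on [w] has to be added to it. *)
Lemma exists_form w (l j : 'I_n.+1) : (l <= j)%N -> w j 0 != 0 ->
  exists v, [/\ forall i : 'I_n.+1, (i < l)%N -> v 0 i = 0, v 0 l != 0 &
                (v *m w) 0 0 != 0].
Proof.
have dw i : ((delta_mx 0 i : 'rV_n.+1) *m w) 0 0 = w i 0 by rewrite -rowE mxE.
move=> lj wj; have [wl|wl] := eqVneq (w l 0) 0.
  have jl : j != l by apply: contraNneq wj => ->; rewrite wl.
  exists (delta_mx 0 l + delta_mx 0 j); split=> [i il||].
  - by rewrite !mxE (ord_ltn_eqF il) (ord_ltn_eqF (leq_trans il lj)) !andbF addr0.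
  - by rewrite !mxE !eqxx (eq_sym l) (negbTE jl) addr0 oner_eq0.
  - by rewrite mulmxDl mxE !dw wl add0r.
exists (delta_mx 0 l); split=> [i il||]; last by rewrite dw.
  by rewrite mxE (ord_ltn_eqF il) andbF.
by rewrite mxE !eqxx oner_eq0.
Qed.

Lemma move_to_e0 w : w != 0 -> exists M, M \in unitmx /\ M *m w = delta_mx ord0 0.
Proof.
move=> w0; have [j wj] : exists j, w j 0 != 0.
  apply: contrapT => /forallNP nw; case/eqP: w0; apply/colP => j; rewrite mxE.
  by apply/eqP/negPn/negP; exact: nw.
have [v [_ v0 vw]] := exists_form (leq0n j : (ord0 <= j)%N) wj.
exists (pseudorefl (((v *m w) 0 0)^-1 *: (delta_mx ord0 0 - w)) v).
split; last exact: pseudorefl_move.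
by apply: pseudorefl_unit; rewrite pseudorefl_move_mult // mulf_neq0 ?invr_eq0 // -colE mxE.
Qed.

(** Gaussian elimination by columns: if [M] fixes the first [l] basis vectors
    then [M e_l] is not in their span, so that a pseudo-reflection which fixes
    these vectors moves [M e_l] to [e_l]. *)
Lemma unitmx_pseudorefl_ind (P : 'M[k]_n.+1 -> Prop) :
  P 1%:M ->
  (forall u v M, 1 + (v *m u) 0 0 != 0 -> P M -> P (pseudorefl u v *m M)) ->
  forall M, M \in unitmx -> P M.
Proof.
move=> P1 Ppseudo.
suff H m : forall M, M \in unitmx -> (m <= n.+1)%N ->
    (forall i : 'I_n.+1, (i < n.+1 - m)%N -> col i M = delta_mx i 0) -> P M.
  by move=> M uM; apply: (H n.+1 M) => // i; rewrite subnn.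
elim: m => [|m IH] M uM mn fixM.
  suff -> : M = 1%:M by [].
  apply/matrixP => i j; have := fixM j; rewrite subn0 ltn_ord => /(_ isT)/colP/(_ i).
  by rewrite !mxE eqxx andbT.
have lP : (n.+1 - m.+1 < n.+1)%N by rewrite subSS ltnS leq_subr.
pose l := Ordinal lP.
have [j lj Mj] : exists2 j : 'I_n.+1, (l <= j)%N & M j l != 0.
  apply: contrapT => nM.
  (* otherwise column [l] is a combination of the previous basis vectors, which
     [M] fixes *)
  pose x : 'cV[k]_n.+1 := delta_mx l 0 -
    \sum_(i : 'I_n.+1 | (i < l)%N) M i l *: delta_mx i 0.
  have xl : x l 0 = 1.
    rewrite /x !mxE !eqxx summxE big1 ?subr0 // => i il.
    by rewrite !mxE eq_sym ord_ltn_eqF //= mulr0.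
  have : M *m x = 0.
    rewrite mulmxBr -colE mulmx_sumr; apply/colP => i; rewrite !mxE summxE.
    under eq_bigr => a al do rewrite -scalemxAr -colE (fixM a al) !mxE.
    have [il|li] := ltnP i l.
      rewrite (bigD1 i) //= !eqxx mulr1 big1 ?addr0 ?subrr // => a /andP[_ ai].
      by rewrite eq_sym (negbTE ai) mulr0.
    rewrite big1 => [|a al]; last by rewrite eq_sym ord_ltn_eqF ?mulr0 // (leq_trans al li).
    by rewrite subr0; apply: contrapT => /eqP Mi; apply: nM; exists i.
  move/(congr1 (mulmx (invmx M))); rewrite mulmxA mulVmx // mul1mx mulmx0.
  by move/colP/(_ l)/eqP; rewrite xl mxE oner_eq0.
have [v [vl v0 vw]] : exists v, [/\ forall i : 'I_n.+1, (i < l)%N -> v 0 i = 0,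
     v 0 l != 0 & (v *m col l M) 0 0 != 0].
  by apply: (exists_form lj); rewrite mxE.
set u := (((v *m col l M) 0 0)^-1 *: (delta_mx l 0 - col l M)).
have ve : (v *m (delta_mx l 0 : 'cV_n.+1)) 0 0 = v 0 l by rewrite -colE mxE.
have la0 : 1 + (v *m u) 0 0 != 0.
  by rewrite pseudorefl_move_mult // mulf_neq0 ?invr_eq0 // ve.
have PN : P (pseudorefl u v *m M).
  apply: IH => [||i il]; first by rewrite unitmx_mul pseudorefl_unit.
    exact: ltnW.
  rewrite !colE -mulmxA -colE; have [il'|] := ltnP i l.
    rewrite fixM // /pseudorefl mulmxDl mul1mx -mulmxA -colE.
    rewrite (_ : col i v = 0) ?mulmx0 ?addr0 //.
    by apply/colP => a; rewrite !mxE !ord1 vl.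
  rewrite leq_eqVlt => /orP[/eqP li|li].
    have -> : i = l by apply: val_inj.
    exact: pseudorefl_move.
  by move: il; rewrite -[(n.+1 - m)%N]subSS subSn //= ltnS leqNgt li.
have := Ppseudo (- (1 + (v *m u) 0 0)^-1 *: u) v _ _ PN.
rewrite mulmxA pseudorefl_inv // mul1mx; apply.
rewrite -scalemxAr mxE; set c := (v *m u) 0 0 in la0 *.
rewrite (_ : 1 + _ = (1 + c)^-1) ?invr_eq0 //.
by field.
Qed.

End PseudoReflection.

(** * Families of pseudo-reflections *)

Section ReflectionFamily.
Variables (n : nat) (k : fieldType).
Variables (u : 'cV[k]_n.+1) (v : 'rV[k]_n.+1).
Local Notation A := (mpoly n.+1 {poly k}).

(** [shift a b] is the map [x |-> a x + b u]. *)
Definition shift (a b : A) : forms n {poly k} :=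
  [tuple a * mX i + (u i 0)%:P *: b | i < n.+1].

Lemma tnth_shift a b i : tnth (shift a b) i = a * mX i + (u i 0)%:P *: b.
Proof. exact: tnth_mktuple. Qed.

(** Forms that a translation along [u] leaves unchanged, which makes them
    constant, up to scaling, along every map [shift a b]. *)
Definition shift_invariant s (z : A) := forall a b, z \mPo shift a b = a ^+ s * z.

Let la := 1 + (v *m u) 0 0.
Let V : A := \sum_i (v 0 i)%:P *: mX i.

Lemma comp_shift_form (w : 'rV[k]_n.+1) a b :
  (\sum_i (w 0 i)%:P *: mX i : A) \mPo shift a b =
  a * (\sum_i (w 0 i)%:P *: mX i) + ((w *m u) 0 0)%:P *: b.
Proof.
rewrite raddf_sum /=.
under eq_bigr do rewrite comp_mpolyZ comp_mX tnth_shift scalerDr scalerAr scalerA.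
rewrite big_split -mulr_sumr /= -scaler_suml; congr (_ + _ *: _).
by rewrite mxE rmorph_sum; apply: eq_bigr => i _; rewrite rmorphM.
Qed.

Let compV a b : V \mPo shift a b = a * V + (la - 1)%:P *: b.
Proof. by rewrite comp_shift_form /la addrAC subrr add0r. Qed.

Variables (s : nat) (z y : A).
Hypotheses (hz : homogeneous s z) (hy : homogeneous s y).
Hypotheses (iz : shift_invariant s z) (iy : shift_invariant s y).

(** The factor by which [v] is multiplied along the family is
    [pseudorefl_num / z = 1 + (la - 1) t + (la - 1) t (t - 1) y / z]; it runs from [1]
    to [la], and the last term keeps it from vanishing in between. *)
Let c : A := 'X *: z + ('X * ('X - 1)) *: y.
Definition pseudorefl_num : A := z + (la - 1)%:P *: c.
Definition pseudorefl_family := shift z (c * V).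

Let hc : homogeneous s c.
Proof. by apply: homogeneousD; apply: homogeneousZ. Qed.

Let hN : homogeneous s pseudorefl_num.
Proof. by apply: homogeneousD => //; apply: homogeneousZ. Qed.

Let ic : shift_invariant s c.
Proof. by move=> a b; rewrite /c rmorphD /= !comp_mpolyZ iz iy [RHS]mulrDr -!scalerAr. Qed.

Let iN : shift_invariant s pseudorefl_num.
Proof.
move=> a b; rewrite /pseudorefl_num rmorphD /= comp_mpolyZ iz ic.
by rewrite [RHS]mulrDr -!scalerAr.
Qed.

Let hV : homogeneous 1 V.
Proof. by apply: homogeneous_sum => i _; apply/homogeneousZ/homogeneous_mX. Qed.

Let hshift a b i : homogeneous s a -> homogeneous s.+1 b ->
  homogeneous s.+1 (tnth (shift a b) i).
Proof.
move=> ha hb; rewrite tnth_shift; apply: homogeneousD; last exact: homogeneousZ.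
by have := homogeneousM ha (homogeneous_mX _ i); rewrite addn1.
Qed.

(** The inverse of [z x + c v(x) u] is, up to scaling, [N x - c v(x) u] with
    [N = z + (la - 1) c], because [z], [c] and [N] are constant along [u] and
    [v] is multiplied by [N] along the family. *)
Lemma pseudorefl_family_pair :
  cremona_pair s.+1 s.+1 pseudorefl_family (shift pseudorefl_num (- c * V))
    (z ^+ s.+1 * pseudorefl_num) (pseudorefl_num ^+ s.+1 * z).
Proof.
have hcV : homogeneous s.+1 (c * V) by have := homogeneousM hc hV; rewrite addn1.
have sE : ((s.+1 * s.+1).-1 = s * s.+1 + s)%N by rewrite mulSn addSn /= addnC.
split=> // [i|i||||].
- exact: hshift.
- by apply: hshift => //; rewrite mulNr -scaleN1r; apply: homogeneousZ.
- by rewrite sE; apply: homogeneousM => //; apply: homogeneousX.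
- by rewrite sE; apply: homogeneousM => //; apply: homogeneousX.
- apply: eq_from_tnth => i.
  rewrite tnth_fcomp tnth_fscale tnth_fid tnth_shift rmorphD rmorphM /= comp_mpolyZ.
  rewrite rmorphM rmorphN /= iN ic compV comp_mX !tnth_shift -!mul_mpolyC exprS.
  by rewrite /pseudorefl_num -!mul_mpolyC; ring.
- apply: eq_from_tnth => i.
  rewrite tnth_fcomp tnth_fscale tnth_fid tnth_shift rmorphD rmorphM /= comp_mpolyZ.
  rewrite rmorphM /= iz ic compV comp_mX !tnth_shift -!mul_mpolyC exprS.
  by rewrite [in X in _ * (X * _ + _)]/pseudorefl_num /pseudorefl_num -!mul_mpolyC; ring.
Qed.

Lemma map_form (f : {rmorphism {poly k} -> k}) (w : 'rV[k]_n.+1) :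
  (forall a, f a%:P = a) ->
  map_mpoly f (\sum_i (w 0 i)%:P *: mX i) = \sum_i w 0 i *: mX i :> mpoly n.+1 k.
Proof.
move=> fC; rewrite raddf_sum /=; apply: eq_bigr => i _.
by rewrite map_mpolyZ map_mX fC.
Qed.

Lemma map_pseudorefl_coef (B : comNzRingType) (f : {rmorphism {poly k} -> B}) t :
  f 'X = t ->
  map_mpoly f c = t *: map_mpoly f z + (t * (t - 1)) *: map_mpoly f y.
Proof.
by move=> <-; rewrite rmorphD /= !map_mpolyZ rmorphM rmorphB rmorph1.
Qed.

Lemma map_pseudorefl_num (B : comNzRingType) (f : {rmorphism {poly k} -> B}) t :
  f 'X = t ->
  map_mpoly f pseudorefl_num = map_mpoly f z + f (la - 1)%:P *:
    (t *: map_mpoly f z + (t * (t - 1)) *: map_mpoly f y).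
Proof. by move=> ft; rewrite rmorphD /= map_mpolyZ (map_pseudorefl_coef ft). Qed.

Lemma fiber_pseudorefl_family t : fiber pseudorefl_family t =
  [tuple map_mpoly (horner_eval t) z * mX i +
     u i 0 *: (map_mpoly (horner_eval t) c * \sum_j v 0 j *: mX j) | i < n.+1].
Proof.
apply: eq_from_tnth => i; rewrite tnth_fmap tnth_shift tnth_mktuple.
rewrite rmorphD rmorphM /= map_mX map_mpolyZ rmorphM /= map_form.
  by rewrite /horner_eval hornerC.
by move=> a; exact: hornerC.
Qed.

Lemma fiber_pseudorefl_family0 : same_ratmap (fiber pseudorefl_family 0) fid.
Proof.
rewrite fiber_pseudorefl_family.
rewrite (map_pseudorefl_coef (f := horner_eval (0 : k)) (hornerX 0)).
rewrite mul0r !scale0r addr0.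
rewrite (_ : mktuple _ = fscale (map_mpoly (horner_eval 0) z) fid).
  exact: same_ratmap_scale.
apply: eq_from_tnth => i.
by rewrite tnth_mktuple tnth_fscale tnth_fid mul0r scaler0 addr0.
Qed.

Lemma fiber_pseudorefl_family1 :
  same_ratmap (fiber pseudorefl_family 1) (linf (pseudorefl u v)).
Proof.
rewrite fiber_pseudorefl_family.
rewrite (map_pseudorefl_coef (f := horner_eval (1 : k)) (hornerX 1)).
rewrite subrr mulr0 scale0r scale1r addr0.
rewrite (_ : mktuple _ = fscale (map_mpoly (horner_eval 1) z) (linf (pseudorefl u v))).
  exact: same_ratmap_scale.
apply: eq_from_tnth => i; rewrite tnth_mktuple tnth_fscale scalerAr -mulrDr.
congr (_ * _); rewrite tnth_linf /pseudorefl.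
under [RHS]eq_bigr do rewrite !mxE big_ord_recl big_ord0 addr0 scalerDl.
rewrite big_split /= [in RHS](bigD1 i) //= eqxx scale1r [in RHS]big1 ?addr0.
  by rewrite scaler_sumr; congr (_ + _); apply: eq_bigr => j _; rewrite scalerA.
by move=> j ji; rewrite eq_sym (negbTE ji) scale0r.
Qed.

End ReflectionFamily.

Arguments map_pseudorefl_num {n k} u v z y {B f t}.

Section LinkReflection.
Variables (n : nat) (k : fieldType) (S : set {poly k}).
Hypothesis admS : admissible S.

(** With the constants [z = 1] and [y = 0], the only invariants on the projective
    line, the multiplier is [1 + (la - 1) t], which vanishes at one value of [t]. *)
Lemma linked_pseudorefl_line (u : 'cV[k]_n.+1) (v : 'rV[k]_n.+1) :
  @nonzero_ends k `<=` S -> 1 + (v *m u) 0 0 != 0 ->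
  linked S fid (linf (pseudorefl u v)).
Proof.
move=> endsS la0; set D : {poly k} := 1 + ((v *m u) 0 0)%:P * 'X.
have [h0 h1] : homogeneous 0 (1 : mpoly n.+1 {poly k}) /\
               homogeneous 0 (0 : mpoly n.+1 {poly k}).
  by split; [exact: dhomog1 | exact: dhomog0].
have i1 : shift_invariant u 0 1 by move=> a b; rewrite rmorph1 mul1r.
have i0 : shift_invariant u 0 0 by move=> a b; rewrite rmorph0 mulr0.
exists D, (pseudorefl_family u v 1 0); split.
- apply: endsS; rewrite /nonzero_ends /= !hornerD !hornerM !hornerX !hornerC.
  by rewrite mulr0 addr0 oner_eq0 mulr1.
- exists 1%N, 1%N; do 3!eexists; split; 
    first exact: (pseudorefl_family_pair v h0 h1 i1 i0).
  move=> K iota t; rewrite expr1 mul1r (map_pseudorefl_num _ _ _ _ (specX iota t)).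
  rewrite rmorph0 rmorph1 scaler0 addr0 scalerA -{1}(scale1r 1) -scalerDl.
  rewrite addrAC subrr add0r [spec _ _ (_%:P)](specC iota t) => Dt.
  rewrite -mul_mpolyC mulr1 mpolyC_eq0; move: Dt; rewrite /D rmorphD rmorphM rmorph1.
  by rewrite [spec _ _ (_%:P)](specC iota t) specX.
- exact: fiber_pseudorefl_family0.
- exact: fiber_pseudorefl_family1.
Qed.

(** Two coordinates of [x] modulo [u] serve as [z] and [y].  Their coefficients in
    [pseudorefl_num] are [1 + (la - 1) t] and [(la - 1) t (t - 1)], which have no
    common zero since [la] is not zero. *)
Lemma linked_pseudorefl (u : 'cV[k]_n.+1) (v : 'rV[k]_n.+1) :
  (2 <= n)%N -> 1 + (v *m u) 0 0 != 0 -> linked S fid (linf (pseudorefl u v)).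
Proof.
move=> n2 la0; have n0 : (0 < n)%N by apply: leq_trans n2.
have [->|u0] := eqVneq u 0.
  rewrite /pseudorefl mul0mx addr0 linf1; apply: linked_refl => //.
  by rewrite -linf1; apply: linf_birational; exact: unitmx1.
have [i ui] : exists i, u i 0 != 0.
  apply: contrapT => /forallNP nu; case/eqP: u0; apply/colP => i; rewrite mxE.
  by apply/eqP/negPn/negP; exact: nu.
pose j := lift i (Ordinal n0); pose j' := lift i (Ordinal n2).
have [ji j'i jj'] : [/\ j != i, j' != i & j != j'].
  by rewrite ![_ == i]eq_sym !neq_lift (inj_eq (@lift_inj _ _)).
pose w a : 'rV[k]_n.+1 := u i 0 *: delta_mx 0 a - u a 0 *: delta_mx 0 i.
pose F a : mpoly n.+1 {poly k} := \sum_l (w a 0 l)%:P *: mX l.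
have hF a : homogeneous 1 (F a).
  by apply: homogeneous_sum => l _; apply/homogeneousZ/homogeneous_mX.
have iF a : shift_invariant u 1 (F a).
  move=> b c; rewrite /F comp_shift_form expr1 mulmxBl -!scalemxAl -!rowE.
  by rewrite !mxE (mulrC (u a 0)) subrr scale0r addr0.
have waa a b : a != i -> b != i -> w a 0 b = u i 0 *+ (a == b).
  move=> ai bi; rewrite !mxE eqxx (negbTE bi) mulr0 subr0 eq_sym /=.
  by case: eqP => _; rewrite ?mulr1 ?mulr0.
exists 1, (pseudorefl_family u v (F j) (F j')); split.
- exact: adm1 admS.
- do 5!eexists; split; 
    first exact: (pseudorefl_family_pair v (hF j) (hF j') (iF j) (iF j')).
  move=> K iota t _.
  have cF a l : a != i -> l != i ->
      mcoeff (mnm1 l) (map_mpoly (spec iota t) (F a)) = iota (u i 0) *+ (a == l).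
    move=> ai li; rewrite mcoeff_map_mpoly mcoeff_linear_form.
    by apply: etrans (specC iota t _) _; rewrite waa // rmorphMn.
  have iu0 : iota (u i 0) != 0 by rewrite fmorph_eq0.
  have ila0 : 1 + iota ((v *m u) 0 0) != 0.
    by rewrite -(rmorph1 iota) -rmorphD fmorph_eq0.
  rewrite rmorphM rmorphXn /=.
  rewrite (map_pseudorefl_num _ _ _ _ (specX iota t)) [spec _ _ (_%:P)](specC iota t).
  have := cF j j ji ji; have := cF j j' ji j'i.
  have := cF j' j j'i ji; have := cF j' j' j'i j'i.
  rewrite !eqxx (eq_sym j') (negbTE jj') addrAC subrr add0r.
  move: (map_mpoly _ (F j)) (map_mpoly _ (F j')) (iota _) (iota _) iu0 ila0.
  move=> z y a b b0 a1 yj' yj zj' zj.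
  apply: mulf_neq0.
    rewrite expf_eq0 /=; apply/eqP => z0; move: zj; rewrite z0 mcoeff0 => /esym/eqP.
    by rewrite (negbTE b0).
  apply/eqP => N0; have /eqP := congr1 (mcoeff (mnm1 j)) N0.
  have /eqP := congr1 (mcoeff (mnm1 j')) N0.
  rewrite !(mcoeffD, mcoeffZ) !mcoeff0 zj zj' yj yj' !mulr0n !mulr1n.
  rewrite !(mulr0, add0r, addr0) !mulf_eq0 (negbTE b0) orbF subr_eq0.
  have -> : b + a * (t * b) = (1 + a * t) * b by ring.
  rewrite mulf_eq0 (negbTE b0) orbF => /or3P[/eqP->|/eqP->|/eqP->].
  - by rewrite mul0r addr0 oner_eq0.
  - by rewrite mulr0 addr0 oner_eq0.
  - by rewrite mulr1 (negbTE a1).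
- exact: fiber_pseudorefl_family0.
- exact: fiber_pseudorefl_family1.
Qed.

End LinkReflection.

(** * Every birational tuple is linked to the identity *)

Lemma infinite_nonroot (k : fieldType) (B : set k) (p : {poly k}) :
  infinite_set B -> p != 0 -> exists2 x, B x & ~~ root p x.
Proof.
move=> infB p0; have [X XB cX] := infinite_set_fset (size p) infB.
apply: contrapT => nx.
have rX : all (root p) (finmap.enum_fset X).
  apply/allP => x xX; apply: contrapT => /negP rx; apply: nx; exists x => //.
  exact: XB.
have := max_poly_roots p0 rX (finmap.fset_uniq X).
by rewrite ltnNge cX.
Qed.

(** Induction on the number of variables: a non-zero coefficient with respect to
    the last variable does not vanish at some point, which leaves a non-zero
    polynomial in that variable. *)
Lemma meval_neq0 m (k : fieldType) (p : mpoly m k) :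
  infinite_set [set: k] -> p != 0 -> exists x, meval x p != 0.
Proof.
move=> infk; elim: m p => [|m IH] p p0.
  exists (fun=> 0); have [u] : exists u, mcoeff u p != 0.
    by exists (mlead p); rewrite -mcoeff_msupp mlead_supp.
  apply: contraNneq; rewrite mevalE => e0.
  have all0 (w w' : multinom 0) : w = w' by apply/mnmP => -[].
  have := e0; rewrite (eq_bigr (fun w => mcoeff u p)); last first.
    by move=> w _; rewrite big_ord0 mulr1 (all0 w u).
  have [up|/memN_msupp_eq0 ->] := boolP (u \in msupp p); last by [].
  rewrite (bigD1_seq u) ?msupp_uniq //= big1; first by rewrite addr0 => ->.
  by move=> w; rewrite (all0 w u) eqxx.
have [u up] : exists u, mcoeff u p != 0.
  by exists (mlead p); rewrite -mcoeff_msupp mlead_supp.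
pose wd (w : multinom m.+1) : multinom m :=
  Multinom [tuple w (widen_ord (leqnSn m) i) | i < m].
have muni_coef : mcoeff (wd u) ((muni p)`_(u ord_max)) = mcoeff u p.
  rewrite muniE coef_sum raddf_sum /=.
  have uin : u \in msupp p by rewrite mcoeff_msupp.
  rewrite (bigD1_seq u) ?msupp_uniq //= big1 ?addr0.
    by rewrite coefZ coefXn eqxx mulr1 mcoeffZ mcoeffX eqxx mulr1.
  move=> w wu; rewrite coefZ coefXn; case: eqP => [e|_]; last by rewrite mulr0 mcoeff0.
  rewrite mulr1 mcoeffZ mcoeffX; case: eqP => [e'|_]; last by rewrite mulr0.
  case/eqP: wu; apply/mnmP => i; have [j ->|->] := unliftP ord_max i; last by rewrite e.
  have := congr1 (fun x : multinom m => x j) e'; rewrite !mnmE.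
  rewrite (_ : widen_ord _ _ = lift ord_max j) //; apply: val_inj.
  by rewrite /= /bump leqNgt ltn_ord.
have [|x xp] := IH (muni p)`_(u ord_max).
  by apply: contraNneq up => q0; rewrite -muni_coef q0 mcoeff0.
pose q := map_poly (meval x) (muni p).
have [|t _ qt] := @infinite_nonroot _ setT q infk.
  by apply: contraNneq xp => q0; rewrite -coef_map /= -/q q0 coef0.
exists (fun i => if unlift ord_max i is Some j then x j else t).
apply: contraNneq qt => e0; rewrite /root -[X in _ == X]e0; apply/eqP.
rewrite /q muniE rmorph_sum horner_sum mevalE; apply: eq_bigr => w _.
rewrite /= map_polyZ map_polyXn hornerZ hornerXn /= mevalZ mevalX -mulrA; congr (_ * _).
rewrite big_ord_recr /= unlift_none; congr (_ * _); apply: eq_bigr => i _.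
rewrite mnmE (_ : widen_ord _ _ = lift ord_max i) ?liftK //.
by apply: val_inj; rewrite /= /bump leqNgt ltn_ord.
Qed.

Section Linking.
Variables (n : nat) (k : fieldType) (S : set {poly k}).
Hypothesis n0 : (0 < n)%N.
Hypothesis infk : infinite_set [set: k].
Hypothesis admS : admissible S.
Hypothesis roomS : (2 <= n)%N \/ @nonzero_ends k `<=` S.
Implicit Types (f g h : tforms n k) (M : 'M[k]_n.+1).

Lemma fid_birational : birational (fid : tforms n k).
Proof. by rewrite -linf1; apply: linf_birational; exact: unitmx1. Qed.

Lemma ratmap_birational h : birational h -> ratmap h.
Proof. by case. Qed.

Lemma fcomp_fid h : fcomp h fid = h.
Proof. by apply: eq_from_tnth => i; rewrite tnth_fcomp comp_fid. Qed.

Lemma fid_fcomp h : fcomp fid h = h.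
Proof. by apply: eq_from_tnth => i; rewrite tnth_fcomp tnth_fid comp_mX. Qed.

Lemma birational_fcomp f g : birational f -> birational g -> birational (fcomp f g).
Proof.
move=> /(birational_cremona_pair n0)[d1 [e1 [f' [P1 [Q1 [p1 nz1]]]]]].
move=> /(birational_cremona_pair n0)[d2 [e2 [g' [P2 [Q2 [p2 nz2]]]]]].
apply: (cremona_pair_birational (cremona_pair_comp p1 p2)).
rewrite mulf_neq0 // expf_eq0 negb_and; apply/orP; right.
exact: cremona_pair_comp_neq0 p2 nz2 (cp_mult_homog p1) nz1.
Qed.

Lemma linked_fid_fcomp f g : birational f ->
  linked S fid f -> linked S fid g -> linked S fid (fcomp f g).
Proof.
move=> /ratmap_birational rf lf lg; rewrite -[X in @linked n k S X _](fid_fcomp fid).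
exact: linked_comp n0 (ratmap_birational fid_birational) rf lf lg.
Qed.

Lemma linked_linf (M : 'M[k]_n.+1) : M \in unitmx -> linked S fid (linf M).
Proof.
move=> uM; elim/unitmx_pseudorefl_ind: uM.
  by rewrite linf1; apply: linked_refl => //; exact: fid_birational.
move=> u v N la0 lN; rewrite -fcomp_linf.
apply: linked_fid_fcomp => //; first by apply: linf_birational; exact: pseudorefl_unit.
by case: roomS => ?; [exact: linked_pseudorefl|exact: linked_pseudorefl_line].
Qed.

Lemma fcompA f g h : fcomp (fcomp f g) h = fcomp f (fcomp g h).
Proof. by apply: eq_from_tnth => i; rewrite !tnth_fcomp comp_fcomp. Qed.

Lemma linf_fcompK M h : M \in unitmx -> fcomp (linf (invmx M)) (fcomp (linf M) h) = h.
Proof. by move=> uM; rewrite -fcompA fcomp_linf mulVmx // linf1 fid_fcomp. Qed.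

Lemma linf_fcompVK M h : M \in unitmx -> fcomp (linf M) (fcomp (linf (invmx M)) h) = h.
Proof. by move=> uM; rewrite -fcompA fcomp_linf mulmxV // linf1 fid_fcomp. Qed.

Let e0 : 'I_n.+1 -> k := fun i => (i == ord0)%:R.

Lemma meval_e0 d (p : mpoly n.+1 k) : homogeneous d p ->
  meval e0 p = mcoeff (mnm_muln (mnm1 ord0) d) p.
Proof.
move=> hp; rewrite mevalE [in RHS](mpolyE p) raddf_sum big_seq [RHS]big_seq.
apply: eq_bigr => u; rewrite mcoeff_msupp => up; rewrite /= mcoeffZ mcoeffX.
congr (_ * _); rewrite big_ord_recl /e0 eqxx expr1n mul1r.
have [wu|wu] := eqVneq (weight u) 0%N.
  rewrite (weight0 hp up wu) eqxx big1 // => i _.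
  by rewrite mulmnE mnm1E mul0n expr0.
have -> : (u == mnm_muln (mnm1 ord0) d) = false.
  apply: contra_neqF wu => /eqP ->; rewrite /weight big1 // => i _.
  by rewrite mulmnE mnm1E mul0n.
have [i ui] : exists i : 'I_n, u (lift ord0 i) != 0%N.
  apply: contrapT => /forallNP nu; case/eqP: wu; rewrite /weight big1 // => i _.
  by apply/eqP/negPn/negP; exact: nu.
by rewrite (bigD1 i) //= expr0n (negbTE ui) mul0r.
Qed.

Let evalc (h : tforms n k) (x : 'cV[k]_n.+1) : 'cV[k]_n.+1 :=
  \col_i meval (fun j => x j 0) (tnth h i).

Let evalc_fcomp f g x : evalc (fcomp f g) x = evalc f (evalc g x).
Proof.
apply/colP => i; rewrite !mxE tnth_fcomp comp_mpoly_meval.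
by apply: meval_eq => j; rewrite mxE.
Qed.

Let evalc_linf M x : evalc (linf M) x = M *m x.
Proof.
apply/colP => i; rewrite !mxE tnth_linf raddf_sum /=.
by apply: eq_bigr => j _; rewrite mevalZ mevalXU.
Qed.

Let evalc_scale d h c x : (forall i, homogeneous d (tnth h i)) ->
  evalc h (c *: x) = c ^+ d *: evalc h x.
Proof.
move=> hh; apply/colP => i; rewrite !mxE !meval_mmap -(mmap_scale _ _ _ (hh i)).
by apply: eq_mmap => // j; rewrite mxE.
Qed.

Let evalc_fscale_fid P x : evalc (fscale P fid) x = meval (fun j => x j 0) P *: x.
Proof.
by apply/colP => i; rewrite !mxE tnth_fscale tnth_fid mevalM mevalXU.
Qed.

Let fixes_e0P d h : (forall i, homogeneous d (tnth h i)) ->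
  (exists c, evalc h (delta_mx ord0 0) = c *: delta_mx ord0 0) -> fixes_e0 d h.
Proof.
move=> hh [c /colP hc] i i0; rewrite -(meval_e0 (hh i)).
have := hc i; rewrite !mxE (negbTE i0) mulr0 => <-.
by apply: meval_eq => j; rewrite mxE andbT.
Qed.

(** If [h] fixes [e_0] and is a local isomorphism there, the contraction family
    joins it to its differential. *)
Lemma linked_fixed_point d e h g P Q : cremona_pair d e h g P Q ->
  evalc h (delta_mx ord0 0) = delta_mx ord0 0 ->
  meval e0 P != 0 -> linked S fid h.
Proof.
move=> p he P0.
have Pe : meval (fun j => (delta_mx ord0 0 : 'cV_n.+1) j 0) P = meval e0 P.
  by apply: meval_eq => j; rewrite mxE andbT.
have ge : evalc g (delta_mx ord0 0) = meval e0 P *: delta_mx ord0 0.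
  by rewrite -[X in evalc g X]he -evalc_fcomp (cp_compl p) evalc_fscale_fid Pe.
have fh : fixes_e0 d h.
  by apply: (fixes_e0P (cp_homog p)); exists 1; rewrite scale1r.
have fg : fixes_e0 e g by apply: (fixes_e0P (cp_inv_homog p)); exists (meval e0 P).
have fam : family 1 (contract h).
  by apply: (contract_family p fh fg); rewrite -(meval_e0 (cp_mult_homog p)).
have [M [q eM]] := fiber_contract0 (cp_deg_gt0 p) fh (cp_homog p).
have [|d' [e' [g' [P' [Q' [p' P'0]]]]]] := @family_fiber _ _ _ _ 0 fam.
  by rewrite hornerC oner_eq0.
rewrite eM in p'.
have uM := cremona_pair_linf_unit p' (cremona_pair_inv_mult_neq0 p' P'0).
have bM := linf_birational uM.
have bMV : birational (linf (invmx M)) by apply: linf_birational; rewrite unitmx_inv.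
have ph0 : P != 0 by apply: contraNneq P0 => ->; rewrite meval0.
have lMh : linked S (linf M) h.
  exists 1, (contract h); split=> //.
  - exact: adm1 admS.
  - by rewrite eM; exact: same_ratmap_scale.
  - by rewrite fiber_contract1; exact: same_ratmap_refl.
have := linked_comp admS n0 (ratmap_birational bMV) (ratmap_birational bMV)
  (linked_refl admS n0 bMV) lMh.
rewrite fcomp_linf mulVmx // linf1 => /(linked_fid_fcomp bM (linked_linf uM)).
by rewrite linf_fcompVK.
Qed.

(** Choose a point where the multiplier does not vanish, and move this point and
    its image to [e_0]. *)
Lemma linked_fid h : birational h -> linked S fid h.
Proof.
move=> /(birational_cremona_pair n0)[d [e [g [P [Q [p P0]]]]]].
have [x] := meval_neq0 infk (mulf_neq0 P0 (mX_neq0 k ord0)).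
rewrite mevalM mulf_eq0 negb_or mevalXU => /andP[Px x0].
pose a : 'cV[k]_n.+1 := \col_i x i.
have Pa : meval (fun j => a j 0) P = meval x P by apply: meval_eq => j; rewrite mxE.
have a0 : a != 0 by apply: contraNneq x0 => /colP/(_ ord0); rewrite !mxE => ->.
pose b := evalc h a.
have gb : evalc g b = meval x P *: a.
  by rewrite -evalc_fcomp (cp_compl p) evalc_fscale_fid Pa.
have b0 : b != 0.
  apply: contra_neq a0 => b0; apply/eqP; rewrite -(inj_eq (scalerI Px)) scaler0 -gb b0.
  rewrite -[X in evalc g X](scale0r (0 : 'cV[k]_n.+1)) (evalc_scale _ _ (cp_inv_homog p)).
  by rewrite expr0n gtn_eqF ?scale0r // (cp_inv_deg_gt0 p).
have [A [uA Aa]] := move_to_e0 a0; have [B [uB Bb]] := move_to_e0 b0.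
have uAV : invmx A \in unitmx by rewrite unitmx_inv.
have Ae : invmx A *m delta_mx ord0 0 = a by rewrite -Aa mulmxA mulVmx // mul1mx.
have lh' : linked S fid (fcomp (linf B) (fcomp h (linf (invmx A)))).
  apply: (linked_fixed_point (cremona_pair_comp (linf_cremona_pair uB)
    (cremona_pair_comp p (linf_cremona_pair uAV)))).
    by rewrite !evalc_fcomp !evalc_linf Ae.
  rewrite rmorph1 expr1n mul1r expr1 mulr1 comp_mpoly_meval.
  rewrite (_ : meval _ P = meval x P) //; apply: meval_eq => i.
  have /colP/(_ i) := Ae; rewrite -evalc_linf !mxE => <-.
  by apply: meval_eq => j; rewrite mxE andbT.
have bh' : birational (fcomp h (linf (invmx A))).
  by apply: birational_fcomp (linf_birational uAV); exact: cremona_pair_birational p P0.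
have uBV : invmx B \in unitmx by rewrite unitmx_inv.
have := linked_fid_fcomp (linf_birational uBV) (linked_linf uBV) lh'.
rewrite linf_fcompK // => /(linked_fid_fcomp bh')/(_ (linked_linf uA)).
by rewrite fcompA fcomp_linf mulVmx // linf1 fcomp_fid.
Qed.

(** Any two transformations are linked because [f^-1 g] is linked to the identity. *)
Theorem linked_all f g : birational f -> birational g -> linked S f g.
Proof.
move=> bf bg.
have [d [e [f' [P [Q [p P0]]]]]] := birational_cremona_pair n0 bf.
have bf' := cremona_pair_birational (cremona_pair_sym p) (cremona_pair_inv_mult_neq0 p P0).
have := linked_comp admS n0 (ratmap_birational bf) (ratmap_birational bf)
  (linked_refl admS n0 bf) (linked_fid (birational_fcomp bf' bg)).
rewrite fcomp_fid -fcompA (cp_compr p); apply: linked_same.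
- exact: ratmap_birational.
- rewrite -(cp_compr p) fcompA; apply: ratmap_birational.
  exact: birational_fcomp bf (birational_fcomp bf' bg).
- exact: same_ratmap_refl.
- apply/same_ratmapP => i j; rewrite !tnth_fcomp !tnth_fscale !tnth_fid.
  by rewrite !rmorphM /= !comp_mX; ring.
Qed.

End Linking.

(** * From families of forms to morphisms *)

Section ProjectivePoints.
Variables (k : fieldType) (V : lmodType k).

Lemma proportional_sym (v w : V) : proportional v w -> proportional w v.
Proof.
by move=> [c c0 ->]; exists c^-1; rewrite ?invr_eq0 // scalerA mulVf // scale1r.
Qed.

Lemma proportional_trans (u v w : V) :
  proportional u v -> proportional v w -> proportional u w.
Proof.
by move=> [c c0 ->] [d d0 ->]; exists (c * d); rewrite ?mulf_neq0 // scalerA.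
Qed.

Definition point_of (v : V) (v0 : v != 0) : proj V :=
  \pi_(proj V) (SigSub (mem_set (v0 : [set w : V | w != 0] v)) : nonzero V).

Lemma hcoord_point_of v v0 : proportional (hcoord (@point_of v v0)) v.
Proof. by apply/asboolP; have /eqmodP := reprK (@point_of v v0). Qed.

Lemma hcoord_inj (x y : proj V) : proportional (hcoord x) (hcoord y) -> x = y.
Proof.
by move=> xy; rewrite -[x]reprK -[y]reprK; apply/eqmodP/asboolP.
Qed.

Lemma hcoord_neq0 (x : proj V) : hcoord x != 0.
Proof. by have := set_valP (repr x). Qed.

End ProjectivePoints.

Lemma cross_proportional n (k : fieldType) (x y : 'rV[k]_n) : x != 0 -> y != 0 ->
  (forall i j, x 0 i * y 0 j = x 0 j * y 0 i) -> proportional x y.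
Proof.
move=> x0 y0 xy; have [l yl] : exists l, y 0 l != 0.
  apply: contrapT => /forallNP nz; case/eqP: y0; apply/rowP => j; rewrite [RHS]mxE.
  by apply/eqP/negPn/negP; exact: nz.
exists (x 0 l / y 0 l).
  apply: mulf_neq0; last by rewrite invr_eq0.
  apply: contra_neq x0 => xl; apply/rowP => j; apply: (mulIf yl).
  by rewrite xy xl !mxE !mul0r.
by apply/rowP => j; rewrite [RHS]mxE mulrAC -xy mulfK.
Qed.
Section EvaluationAtPoints.
Variables (n : nat) (K : fieldType).
Implicit Types (x : 'rV[K]_n.+1) (h g : tforms n K) (p : mpoly n.+1 K).

Definition evalv x p : K := meval (fun i => x 0 i) p.
Definition evalr x h : 'rV[K]_n.+1 := \row_j evalv x (tnth h j).

Lemma evalv_scale d c x p : homogeneous d p -> evalv (c *: x) p = c ^+ d * evalv x p.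
Proof.
move=> hp; rewrite /evalv !meval_mmap -(mmap_scale _ _ _ hp).
by apply: eq_mmap => // j; rewrite mxE.
Qed.

Lemma evalvM x p q : evalv x (p * q) = evalv x p * evalv x q.
Proof. exact: mevalM. Qed.

Lemma evalvB x p q : evalv x (p - q) = evalv x p - evalv x q.
Proof. exact: mevalB. Qed.

Lemma evalr_scale d c x h : (forall i, homogeneous d (tnth h i)) ->
  evalr (c *: x) h = c ^+ d *: evalr x h.
Proof. by move=> hh; apply/rowP => i; rewrite !mxE (evalv_scale _ _ (hh i)). Qed.

Lemma evalv_comp x p h : evalv x (p \mPo h) = evalv (evalr x h) p.
Proof. by rewrite /evalv comp_mpoly_meval; apply: meval_eq => j; rewrite mxE. Qed.

Lemma evalr_fcomp x g h : evalr x (fcomp g h) = evalr (evalr x h) g.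
Proof. by apply/rowP => i; rewrite !mxE tnth_fcomp evalv_comp. Qed.

Lemma evalr_fscale_fid x p : evalr x (fscale p fid) = evalv x p *: x.
Proof.
by apply/rowP => i; rewrite !mxE tnth_fscale tnth_fid /evalv mevalM mevalXU.
Qed.

Lemma evalr_proportional d x y h : (forall i, homogeneous d (tnth h i)) ->
  proportional x y -> proportional (evalr x h) (evalr y h).
Proof.
move=> hh [c c0 ->]; exists (c ^+ d); first by rewrite expf_neq0.
exact: evalr_scale.
Qed.

Lemma evalv_proportional d x y p : homogeneous d p -> proportional x y ->
  evalv x p != 0 -> evalv y p != 0.
Proof.
by move=> hp [c c0 ->]; rewrite (evalv_scale _ _ hp) mulf_eq0 negb_or => /andP[].
Qed.

Section Pair.
Variables (d e : nat) (h g : tforms n K) (P Q : mpoly n.+1 K).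
Hypothesis p : cremona_pair d e h g P Q.

Lemma pair_evalK x : evalr (evalr x h) g = evalv x P *: x.
Proof. by rewrite -evalr_fcomp (cp_compl p) evalr_fscale_fid. Qed.

Lemma pair_eval_neq0 x : x != 0 -> evalv x P != 0 -> evalr x h != 0.
Proof.
move=> x0 Px; apply: contra_neq x0 => hx; apply: (scalerI Px).
rewrite -pair_evalK hx scaler0 -[X in evalr X g](scale0r (0 : 'rV[K]_n.+1)).
rewrite (evalr_scale _ _ (cp_inv_homog p)) expr0n gtn_eqF ?scale0r //.
exact: cp_inv_deg_gt0 p.
Qed.

Lemma pair_eval_mult x : P != 0 -> evalv x P != 0 -> evalv (evalr x h) Q != 0.
Proof.
move=> P0 Px; rewrite -evalv_comp (cremona_pair_mult_comp p P0).
by rewrite /evalv rmorphXn expf_neq0.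
Qed.

End Pair.

Lemma exists_point p : infinite_set [set: K] -> p != 0 ->
  exists x : 'rV[K]_n.+1, x != 0 /\ evalv x p != 0.
Proof.
move=> infK p0; have [x] := meval_neq0 infK (mulf_neq0 p0 (mX_neq0 K ord0)).
rewrite mevalM mulf_eq0 negb_or mevalXU => /andP[px x0].
exists (\row_i x i); split.
  by apply: contraNneq x0 => /rowP/(_ ord0); rewrite !mxE => ->.
by rewrite /evalv (_ : meval _ p = meval x p) //; apply: meval_eq => j; rewrite mxE.
Qed.

End EvaluationAtPoints.

Section BirClass.
Variables (n : nat) (k : fieldType).
Implicit Types (h : tforms n k) (f : Bir n k).

Lemma forms_of_bir_class h (hb : birational h) :
  same_ratmap (forms_of (bir_class hb)) h.
Proof. by have /eqmodP := reprK (bir_class hb). Qed.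

Lemma bir_classP h (hb : birational h) f :
  same_ratmap h (forms_of f) -> bir_class hb = f.
Proof. by move=> e; rewrite -[RHS]reprK; apply/eqmodP. Qed.

Lemma forms_of_birational f : birational (forms_of f).
Proof. exact: (set_valP (repr f)). Qed.

Lemma forms_of_inj f g : same_ratmap (forms_of f) (forms_of g) -> f = g.
Proof. by move=> e; rewrite -[f]reprK -[g]reprK; apply/eqmodP. Qed.

End BirClass.

Lemma infinite_rmorphism (k K : fieldType) (iota : {rmorphism k -> K}) :
  infinite_set [set: k] -> infinite_set [set: K].
Proof.
move=> infk finK; apply: infk; rewrite -(preimage_setT iota).
by apply: finite_preimage => // x y _ _; exact: fmorph_inj.
Qed.

HB.instance Definition _ (L K : fieldType) (iota : {rmorphism L -> K}) m
    (v : 'rV[K]_m) :=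
  GRing.RMorphism.copy (evalp iota v) (mmap iota (fun i => v 0 i)).

Section Pullback.
Variables (k : fieldType) (K : closedFieldType) (iota : {rmorphism k -> K}).
Variables (A : variety iota) (T : A -> K) (Tc : forall i, mpoly (vdim (v := A) i) k).
Hypothesis TE : forall i (v : 'rV[K]_(vdim i)), zeros iota (veqs i) v ->
  T (vchart v) = evalp iota v (Tc i).
Hypothesis infk : infinite_set [set: k].

Variables (n : nat) (D : {poly k}) (H G : forms n {poly k}).
Variables (d e : nat) (P Q : mpoly n.+1 {poly k}).
Hypothesis pHG : cremona_pair d e H G P Q.
Hypothesis P_neq0 : forall a, map_mpoly (spec iota (T a)) P != 0.

Let at_point a : {rmorphism {poly k} -> K} := spec iota (T a).
Let pairK a := cremona_pair_map (at_point a) pHG.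

Let Q_neq0 a : map_mpoly (at_point a) Q != 0.
Proof. exact: cremona_pair_inv_mult_neq0 (pairK a) (P_neq0 a). Qed.

Let pull i : {rmorphism {poly k} -> mpoly (vdim (v := A) i) k} :=
  GRing.RMorphism.clone _ _ (horner_eval (Tc i) \o map_poly (@mpolyC _ _)) _.

Let evalp_pull i (v : 'rV[K]_(vdim i)) c : zeros iota (veqs i) v ->
  evalp iota v (pull i c) = at_point (vchart v) c.
Proof.
move=> hv; rewrite /at_point specE (TE hv) /= /horner_eval /evalp -horner_map /=.
rewrite -map_poly_comp; congr (_.[_]).
by apply: eq_map_poly => b /=; rewrite mmapC.
Qed.

Let evalf_pull i (v : 'rV[K]_(vdim i)) (x : pspace n K) p :
  zeros iota (veqs i) v ->
  evalf iota v x (map_mpoly (pull i) p) =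
  evalv (hcoord x) (map_mpoly (at_point (vchart v)) p).
Proof.
move=> hv; rewrite /evalv meval_mmap /evalf !mmap_map.
by apply: eq_mmap => // c; exact: evalp_pull.
Qed.

Let pullK i : {rmorphism {poly k} -> mpoly (vdim (v := A) i) K} :=
  GRing.RMorphism.clone _ _ (map_mpoly iota \o pull i) _.

Let evalf_pullK i (v : 'rV[K]_(vdim i)) (x : pspace n K) p :
  zeros iota (veqs i) v ->
  evalf idfun v x (map_mpoly (pullK i) p) =
  evalv (hcoord x) (map_mpoly (at_point (vchart v)) p).
Proof.
move=> hv; rewrite -(evalf_pull _ _ hv) /evalf !mmap_map.
apply: eq_mmap => // c; rewrite /= /evalp mmap_map.
exact: eq_mmap.
Qed.

(** The map defined by the fibre of [F] over [a], extended by the identity to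
    the points where the forms vanish. *)
Let to_point (F : forms n {poly k}) (a : A) (x : pspace n K) : pspace n K :=
  if pselect (evalr (hcoord x) (fmap (at_point a) F) != 0) is left w0
  then point_of w0 else x.

Let to_pointE F a x : evalr (hcoord x) (fmap (at_point a) F) != 0 ->
  proportional (hcoord (to_point F a x)) (evalr (hcoord x) (fmap (at_point a) F)).
Proof. by rewrite /to_point; case: pselect => // w0 _; exact: hcoord_point_of. Qed.

Let nonvanishing (R : mpoly n.+1 {poly k}) : set (A * pspace n K) :=
  [set ax | evalv (hcoord ax.2) (map_mpoly (at_point ax.1) R) != 0].

Let nonvanishing_open r R : homogeneous r R -> prod_open (nonvanishing R).
Proof.
move=> hR i v x hv; rewrite /nonvanishing /= => nz.
exists r, (map_mpoly (pullK i) R); split; first exact: homogeneous_map.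
  by rewrite evalf_pullK.
by move=> v' x' hv'; rewrite evalf_pullK.
Qed.

Let nonvanishing_surj R : (forall a, map_mpoly (at_point a) R != 0) ->
  forall r, homogeneous r R -> forall a, exists x, nonvanishing R (a, x).
Proof.
move=> R0 r hR a; have [x [x0 Rx]] := exists_point (infinite_rmorphism iota infk) (R0 a).
exists (point_of x0); rewrite /nonvanishing /=.
apply: evalv_proportional Rx; first exact: homogeneous_map hR.
exact/proportional_sym/hcoord_point_of.
Qed.

Let to_point_regular r F (U : set (A * pspace n K)) :
  (forall j, homogeneous r (tnth F j)) ->
  (forall a x, U (a, x) -> evalr (hcoord x) (fmap (at_point a) F) != 0) ->
  regular_on U (to_point F).
Proof.
move=> hF UF i v x hv Ux.
have evE v' x' : zeros iota (veqs i) v' ->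
    \row_j evalf iota v' x' (map_mpoly (pull i) (tnth F j))
    = evalr (hcoord x') (fmap (at_point (vchart v')) F).
  by move=> hv'; apply/rowP => j; rewrite !mxE evalf_pull // tnth_fmap.
exists r, (fun j => map_mpoly (pull i) (tnth F j)); split.
- by move=> j; exact: homogeneous_map.
- apply: contrapT => /forallNP nz; have /eqP := UF _ _ Ux; apply.
  rewrite -evE //; apply/rowP => j; rewrite !mxE; apply/eqP/negPn/negP; exact: nz.
- by move=> v' x' hv' Ux' _; rewrite evE //; exact/proportional_sym/to_pointE/UF.
Qed.

Let inverse_on d' e' F F' (R R' : mpoly n.+1 {poly k}) :
  cremona_pair d' e' F F' R R' -> (forall a, map_mpoly (at_point a) R != 0) ->
  forall a x, nonvanishing R (a, x) ->
  [/\ evalr (hcoord x) (fmap (at_point a) F) != 0,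
      nonvanishing R' (a, to_point F a x) &
      to_point F' a (to_point F a x) = x].
Proof.
move=> p R0 a x Rx; have pa := cremona_pair_map (at_point a) p.
have Fx := pair_eval_neq0 pa (hcoord_neq0 x) Rx.
have yE := to_pointE Fx; set y := to_point F a x in yE *.
have R'y : evalv (hcoord y) (map_mpoly (at_point a) R') != 0.
  apply: (evalv_proportional (cp_inv_mult_homog pa) (proportional_sym yE)).
  exact: pair_eval_mult pa _ (R0 a) Rx.
have F'y := pair_eval_neq0 (cremona_pair_sym pa) (hcoord_neq0 y) R'y.
split; [exact: Fx | exact: R'y |].
apply: hcoord_inj; apply: proportional_trans (to_pointE F'y) _.
apply: proportional_trans (evalr_proportional (cp_inv_homog pa) yE) _.
by rewrite (pair_evalK pa); exists (evalv (hcoord x) (map_mpoly (at_point a) R)).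
Qed.

Let inv1 := inverse_on pHG P_neq0.
Let inv2 := inverse_on (cremona_pair_sym pHG) Q_neq0.

(** The morphism defined by a family along a map to the line.  It is an
    isomorphism from the locus where [P] does not vanish to the one where [Q]
    does not vanish, because [Q o H] is a power of [P]. *)
Definition pullback : bir_family A n :=
  @BirFamily _ _ _ A n (nonvanishing P) (nonvanishing Q) (to_point H) (to_point G)
    (nonvanishing_open (cp_mult_homog pHG))
    (nonvanishing_open (cp_inv_mult_homog pHG))
    (nonvanishing_surj P_neq0 (cp_mult_homog pHG))
    (nonvanishing_surj Q_neq0 (cp_inv_mult_homog pHG))
    (fun a x Px => let: And3 _ y xK := inv1 Px in conj y xK)
    (fun a x Qx => let: And3 _ y xK := inv2 Qx in conj y xK)
    (to_point_regular (cp_homog pHG) (fun a x Px => let: And3 nz _ _ := inv1 Px in nz))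
    (to_point_regular (cp_inv_homog pHG)
      (fun a x Qx => let: And3 nz _ _ := inv2 Qx in nz)).

(** Where the chosen forms of [f] do not all vanish, they are proportional to
    those of the family. *)
Lemma pullback_fiber a t (f : Bir n k) : T a = iota t ->
  same_ratmap (forms_of f) (fiber H t) -> fiber_is pullback a f.
Proof.
move=> Ta ft x Px /=; set w := \row_j _ => w0.
have Hx := pair_eval_neq0 (pairK a) (hcoord_neq0 x) Px.
apply: proportional_trans (proportional_sym (to_pointE Hx)).
have {}ft i j : w 0 i * evalr (hcoord x) (fmap (at_point a) H) 0 j =
    w 0 j * evalr (hcoord x) (fmap (at_point a) H) 0 i.
  have evH l : evalr (hcoord x) (fmap (at_point a) H) 0 l
               = evalp iota (hcoord x) (tnth (fiber H t) l).
    rewrite !mxE tnth_fmap tnth_fmap /evalv /evalp meval_mmap !mmap_map.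
    apply: eq_mmap => // c; rewrite /at_point Ta /=.
    exact: spec_iota.
  by rewrite !evH !mxE -!evalpM (same_ratmapP _ _ ft).
exact: cross_proportional w0 Hx ft.
Qed.

End Pullback.

(** A link over an open subset of the line, pulled back by a map to the line that
    avoids the zeros of [D], is a morphism with the prescribed end points. *)
Lemma linked_morphism n (k : fieldType) (K : closedFieldType)
    (iota : {rmorphism k -> K}) (A : variety iota) (T : A -> K)
    (Tc : forall i, mpoly (vdim (v := A) i) k) (D : {poly k}) (H : forms n {poly k}) :
  (forall i (v : 'rV[K]_(vdim i)), zeros iota (veqs i) v ->
     T (vchart v) = evalp iota v (Tc i)) ->
  infinite_set [set: k] -> family D H -> (forall a, spec iota (T a) D != 0) ->
  exists rho : kpoints A -> Bir n k, is_bir_morphism rho /\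
    forall a t, T (set_val a) = iota t -> same_ratmap (forms_of (rho a)) (fiber H t).
Proof.
move=> TE infk fH DT.
have Tk (a : kpoints A) : exists t, T (set_val a) = iota t.
  have [i [v hv av]] : rational_point (set_val a) := set_valP a.
  rewrite av (TE _ _ hv).
  exists (evalp idfun v (Tc i)); rewrite /evalp rmorph_mmap.
  by apply: eq_mmap => // j; rewrite /= mxE.
have [tk tkE] := choice Tk.
have bH a : birational (fiber H (tk a)).
  apply: family_fiber_birational fH _; have := DT (set_val a).
  by rewrite tkE spec_iota fmorph_eq0.
exists (fun a => bir_class (bH a)).
have fiberP a t : T (set_val a) = iota t ->
    same_ratmap (forms_of (bir_class (bH a))) (fiber H t).
  move=> Ta; have -> : t = tk a by apply: (fmorph_inj iota); rewrite -Ta tkE.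
  exact: forms_of_bir_class.
split=> //; case: fH => d [e [G [P [Q [p nz]]]]].
exists (pullback TE infk p (fun a => nz _ _ _ (DT a))) => a.
exact: pullback_fiber (tkE a) (fiberP _ _ (tkE a)).
Qed.

(** * Connectedness for the Zariski topology *)

Lemma fiber_end n (k : fieldType) (D : {poly k}) (H : forms n {poly k}) t
    (f f' : Bir n k) : family D H -> D.[t] != 0 ->
  same_ratmap (fiber H t) (forms_of f) -> same_ratmap (forms_of f') (fiber H t) ->
  f' = f.
Proof.
move=> fH Dt Hf f'H; have [[_ [l hl]] _] := family_fiber_birational fH Dt.
by apply: forms_of_inj; exact: same_ratmap_trans hl f'H Hf.
Qed.

Lemma affine_line_linked n (k : fieldType) (K : closedFieldType)
    (iota : {rmorphism k -> K}) (f g : Bir n k) :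
  infinite_set [set: k] -> linked [set 1] (forms_of f) (forms_of g) ->
  exists rho : kpoints (affine_line iota) -> Bir n k,
    [/\ is_bir_morphism rho, rho (affine_line_point iota 0) = f &
        rho (affine_line_point iota 1) = g].
Proof.
move=> infk [D [H [-> fH H0 H1]]].
have [||rho [brho rhoE]] := @linked_morphism n k K iota (affine_line iota) id
    (fun i => mX ord0) _ _ _ infk fH.
- by move=> i v _; rewrite /evalp mmapX mmap1U.
- by move=> a; rewrite rmorph1 oner_eq0.
exists rho; split=> //.
- by apply: (fiber_end fH _ H0); [rewrite hornerC oner_eq0 | exact: rhoE].
- by apply: (fiber_end fH _ H1); [rewrite hornerC oner_eq0 | exact: rhoE].
Qed.

(** ** Affine varieties *)

Section AffineVariety.
Variables (k : fieldType) (K : closedFieldType) (iota : {rmorphism k -> K}).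
Variables (m : nat) (E : set (mpoly m k)) (base : 'rV[K]_m).
Hypothesis baseE : zeros iota E base.

Let points : Type := set_type (zeros iota E).
Let point (v : 'rV[K]_m) (hv : zeros iota E v) : points := SigSub (mem_set hv).
Let dim (i : 'I_1) : nat := m.
Let eqs (i : 'I_1) : set (mpoly (dim i) k) := E.

Let chart (i : 'I_1) (v : 'rV[K]_(dim i)) : points :=
  if pselect (zeros iota E v) is left hv then point hv else point baseE.

Lemma affine_chartE (i : 'I_1) v : zeros iota (@eqs i) v -> set_val (@chart i v) = v.
Proof. by rewrite /chart; case: pselect => // hv _. Qed.

Lemma affine_variety_inj i : {in zeros iota (@eqs i) &, injective (@chart i)}.
Proof.
move=> v w /set_mem hv /set_mem hw /(congr1 set_val).
by rewrite !affine_chartE.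
Qed.

Lemma affine_variety_cover (a : points) :
  exists i, exists2 v, zeros iota (@eqs i) v & a = @chart i v.
Proof.
have ha : zeros iota E (set_val a) := set_valP a.
exists ord0, (set_val a) => //; apply/val_inj; exact/esym/affine_chartE.
Qed.

Lemma affine_variety_regular i j v w :
  zeros iota (@eqs i) v -> zeros iota (@eqs j) w -> @chart i v = @chart j w ->
  exists (q : mpoly (dim i) k) (p : 'I_(dim j) -> mpoly (dim i) k),
    evalp iota v q != 0 /\
    forall v', zeros iota (@eqs i) v' -> evalp iota v' q != 0 ->
      let w' := \row_l (evalp iota v' (p l) / evalp iota v' q) in
      zeros iota (@eqs j) w' /\ @chart i v' = @chart j w'.
Proof.
move=> _ _ _; exists 1, (fun l => mpolyX k (mnm1 l)); rewrite rmorph1 oner_eq0.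
split=> // v' hv' _ /=; set w' := \row_l _.
have -> : w' = v'.
  by apply/rowP => l; rewrite mxE rmorph1 divr1 /evalp mmapX mmap1U.
by split.
Qed.

Lemma affine_variety_separated i j :
  exists F : set (mpoly (dim i + dim j) k),
    forall v w, zeros iota (@eqs i) v -> zeros iota (@eqs j) w ->
      (@chart i v = @chart j w <-> zeros iota F (row_mx v w)).
Proof.
pose diff l : mpoly (m + m) k := mX (lshift m l) - mX (rshift m l).
have diffE v w l : evalp iota (row_mx v w) (diff l) = v 0 l - w 0 l.
  by rewrite rmorphB /= /evalp !mmapX !mmap1U row_mxEl row_mxEr.
exists (range diff) => v w hv hw; split=> [/(congr1 set_val)|h].
  rewrite (affine_chartE hv) (affine_chartE hw) => -> _ [l _ <-].
  by rewrite diffE subrr.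
congr (@chart _ _); apply/rowP => l; apply/eqP; rewrite -subr_eq0 -diffE.
by apply/eqP/h; exists l.
Qed.

Definition affine_variety : variety iota :=
  Variety affine_variety_inj affine_variety_cover affine_variety_regular
    affine_variety_separated.

Lemma affine_rational (v : 'rV[k]_m) (hv : zeros iota E (map_mx iota v)) :
  rational_point (point hv : affine_variety).
Proof.
exists ord0, v => //; apply/val_inj; apply/esym.
exact: (@affine_chartE ord0 _ hv).
Qed.

Definition affine_point (v : 'rV[k]_m) (hv : zeros iota E (map_mx iota v)) :
  kpoints affine_variety := SigSub (mem_set (affine_rational hv)).

End AffineVariety.

Arguments affine_chartE {k K iota m E base} baseE i [v] hv.

(** ** Principal open subsets of the line *)

Section PrincipalOpen.
Variables (k : fieldType) (K : closedFieldType) (iota : {rmorphism k -> K}).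
Variable D : {poly k}.
Hypothesis D0 : D.[0] != 0.

(** The open subset [D <> 0] of the line, as the plane curve [D(x) y = 1]. *)
Definition curve_eq : mpoly 2 k :=
  (map_poly (@mpolyC 2 k) D).[mX ord0] * mX ord_max - 1.

Lemma evalp_line_coord (L : fieldType) (f : {rmorphism k -> L}) (v : 'rV[L]_2) :
  evalp f v (map_poly (@mpolyC 2 k) D).[mX ord0] = (map_poly f D).[v 0 ord0].
Proof.
rewrite -horner_map /= -map_poly_comp /evalp mmapX mmap1U; congr (_.[_]).
by apply: eq_map_poly => c /=; rewrite ?/evalp mmapC.
Qed.

Lemma curveP (L : fieldType) (f : {rmorphism k -> L}) (v : 'rV[L]_2) :
  zeros f [set curve_eq] v <-> (map_poly f D).[v 0 ord0] * v 0 ord_max = 1.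
Proof.
have E : evalp f v curve_eq = (map_poly f D).[v 0 ord0] * v 0 ord_max - 1.
  rewrite /curve_eq rmorphB rmorphM rmorph1 /= evalp_line_coord.
  by rewrite /evalp mmapX mmap1U.
split=> [/(_ _ erefl)/eqP|h _ ->]; first by rewrite E subr_eq0 => /eqP.
by rewrite E h subrr.
Qed.

Definition curve_pt (t : k) : 'rV[k]_2 := \row_j (if j == ord0 then t else D.[t]^-1).

Lemma curve_ptE t : D.[t] != 0 -> zeros iota [set curve_eq] (map_mx iota (curve_pt t)).
Proof.
move=> Dt; apply/curveP; rewrite !mxE /= horner_map /=.
by rewrite -rmorphM divff // rmorph1.
Qed.

Definition principal_open : variety iota := affine_variety (curve_ptE D0).
Definition principal_point t (Dt : D.[t] != 0) : kpoints principal_open :=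
  affine_point (curve_ptE D0) (curve_ptE Dt).

Let T (a : principal_open) : K := (set_val a : 'rV[K]_2) 0 ord0.

Lemma principal_open_linked n (H : forms n {poly k}) :
  infinite_set [set: k] -> family D H ->
  exists rho : kpoints principal_open -> Bir n k, is_bir_morphism rho /\
    forall t (Dt : D.[t] != 0),
      same_ratmap (forms_of (rho (principal_point Dt))) (fiber H t).
Proof.
move=> infk fH.
have [||rho [brho rhoE]] := @linked_morphism n k K iota principal_open T
    (fun i => mX ord0) D H _ infk fH.
- move=> i v hv; rewrite /T (affine_chartE (curve_ptE D0) i hv).
  by rewrite /evalp mmapX mmap1U.
- move=> a; have /curveP : zeros iota [set curve_eq] (set_val a) := set_valP a.
  by rewrite specE; apply: contra_eq_neq => ->; rewrite mul0r eq_sym oner_eq0.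
exists rho; split=> // t Dt; apply: rhoE.
by rewrite /T /= !mxE.
Qed.

(** Clearing the powers of [D] turns an equation on the curve into a polynomial
    equation in the coordinate of the line. *)
Lemma clear_denominators (q : mpoly 2 k) : exists N (p : {poly k}),
  forall t, D.[t] != 0 -> p.[t] = D.[t] ^+ N * evalp idfun (curve_pt t) q.
Proof.
pose N := msize q.
exists N, (\sum_(u <- msupp q) mcoeff u q *: ('X ^+ u ord0 * D ^+ (N - u ord_max))).
move=> t Dt; rewrite horner_sum /evalp /mmap mulr_sumr big_seq [RHS]big_seq.
apply: eq_bigr => u uq; rewrite hornerZ hornerM !horner_exp hornerX [RHS]mulrCA.
congr (_ * _); rewrite /mmap1 big_ord_recl big_ord_recl big_ord0 mulr1 !mxE /=.
have -> : lift ord0 ord0 = ord_max :> 'I_2 by apply: val_inj.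
rewrite [RHS]mulrCA; congr (_ * _); rewrite exprVn.
have uN : (u ord_max <= N)%N.
  apply: leq_trans (ltnW (msize_mdeg_lt uq)); rewrite mdegE big_ord_recr /=.
  exact: leq_addl.
apply: (mulIf (expf_neq0 (u ord_max) Dt)); rewrite -exprD subnK //.
by rewrite mulfVK // expf_neq0.
Qed.

(** An equation of [S] that fails at [a] becomes, once denominators are cleared, a
    non-zero polynomial in the coordinate of the line. *)
Lemma principal_closed (S : set (kpoints principal_open)) (a : kpoints principal_open) :
  kpoints_closed S -> ~ S a -> exists2 p : {poly k}, p != 0 &
    forall t (Dt : D.[t] != 0), S (principal_point Dt) -> root p t.
Proof.
move=> [Z cZ ->] /= nZa.
have [i [v hv av]] : rational_point (set_val a) := set_valP a.
have [F hF] := cZ i; move: nZa; rewrite av => /hF => /(_ hv).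
move=> /asboolPn/existsp_asboolPn [q] /asboolPn/imply_asboolPn [Fq qv].
have [N [p pE]] := clear_denominators q.
have evq (w : 'rV[k]_2) : evalp iota (map_mx iota w) q = iota (evalp idfun w q).
  by rewrite /evalp rmorph_mmap; apply: eq_mmap => // j; rewrite /= mxE.
have Dv : D.[v 0 ord0] * v 0 ord_max = 1.
  move/curveP: hv; rewrite !mxE horner_map -rmorphM => /eqP.
  by rewrite fmorph_eq1 => /eqP.
have Dv0 : D.[v 0 ord0] != 0.
  by apply: contra_eq_neq Dv => ->; rewrite mul0r eq_sym oner_eq0.
have vE : curve_pt (v 0 ord0) = v.
  apply/rowP => j; rewrite mxE; case: ifPn => [/eqP -> //|j0].
  have -> : j = ord_max by case: j j0 => [[|[|]]] // ? _; apply: val_inj.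
  by apply: (mulfI Dv0); rewrite Dv divff.
exists p.
  apply: contra_not_neq qv => p0; rewrite evq -vE.
  have := pE _ Dv0; rewrite p0 horner0 => /esym/eqP.
  by rewrite mulf_eq0 expf_eq0 (negbTE Dv0) andbF /= => /eqP ->; rewrite rmorph0.
move=> t Dt Zt; rewrite /root pE // mulf_eq0; apply/orP; right.
have ht := curve_ptE Dt; rewrite -(fmorph_eq0 iota) -evq; apply/eqP.
apply: (proj1 (hF _ ht)) => //.
rewrite (_ : vchart _ = set_val (principal_point Dt)) //.
by apply/val_inj; exact: (affine_chartE (curve_ptE D0) i ht).
Qed.

End PrincipalOpen.

(** A link between a point of a closed and open subset and a point outside it
    would write the rational points of an open subset of the line as the union
    of two proper closed subsets, hence [k] as a finite set. *)
Lemma zariski_connected n (k : fieldType) (K : closedFieldType)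
    (iota : {rmorphism k -> K}) : (0 < n)%N -> infinite_set [set: k] ->
  connected [set: bir_zariski n iota].
Proof.
move=> n0 infk B [f Bf] [C oC]; rewrite setTI => BC [C' cC']; rewrite setTI => BC'.
subst C C'; apply/seteqP; split=> // g _; apply: contrapT => nBg.
have cB : bir_zariski_closed iota B.
  by move: cC'; rewrite -openC => /=; rewrite -[X in bir_zariski_closed iota X]setCK.
have cBC : bir_zariski_closed iota (~` B) by exact: oC.
have [D [H [[D0 D1] fH H0 H1]]] : linked (@nonzero_ends k) (forms_of f) (forms_of g).
  apply: linked_all => //; first exact: admissible_ends; first by right.
  - exact: forms_of_birational.
  - exact: forms_of_birational.
have [rho [brho rhoE]] := principal_open_linked iota D0 infk fH.
have rho0 : rho (principal_point iota D0 D0) = f := fiber_end fH D0 H0 (rhoE _ _).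
have rho1 : rho (principal_point iota D0 D1) = g := fiber_end fH D1 H1 (rhoE _ _).
have [|p1 p10 p1P] := @principal_closed _ _ iota _ D0 _ (principal_point iota D0 D1)
  (cB _ _ brho).
  by rewrite /= rho1.
have [|p2 p20 p2P] := @principal_closed _ _ iota _ D0 _ (principal_point iota D0 D0)
  (cBC _ _ brho).
  by rewrite /= rho0; apply.
have D_neq0 : D != 0 by apply/eqP => D00; have := D0; rewrite D00 horner0 eqxx.
have [t _] := infinite_nonroot infk (mulf_neq0 (mulf_neq0 p10 p20) D_neq0).
rewrite !rootM !negb_or => /andP[/andP[t1 t2] Dt].
have [Bt|nBt] := pselect (B (rho (principal_point iota D0 Dt))).
  by case/negP: t1; exact: p1P Bt.
by case/negP: t2; exact: p2P nBt.
Qed.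

(** * Path-connectedness for the Euclidean topology *)

Section Coefficients.
Variables (n : nat) (k : fieldType) (d : nat).

Definition coefs_of (h : tforms n k) : coefs n k d :=
  \matrix_(i, l) mcoeff (bmnm (val (enum_val l : monomial n d))) (tnth h i).

Lemma tforms_of_coefsK h : (forall i, homogeneous d (tnth h i)) ->
  tforms_of_coefs (coefs_of h) = h.
Proof.
move=> hh; apply: eq_from_tnth => i; rewrite tnth_mktuple; apply/mpolyP => u.
rewrite raddf_sum /=; under eq_bigr do rewrite mxE enum_rankK mcoeffZ mcoeffX.
have [ud|ud] := eqVneq (mdeg u) d; last first.
  rewrite big1 => [|m _]; last first.
    by case: eqP => [um|_]; rewrite ?mulr0 //; case/eqP: ud; rewrite -um; apply/eqP/(valP m).
  by apply/esym/eqP; apply: contra_neqT ud; move/homogeneousP: (hh i); exact.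
have ub : (mdeg u < d.+1)%N by rewrite ud.
have um : mdeg (BMultinom ub) == d by rewrite /= ud.
rewrite (bigD1 (exist _ (BMultinom ub) um)) //= eqxx mulr1 big1 ?addr0 // => m mu.
case: eqP => [e|_]; rewrite ?mulr0 //; case/eqP: mu.
by apply/val_inj/val_inj.
Qed.

Lemma tforms_of_coefsZ a (c : coefs n k d) :
  tforms_of_coefs (a *: c) = fscale (mpolyC n.+1 a) (tforms_of_coefs c).
Proof.
apply: eq_from_tnth => i; rewrite tnth_fscale mul_mpolyC !tnth_mktuple scaler_sumr.
by apply: eq_bigr => m _; rewrite mxE scalerA.
Qed.

End Coefficients.

Lemma cremona_pair_scale n (k : fieldType) a d e (h g : tforms n k) P Q :
  cremona_pair d e h g P Q ->
  cremona_pair d e (fscale (mpolyC n.+1 a) h) g (a ^+ e *: P) (a *: Q).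
Proof.
case=> d0 e0 hh hg hP hQ gh hg'; split=> // [i||||].
- by rewrite tnth_fscale mul_mpolyC; exact: homogeneousZ.
- exact: homogeneousZ.
- exact: homogeneousZ.
- apply: eq_from_tnth => i; rewrite tnth_fcomp (comp_fscale _ _ (hg i)).
  by rewrite -tnth_fcomp gh !tnth_fscale -mul_mpolyC rmorphXn mulrA.
- apply: eq_from_tnth => i; rewrite tnth_fcomp !tnth_fscale rmorphM /= comp_mpolyC.
  by rewrite -tnth_fcomp hg' tnth_fscale -mul_mpolyC mulrA.
Qed.

Lemma continuous_horner_num (k : numFieldType) (p : {poly k}) :
  continuous (horner p : k -> k).
Proof.
elim/poly_ind: p => [|p c IH].
  rewrite (_ : horner 0 = cst 0); first exact: cst_continuous.
  by apply/funext => y; rewrite horner0.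
rewrite (_ : horner _ = (fun y => p.[y] * y + c)); last first.
  by apply/funext => y; rewrite hornerMXaddC.
move=> x.
have c1 : {for x, continuous (horner p \* @id k)} := continuousM (IH x) (fun A : set k => id).
have c2 : {for x, continuous (fun=> c : k)} := @cst_continuous k k c x.
exact: (continuousD c1 c2).
Qed.

Lemma continuous_matrix (T U : topologicalType) m n (f : T -> 'M[U]_(m, n)) :
  (forall i j, continuous (fun x => f x i j)) -> continuous f.
Proof.
move=> cf x A [B nB sBA].
suff : \forall y \near x, forall i j, B i j (f y i j) by apply: filterS => y; exact: sBA.
apply: filter_forall => i; apply: filter_forall => j.
exact: cf.
Qed.

Section EuclideanPath.
Variables (n : nat) (k : numFieldType) (R : realType) (j : {rmorphism R -> k}).
Hypothesis j_cont : continuous j.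
Variable H : forms n {poly k}.
Hypothesis fH : family 1 H.

Let birH t : birational (fiber H t).
Proof. by apply: family_fiber_birational fH _; rewrite hornerC oner_eq0. Qed.

Definition euclidean_path (t : R) : bir_euclidean n k := bir_class (birH (j t)).

(** A family is given by forms of a fixed degree [d], so that the path lifts to
    the space of coefficients, on which its components are polynomials. *)
Lemma euclidean_path_continuous : continuous euclidean_path.
Proof.
have [d [e [G [P [Q [p _]]]]]] := fH.
have hH t i : homogeneous d (tnth (fiber H t) i).
  by rewrite tnth_fmap; apply: homogeneous_map (cp_homog p i).
pose c t : coefs n k d := coefs_of d (fiber H (j t)).
have cK t : tforms_of_coefs (c t) = fiber H (j t) by exact: tforms_of_coefsK.
have c0 t : c t != 0.
  have [[_ [i Hi]] _] := birH (j t); apply: contraNneq Hi => ct0.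
  rewrite -cK ct0 -(scale0r (0 : coefs n k d)) tforms_of_coefsZ tnth_fscale.
  by rewrite mpolyC0 mul0r.
pose v t : nonzero (coefs n k d) :=
  SigSub (mem_set (c0 t : [set w : coefs n k d | w != 0] (c t))).
have v_cont : continuous v.
  apply: continuous_comp_initial; apply: continuous_matrix => i l x.
  pose u := bmnm (val (enum_val l : monomial n d)).
  rewrite (_ : (fun _ => _) = horner (mcoeff u (tnth H i)) \o j).
    apply: continuous_comp; [exact: j_cont | exact: continuous_horner_num].
  by apply/funext => y; rewrite /= mxE tnth_fmap mcoeff_map_mpoly.
pose w t : Wspace n k d := \pi_(proj (coefs n k d)) (v t).
have w_cont : continuous w.
  by move=> t; apply: continuous_comp; [exact: v_cont | exact: pi_continuous].
have wE t : exists2 a, a != 0 & hcoord (w t) = a *: c t by exact: hcoord_point_of (c0 t).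
have wH t : same_ratmap (tforms_of_coefs (hcoord (w t))) (fiber H (j t)).
  have [a _ ->] := wE t; rewrite tforms_of_coefsZ cK; exact: same_ratmap_scale.
have wB t : Hspace (w t).
  have [a a0 wa] := wE t; rewrite /Hspace /= wa tforms_of_coefsZ cK.
  have [|d' [e' [g [P' [Q' [p' P'0]]]]]] := @family_fiber _ _ _ _ (j t) fH.
    by rewrite hornerC oner_eq0.
  apply: cremona_pair_birational (cremona_pair_scale a p') _.
  by rewrite scaler_eq0 negb_or expf_neq0.
pose w' t : set_type (@Hspace n k d) := SigSub (mem_set (wB t)).
have w'_cont : continuous w' by apply: continuous_comp_initial; exact: w_cont.
have piE t : bir_pi (w' t) = euclidean_path t.
  apply: bir_classP; have [[_ [l hl]] _] := birH (j t).
  exact: same_ratmap_trans hl (wH t) (same_ratmap_sym (forms_of_bir_class _)).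
apply/continuousP => S oS; have := oS d (cp_deg_gt0 p); rewrite /bir_deg_open.
rewrite bir_deg_preimage => oS'.
have -> : euclidean_path @^-1` S = w' @^-1` (@bir_pi n k d @^-1` S).
  by apply/seteqP; split=> t /=; rewrite piE.
by move/continuousP: w'_cont; exact.
Qed.

End EuclideanPath.

Lemma path_connected_connected (R : realType) (T : topologicalType) :
  path_connected R T -> connected [set: T].
Proof.
move=> pT B [x Bx] oB cB; apply/seteqP; split=> // y _.
have [g [cg g0 g1]] := pT x y.
have cI : connected (g @` `[0, 1]).
  exact: connected_continuous_connected (@segment_connected R 0 1) cg.
have e : B `&` g @` `[0, 1] = g @` `[0, 1].
  apply: cI.
  - exists x; split=> //; exists 0 => //; by rewrite /= in_itv /= lexx ler01.
  - by have [C oC ->] := oB; exists C => //; rewrite setTI setIC.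
  - by have [C cC ->] := cB; exists C => //; rewrite setTI setIC.
have [] : (B `&` g @` `[0, 1]) y by rewrite e; exists 1 => //; rewrite /= in_itv /= lexx ler01.
by [].
Qed.

Lemma infinite_numField (k : numFieldType) : infinite_set [set: k].
Proof.
move=> fink; apply: infinite_nat; rewrite -(preimage_setT (fun i : nat => i%:R : k)).
by apply: finite_preimage => // i i' _ _ /eqP; rewrite eqr_nat => /eqP.
Qed.

Lemma bir_path_connected n (k : numFieldType) (R : realType) (j : {rmorphism R -> k}) :
  continuous j -> (2 <= n)%N -> path_connected R (bir_euclidean n k).
Proof.
move=> j_cont n2 f g; have n0 : (0 < n)%N by apply: leq_trans n2.
have infk := @infinite_numField k.
have [D [H [-> fH H0 H1]]] : linked [set 1] (forms_of f) (forms_of g).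
  apply: linked_all => //; first exact: admissible1; first by left.
  - exact: forms_of_birational.
  - exact: forms_of_birational.
have pathE t : same_ratmap (forms_of (euclidean_path j fH t)) (fiber H (j t)).
  exact: forms_of_bir_class.
exists (euclidean_path j fH); split.
- exact/continuous_subspaceT/euclidean_path_continuous.
- have := pathE 0; rewrite rmorph0; apply: (fiber_end fH _ H0).
  by rewrite hornerC oner_eq0.
- have := pathE 1; rewrite rmorph1; apply: (fiber_end fH _ H1).
  by rewrite hornerC oner_eq0.
Qed.

Lemma real_complex_continuous (R : realType) (k : numFieldType := R[i]) :
  continuous (real_complex R : R -> k).
Proof.
move=> x A /= [e /= e0 eA].
have eR : (complex.Re (e : R[i]))%:C%C = (e : R[i]) by apply: RRe_real; exact: gtr0_real.
have e0' : 0 < complex.Re (e : R[i]) by rewrite -ltcR eR.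
exists (complex.Re (e : R[i])) => // y /= xy; apply: eA => /=.
rewrite -[X in _ < X]eR -[X in `|X|](rmorphB (real_complex R)) normc_def /=.
by rewrite expr0n addr0 sqrtr_sqr ltcR.
Qed.

Lemma bir_path_connected_real (R : realType) n : (2 <= n)%N ->
  path_connected R (bir_euclidean n R).
Proof. 
exact: (@bir_path_connected n R R idfun (fun (x : R) (A : set R) => id)).
Qed.

Lemma bir_path_connected_complex (R : realType) n : (2 <= n)%N ->
  path_connected R (bir_euclidean n R[i]).
Proof.
apply: (@bir_path_connected n _ R (real_complex R)).
exact: real_complex_continuous.
Qed.

(** * Birational maps of the projective line are linear *)

Section BinaryForms.
Variable k : fieldType.
Implicit Types (p : mpoly 2 k) (q : {poly k}).

Definition dehom p : {poly k} := mmap polyC (fun i : 'I_2 => if i == ord0 then 'X else 1) p.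

HB.instance Definition _ := GRing.RMorphism.copy dehom
  (mmap polyC (fun i : 'I_2 => if i == ord0 then 'X else 1 : {poly k})).

Definition homog_of N q : mpoly 2 k :=
  \sum_(i < N.+1) q`_i *: (mX ord0 ^+ i * mX ord_max ^+ (N - i)).

Lemma homogeneous_homog_of N q : homogeneous N (homog_of N q).
Proof.
apply: homogeneous_sum => i _; apply: homogeneousZ.
have := homogeneousM (homogeneousX i (homogeneous_mX k ord0))
  (homogeneousX (N - i) (homogeneous_mX k (ord_max : 'I_2))).
by rewrite !mul1n subnKC // -ltnS.
Qed.

Lemma dehomE p : dehom p = \sum_(u <- msupp p) mcoeff u p *: 'X^(u ord0).
Proof.
rewrite /dehom /mmap; apply: eq_bigr => u _; rewrite mul_polyC; congr (_ *: _).
by rewrite /mmap1 !big_ord_recl big_ord0 /= expr1n !mulr1.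
Qed.

Lemma mdeg2 (u : multinom 2) : mdeg u = (u ord0 + u ord_max)%N.
Proof.
rewrite mdegE !big_ord_recl big_ord0 addn0; congr (_ + u _)%N; exact: val_inj.
Qed.

Lemma multinom2P (u w : multinom 2) : mdeg u = mdeg w -> u ord0 = w ord0 -> u = w.
Proof.
rewrite !mdeg2 => dE e0; apply/mnmP => i.
have [->|i0] := eqVneq i ord0; first by [].
have -> : i = ord_max by case: i i0 => [[|[|]]] // ? _; apply: val_inj.
by move: dE; rewrite e0 => /addnI.
Qed.

Lemma coef_dehom N p u : homogeneous N p -> mdeg u = N ->
  (dehom p)`_(u ord0) = mcoeff u p.
Proof.
move=> /homogeneousP hp uN; rewrite dehomE coef_sum.
under eq_bigr do rewrite coefZ coefXn.
have [up|up] := boolP (u \in msupp p).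
  rewrite (bigD1_seq u) ?msupp_uniq //= eqxx mulr1 big_seq_cond big1 ?addr0 // => w.
  rewrite mcoeff_msupp => /andP[wp wu]; case: eqP => [e|_]; rewrite ?mulr0 //.
  by case/eqP: wu; apply: multinom2P => //; rewrite uN; exact: hp.
rewrite (memN_msupp_eq0 up) big_seq big1 // => w; rewrite mcoeff_msupp => wp.
case: eqP => [e|_]; rewrite ?mulr0 //; case/negP: up.
by rewrite (@multinom2P u w) ?mcoeff_msupp // uN; apply/esym/hp.
Qed.

Lemma size_dehom N p : homogeneous N p -> (size (dehom p) <= N.+1)%N.
Proof.
move=> /homogeneousP hp; rewrite dehomE big_seq; apply: leq_trans (size_sum _ _ _) _.
apply/bigmax_leqP_seq => u uin _; rewrite mcoeff_msupp in uin.
apply: leq_trans (size_scale_leq _ _) _; rewrite size_polyXn ltnS -(hp u uin) mdeg2.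
exact: leq_addr.
Qed.

Lemma dehom_inj N p p' : homogeneous N p -> homogeneous N p' ->
  dehom p = dehom p' -> p = p'.
Proof.
move=> hp hp' e; apply/mpolyP => u; have [uN|uN] := eqVneq (mdeg u) N.
  by rewrite -(coef_dehom hp uN) e (coef_dehom hp' uN).
have coef0 (r : mpoly 2 k) : homogeneous N r -> mcoeff u r = 0.
  by move=> /homogeneousP hr; apply/eqP; apply: contra_neqT uN => /hr.
by rewrite !coef0.
Qed.

Lemma dehom_homog_of N q : (size q <= N.+1)%N -> dehom (homog_of N q) = q.
Proof.
move=> sq; rewrite rmorph_sum /=; apply/polyP => a; rewrite coef_sum.
have term (i : 'I_N.+1) :
    dehom (q`_i *: (mX ord0 ^+ i * mX ord_max ^+ (N - i))) = q`_i *: 'X^i.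
  rewrite /dehom mmapZ rmorphM !rmorphXn /= !mmapX !mmap1U /= expr1n mulr1.
  by rewrite mul_polyC.
under eq_bigr do rewrite term coefZ coefXn.
have [aN|aN] := ltnP a N.+1.
  rewrite (bigD1 (Ordinal aN)) //= eqxx mulr1 big1 ?addr0 // => i ia.
  by rewrite eq_sym (_ : (_ == a) = false) ?mulr0 //; apply/negbTE.
rewrite nth_default ?(leq_trans sq) // big1 // => i _.
by rewrite gtn_eqF ?mulr0 // (leq_trans (ltn_ord i)).
Qed.

Lemma homog_of_dehom N p : homogeneous N p -> homog_of N (dehom p) = p.
Proof.
move=> hp; apply: (dehom_inj (homogeneous_homog_of N _) hp).
by rewrite dehom_homog_of // size_dehom.
Qed.

Lemma homog_ofM N M q q' : (size q <= N.+1)%N -> (size q' <= M.+1)%N ->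
  homog_of (N + M) (q * q') = homog_of N q * homog_of M q'.
Proof.
move=> sq sq'; apply: (dehom_inj (homogeneous_homog_of _ _)).
  by apply: homogeneousM; exact: homogeneous_homog_of.
rewrite rmorphM /= !dehom_homog_of //.
apply: leq_trans (size_polyMleq _ _) _; rewrite -subn1 leq_subLR.
by rewrite add1n -addnS -addSn; exact: leq_add.
Qed.

Lemma evalv_dehom (x : k) p :
  evalv (\row_j (if j == ord0 then x else 1)) p = (dehom p).[x].
Proof.
rewrite -[RHS]/(horner_eval x (dehom p)) /dehom rmorph_mmap /evalv meval_mmap.
apply: eq_mmap => [c|i] /=; first by rewrite /horner_eval hornerC.
by rewrite mxE /horner_eval; case: ifP => _; rewrite ?hornerX ?hornerC.
Qed.

Lemma evalv_infinity N p : homogeneous N p ->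
  evalv (\row_j (j == ord0)%:R) p = (dehom p)`_N.
Proof.
move=> hp; pose u : multinom 2 := mnm_muln (mnm1 ord0) N.
have u0 : u ord0 = N by rewrite mulmnE mnm1E mul1n.
have <- : mcoeff u p = (dehom p)`_N.
  by rewrite -(coef_dehom hp) ?u0 // mdegMn mdeg1 mul1n.
rewrite -(meval_e0 hp) /evalv; apply: meval_eq => j; by rewrite mxE.
Qed.

End BinaryForms.

Section LineMaps.
Variables (k : fieldType) (K : closedFieldType) (iota : {rmorphism k -> K}).
Implicit Types (h g : tforms 1 k).

Lemma ord2P (i : 'I_2) : i = ord0 \/ i = ord_max.
Proof. by case: i => [[|[|]]] // ?; [left|right]; apply: val_inj. Qed.

(** The dehomogenised form either has a root or is a constant, in which case the
    point at infinity is a zero of the form. *)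
Lemma binary_form_zero r (p : mpoly 2 K) : homogeneous r p -> (0 < r)%N ->
  exists2 x : 'rV[K]_2, x != 0 & evalv x p = 0.
Proof.
move=> hp r0; have [s1|/closed_rootP[x rx]] := eqVneq (size (dehom p)) 1%N.
  exists (\row_j (j == ord0)%:R).
    by apply/eqP => /rowP/(_ ord0); rewrite !mxE eqxx => /eqP; rewrite oner_eq0.
  by rewrite (evalv_infinity hp) nth_default // s1.
exists (\row_j (if j == ord0 then x else 1)); last by rewrite evalv_dehom; exact/eqP.
by apply/eqP => /rowP/(_ ord_max); rewrite !mxE /= => /eqP; rewrite oner_eq0.
Qed.

(** Division by a greatest common factor, computed on the dehomogenised forms.
    The degree [d'] is the larger of the degrees of the two quotients, so that
    not both vanish at infinity. *)
Lemma binary_forms_reduce d h : (forall i, homogeneous d (tnth h i)) ->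
  (exists i, tnth h i != 0) -> exists d' C A,
  [/\ h = fscale C A, forall i, homogeneous d' (tnth A i) &
      forall x : 'rV[K]_2, x != 0 -> evalr x (fmap iota A) != 0].
Proof.
move=> hh [i0 h0]; pose q i := dehom (tnth h i).
pose c := gcdp (q ord0) (q ord_max).
have qnz : (q ord0 != 0) || (q ord_max != 0).
  rewrite -negb_and; apply: contra h0 => /andP[/eqP q0 /eqP q1].
  apply/eqP/(dehom_inj (hh i0) (dhomog0 _ _ _)); rewrite [RHS]raddf0.
  by have [->|->] := ord2P i0.
have c0 : c != 0 by rewrite gcdp_eq0 negb_and.
pose a i := q i %/ c.
have qE i : q i = c * a i.
  by rewrite mulrC divpK //; have [->|->] := ord2P i; rewrite ?dvdp_gcdl ?dvdp_gcdr.
have coa : coprimep (a ord0) (a ord_max) by exact: coprimep_div_gcd.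
pose d' := (maxn (size (a ord0)) (size (a ord_max))).-1.
have sa i : (size (a i) <= d'.+1)%N.
  rewrite /d'; apply: leq_trans (leqSpred _).
  by have [->|->] := ord2P i; rewrite leq_max leqnn ?orbT.
have [m am] : exists m, size (a m) = d'.+1.
  have anz : (a ord0 != 0) || (a ord_max != 0).
    rewrite -negb_and; apply: contraL qnz => /andP[/eqP e0 /eqP e1].
    by rewrite !qE e0 e1 !mulr0 eqxx.
  have maxgt : (0 < maxn (size (a ord0)) (size (a ord_max)))%N.
    by rewrite leq_max !size_poly_gt0.
  rewrite /d' prednK //; case: (leqP (size (a ord0)) (size (a ord_max))) => _.
    by exists ord_max.
  by exists ord0.
have scd : (size c + d' <= d.+1)%N.
  have := size_dehom (hh m); rewrite -/(q m) qE size_mul // ?am ?addnS //.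
  by rewrite -size_poly_gt0 am.
have dd' : (d' <= d)%N.
  by rewrite -ltnS (leq_trans _ scd) // -add1n leq_add2r size_poly_gt0.
have sc : (size c <= (d - d').+1)%N by rewrite -(leq_add2r d') addSn subnK.
pose A : tforms 1 k := [tuple homog_of d' (a i) | i < 2].
have hA i : homogeneous d' (tnth A i) by rewrite tnth_mktuple; exact: homogeneous_homog_of.
exists d', (homog_of (d - d') c), A; split=> //.
  apply: eq_from_tnth => i; rewrite tnth_fscale tnth_mktuple -homog_ofM // subnK //.
  by rewrite -qE homog_of_dehom.
move=> x x0; apply: contra_neq x0 => Ax.
have {}Ax i : evalv x (map_mpoly iota (tnth A i)) = 0.
  by have /rowP/(_ i) := Ax; rewrite !mxE tnth_fmap.
have hAK i := homogeneous_map iota (hA i).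
have dehomK (p : mpoly 2 k) : dehom (map_mpoly iota p) = map_poly iota (dehom p).
  rewrite /dehom [RHS]rmorph_mmap [LHS]mmap_map; apply: eq_mmap => [b|i] /=.
    by rewrite map_polyC.
  by case: ifP => _; rewrite ?map_polyX ?rmorph1.
have dA i : dehom (map_mpoly iota (tnth A i)) = map_poly iota (a i).
  by rewrite dehomK tnth_mktuple dehom_homog_of.
have [y0|y0] := eqVneq (x 0 ord_max) 0.
  have xE : x = x 0 ord0 *: \row_j (j == ord0)%:R.
    apply/rowP => j; rewrite !mxE; have [->|->] := ord2P j; first by rewrite eqxx mulr1.
    by rewrite y0 mulr0.
  have := Ax m; rewrite xE (evalv_scale _ _ (hAK m)) (evalv_infinity (hAK m)) dA.
  rewrite coef_map => /eqP; rewrite mulf_eq0 fmorph_eq0 expf_eq0.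
  have -> : ((a m)`_d' == 0) = false.
    by apply/negbTE; rewrite -[d']/(d'.+1.-1) -am -lead_coefE lead_coef_eq0 -size_poly_gt0 am.
  by rewrite orbF => /andP[_ /eqP ->]; rewrite scale0r.
set r := x 0 ord0 / x 0 ord_max.
have xE : x = x 0 ord_max *: \row_j (if j == ord0 then r else 1).
  apply/rowP => j; rewrite !mxE; have [->|->] := ord2P j; last by rewrite mulr1.
  by rewrite /= mulrC divfK.
have ra i : root (map_poly iota (a i)) r.
  have := Ax i; rewrite xE (evalv_scale _ _ (hAK i)) evalv_dehom dA => /eqP.
  by rewrite mulf_eq0 expf_eq0 (negbTE y0) andbF.
have := coa; rewrite -(coprimep_map iota) => /coprimep_root/(_ (ra ord0)).
by rewrite (eqP (ra ord_max)) eqxx.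
Qed.

(** If [h] and [g] have no common factors then [g o h] has no zeros, so that its
    multiplier is a constant and both degrees are one. *)
Lemma birational_line_linear h : birational h ->
  exists2 M : 'M[k]_2, M \in unitmx & same_ratmap h (linf M).
Proof.
move=> /(@birational_cremona_pair _ _ _ (ltn0Sn 0))[d [e [g [P [Q [p P0]]]]]].
have Q0 := cremona_pair_inv_mult_neq0 p P0.
have [d' [C [A [hCA hA zA]]]] := binary_forms_reduce (cp_homog p) (cremona_pair_neq0 p P0).
have [e' [C' [B [gCB hB zB]]]] := binary_forms_reduce (cp_inv_homog p)
  (cremona_pair_neq0 (cremona_pair_sym p) Q0).
pose W := (C' \mPo h) * C ^+ e'.
have WE i : W * tnth (fcomp B A) i = P * mX i.
  have := congr1 (fun t => tnth t i) (cp_compl p); rewrite tnth_fscale tnth_fid => <-.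
  rewrite !tnth_fcomp gCB tnth_fscale rmorphM /= /W -mulrA; congr (_ * _).
  by rewrite hCA (comp_fscale _ _ (hB i)).
have W0 : W != 0.
  apply: contraNneq P0 => W0; have := WE ord0; rewrite W0 mul0r => /esym/eqP.
  by rewrite mulf_eq0 (negbTE (mX_neq0 _ _)) orbF.
have BAid : same_ratmap (fcomp B A) fid.
  apply/same_ratmapP => i j; apply: (mulfI W0); rewrite !mulrA !WE !tnth_fid.
  by rewrite mulrAC.
have [P' eP'] := proportional_to_id (ltn0Sn 0) BAid.
have P'0 : P' != 0.
  apply: contraNneq P0 => P'0; have := WE ord0.
  rewrite eP' tnth_fscale P'0 mul0r mulr0 => /esym/eqP.
  by rewrite mulf_eq0 (negbTE (mX_neq0 _ _)) orbF.
have : homogeneous (e' * d') (P' * mX ord0).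
  rewrite -tnth_fid -tnth_fscale -eP' tnth_fcomp; exact: homogeneous_comp.
move=> /homogeneous_factor/(_ P'0); rewrite mdeg1 => -[ed hP'].
have d1 : d' = 1%N.
  have [/eqP|r0] := posnP (e' * d' - 1).
    rewrite subn_eq0 => le1; have : (e' * d' == 1)%N by rewrite eqn_leq le1.
    by rewrite muln_eq1 => /andP[_ /eqP].
  have [x x0 P'x] := binary_form_zero (homogeneous_map iota hP') r0.
  have /eqP := zB _ (zA x x0); case.
  rewrite -evalr_fcomp.
  have -> : fcomp (fmap iota B) (fmap iota A) = fscale (map_mpoly iota P') fid.
    apply: eq_from_tnth => i; rewrite tnth_fcomp tnth_fmap -map_fmap -tnth_fcomp eP'.
    by rewrite !tnth_fscale !tnth_fid rmorphM /= map_mX.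
  by rewrite evalr_fscale_fid P'x scale0r.
rewrite d1 in hA.
pose M : 'M[k]_2 := \matrix_(i, j) mcoeff (mnm1 j) (tnth A i).
have AM : A = linf M.
  apply: eq_from_tnth => i; rewrite tnth_linf [LHS]homogeneous1E //.
  by apply: eq_bigr => j _; rewrite mxE.
rewrite hCA AM in p *; exists M; last exact: same_ratmap_scale.
exact: cremona_pair_linf_unit p Q0.
Qed.

End LineMaps.

(** * A projective line without polynomial paths *)

Section Orientation.
Variable R : realFieldType.
Implicit Types (x y z : 'rV[R]_2) (h : tforms 1 R) (M : 'M[R]_2).

Definition det2 x y : R := x 0 ord0 * y 0 ord_max - x 0 ord_max * y 0 ord0.

(** Up to sign, the cyclic orientation of the images of three points. *)
Definition orient h x y z : R :=
  det2 (evalr x h) (evalr y h) * det2 (evalr y h) (evalr z h) *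
  det2 (evalr z h) (evalr x h).

Lemma det_mx2 M :
  \det M = M ord0 ord0 * M ord_max ord_max - M ord0 ord_max * M ord_max ord0.
Proof.
rewrite (expand_det_row _ ord0) !big_ord_recl big_ord0 addr0 /cofactor !det_mx11 !mxE /=.
rewrite /= expr0 mul1r expr1 mulN1r mulrN.
by congr (_ * M _ _ - M _ _ * M _ _); apply: val_inj.
Qed.

Lemma evalr_linf x M i :
  evalr x (linf M) 0 i = M i ord0 * x 0 ord0 + M i ord_max * x 0 ord_max.
Proof.
rewrite mxE tnth_linf /evalv raddf_sum /= !big_ord_recl big_ord0 addr0.
rewrite !mevalZ !mevalXU; congr (_ + M _ _ * x _ _); apply: val_inj => //.
Qed.

Lemma det2_linf M x y :
  det2 (evalr x (linf M)) (evalr y (linf M)) = \det M * det2 x y.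
Proof. by rewrite /det2 !evalr_linf det_mx2; ring. Qed.

Lemma det2_scale a b x y : det2 (a *: x) (b *: y) = a * b * det2 x y.
Proof. by rewrite /det2 !mxE; ring. Qed.

Lemma det2_0l y : det2 0 y = 0.
Proof. by rewrite /det2 !mxE !mul0r subr0. Qed.

(** A matrix multiplies [det2] by its determinant.  Each point occurs in two
    factors of the orientation, so that the scaling of the coordinates
    contributes a square, and the determinant an odd power. *)
Lemma orient_linf h M x y z : same_ratmap h (linf M) -> M \in unitmx ->
  evalr x h != 0 -> evalr y h != 0 -> evalr z h != 0 ->
  det2 x y != 0 -> det2 y z != 0 -> det2 z x != 0 ->
  Num.sg (orient h x y z) =
  Num.sg (\det M) * Num.sg (det2 x y * det2 y z * det2 z x).
Proof.
rewrite unitmxE unitfE => /same_ratmapP hM detM hx hy hz xy yz zx.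
have prop a b : evalr a h != 0 -> det2 a b != 0 ->
    proportional (evalr a h) (evalr a (linf M)).
  move=> ha ab; apply: cross_proportional => // [|i j].
    have : det2 (evalr a (linf M)) (evalr b (linf M)) != 0 by rewrite det2_linf mulf_neq0.
    by apply: contraNneq => ->; rewrite det2_0l.
  by rewrite !mxE /evalv -!mevalM hM.
have [a a0 ha] := prop _ _ hx xy; have [b b0 hb] := prop _ _ hy yz.
have [c c0 hc] := prop _ _ hz zx.
rewrite /orient ha hb hc !det2_scale !det2_linf.
have -> : a * b * (\det M * det2 x y) * (b * c * (\det M * det2 y z)) *
    (c * a * (\det M * det2 z x)) =
    (a * b * c * \det M) ^+ 2 * (\det M * (det2 x y * det2 y z * det2 z x)) by ring.
rewrite sgrM; have -> : Num.sg ((a * b * c * \det M) ^+ 2) = 1.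
  by apply: gtr0_sg; rewrite exprn_even_gt0 // !mulf_neq0.
by rewrite mul1r; exact: sgrM.
Qed.

Lemma exists_three_points (p : mpoly 2 R) : p != 0 -> exists x y z,
  [/\ [/\ evalv x p != 0, evalv y p != 0 & evalv z p != 0],
      det2 x y != 0, det2 y z != 0 & det2 z x != 0].
Proof.
move=> p0; have infR := @infinite_numField R.
pose l x : mpoly 2 R := x 0 ord0 *: mX ord_max - x 0 ord_max *: mX ord0.
have lE x y : evalv y (l x) = det2 x y.
  by rewrite /evalv /l mevalB !mevalZ !mevalXU.
have l0 x : x != 0 -> l x != 0.
  apply: contra_neq => lx; have c j := congr1 (mcoeff (mnm1 j)) lx.
  apply/rowP => j; rewrite mxE; have [->|->] := ord2P j.
    have := c ord_max; rewrite mcoeffB !mcoeffZ !mcoeffX !eq_mnm1 mcoeff0 /=.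
    by rewrite mulr1 mulr0 subr0.
  have := c ord0; rewrite mcoeffB !mcoeffZ !mcoeffX !eq_mnm1 mcoeff0 /=.
  by rewrite mulr1 mulr0 sub0r => /eqP; rewrite oppr_eq0 => /eqP.
have [x [x0 px]] := exists_point infR p0.
have [y [y0]] := exists_point infR (mulf_neq0 p0 (l0 x x0)).
rewrite /evalv mevalM mulf_eq0 negb_or -!/(evalv _ _) lE => /andP[py xy].
have [z [z0]] := exists_point infR (mulf_neq0 (mulf_neq0 p0 (l0 x x0)) (l0 y y0)).
rewrite /evalv !mevalM !mulf_eq0 !negb_or -!/(evalv _ _) !lE => /andP[/andP[pz xz] yz].
exists x, y, z; split=> //.
by move: xz; rewrite /det2 -oppr_eq0 opprB mulrC [X in _ - X]mulrC.
Qed.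

Lemma sg_det_linf M N : M \in unitmx -> N \in unitmx ->
  same_ratmap (linf M) (linf N) -> Num.sg (\det M) = Num.sg (\det N).
Proof.
move=> uM uN MN; have [x [y [z [_ xy yz zx]]]] := exists_three_points (oner_neq0 _).
have nz a b : det2 a b != 0 -> evalr a (linf M) != 0.
  move=> ab; have : det2 (evalr a (linf M)) (evalr b (linf M)) != 0.
    by rewrite det2_linf mulf_neq0 //; move: uM; rewrite unitmxE unitfE.
  by apply: contraNneq => ->; rewrite det2_0l.
have e1 := orient_linf (same_ratmap_refl _) uM (nz _ _ xy) (nz _ _ yz) (nz _ _ zx) xy yz zx.
have := orient_linf MN uN (nz _ _ xy) (nz _ _ yz) (nz _ _ zx) xy yz zx.
rewrite e1; apply: mulIf; rewrite sgr_eq0 !mulf_neq0 //.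
Qed.

End Orientation.

Section LineFamily.
Variables (k : fieldType) (K : closedFieldType) (iota : {rmorphism k -> K}).
Hypothesis infk : infinite_set [set: k].
Local Notation line := (affine_line iota).
Local Notation pt t := (affine_line_point iota t).

(** The polynomial in the parameter obtained by evaluating a form at [x]. *)
Definition at_pt (L : fieldType) (x : 'rV[L]_2) (p : mpoly 2 (mpoly 1 L)) : {poly L} :=
  mmap (mmap polyC (fun=> 'X)) (fun i => (x 0 i)%:P) p.

Definition at_time (L : fieldType) (t : L) (p : mpoly 2 (mpoly 1 L)) : mpoly 2 L :=
  map_mpoly (evalp idfun (\row__ t)) p.

Lemma at_ptE (L : fieldType) x t p : (at_pt x p).[t] = evalv x (@at_time L t p).
Proof.
rewrite -[LHS]/(horner_eval t (at_pt x p)) /at_pt rmorph_mmap /evalv meval_mmap.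
rewrite /at_time mmap_map; apply: eq_mmap => [c|i] /=; last by rewrite /horner_eval hornerC.
rewrite rmorph_mmap /evalp; apply: eq_mmap => [b|i] /=.
  by rewrite /horner_eval hornerC.
by rewrite mxE /horner_eval hornerX.
Qed.

Variables (fam : bir_family line 1) (rho : kpoints line -> Bir 1 k).
Hypothesis fam_rho : forall a, fiber_is fam (set_val a) (rho a).

Let vt (t : k) : 'rV[K]_1 := \row__ iota t.

Let vtE (t : k) : vchart (v := line) (i := ord0) (vt t) = set_val (pt t).
Proof. by rewrite /= mxE. Qed.

Let zeros0 (v : 'rV[K]_(vdim (v := line) ord0)) : zeros iota (veqs (v := line) ord0) v.
Proof. by []. Qed.

(** Near [t0] the family is given by forms [h].  For each [t] these agree with
    [rho t] on a dense open set of points, hence as polynomials. *)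
Lemma local_forms (t0 : k) : exists (h : 'I_2 -> mpoly 2 (mpoly 1 k)) (N : {poly K}),
  [/\ exists j, at_time t0 (h j) != 0, N.[iota t0] != 0 &
      forall t, N.[iota t] != 0 -> (exists j, at_time t (h j) != 0) ->
        same_ratmap [tuple at_time t (h i) | i < 2] (forms_of (rho (pt t)))].
Proof.
have [x Ux] := bf_dom_surj fam (set_val (pt t0)); rewrite -vtE in Ux.
have [dq [q [hq qx qU]]] := bf_dom_open (zeros0 _) Ux.
have [dh [h [hh [j hx] hF]]] := bf_fun_regular (zeros0 _) Ux.
have qE t x' : evalf idfun (vt t) x' q = evalv (hcoord x') (at_time (iota t) q).
  by rewrite /evalv meval_mmap /at_time mmap_map.
have hE t x' l : evalf iota (vt t) x' (h l) =
    evalv (hcoord x') (map_mpoly iota (at_time t (h l))).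
  rewrite /evalv meval_mmap /at_time !mmap_map /evalf; apply: eq_mmap => // c /=.
  by rewrite /evalp rmorph_mmap; apply: eq_mmap => // i /=; rewrite !mxE.
exists h, (at_pt (hcoord x) q); split.
- exists j; apply: contraNneq hx => h0; rewrite hE h0 rmorph0.
  by rewrite /evalv meval0.
- by rewrite at_ptE -qE.
move=> t Nt [a ha]; set w := forms_of _.
have [[_ [b wb]] _] : birational w := forms_of_birational _.
have [[[dw hw] _] _] : birational w := forms_of_birational _.
apply/same_ratmapP => i l; rewrite !tnth_mktuple; apply/eqP; rewrite -subr_eq0.
apply/negPn/negP => hwn.
have hht m : homogeneous dh (at_time t (h m)) by apply: homogeneous_map (hh m).
set p1 := at_time t (h a) * tnth w b; set p2 := _ - _ in hwn.
have hp2 : homogeneous (dh + dw) p2.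
  apply: homogeneousD; first exact: homogeneousM.
  by rewrite -scaleN1r; apply: homogeneousZ; exact: homogeneousM.
have hr : homogeneous (dq + (dh + dw + (dh + dw)))
    (at_time (iota t) q * map_mpoly iota (p1 * p2)).
  apply: homogeneousM; first exact: homogeneous_map.
  by apply: homogeneous_map; do 2!apply: homogeneousM => //.
have q0 : at_time (iota t) q != 0.
  by apply: contraNneq Nt => q0; rewrite at_ptE q0 /evalv meval0.
(* a point of the open set where [q], [h_a] and [w_b] do not vanish, at which
   the two tuples would not be proportional *)
have [x' [x'0 x'nz]] := exists_point (infinite_rmorphism iota infk)
  (mulf_neq0 q0 (map_mpoly_neq0 iota (mulf_neq0 (mulf_neq0 ha wb) hwn))).
set y := point_of x'0.
have mapE : map_mpoly iota (p1 * p2) =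
    map_mpoly iota (at_time t (h a)) * map_mpoly iota (tnth w b) * map_mpoly iota p2.
  by rewrite /p1 !rmorphM.
have := evalv_proportional hr (proportional_sym (hcoord_point_of x'0)) x'nz.
rewrite mapE !evalvM !mulf_eq0 !negb_or -/y.
case/andP => qy /andP[/andP[hay wby] p2y].
have Uy : bf_dom fam (vchart (v := line) (i := ord0) (vt t), y).
  by apply: qU; [exact: zeros0 | rewrite qE].
have hne : exists m, evalf iota (vt t) y (h m) != 0.
  by exists a; rewrite (hE t y a); exact: hay.
have [c c0 hy] := hF (vt t) y (zeros0 (vt t)) Uy hne.
rewrite vtE in Uy hy.
have wE m : evalp iota (hcoord y) (tnth w m) =
    evalv (hcoord y) (map_mpoly iota (tnth w m)).
  by rewrite /evalv meval_mmap mmap_map.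
have [|c' c'0 wy] := fam_rho Uy.
  by apply/eqP => /rowP/(_ b); rewrite !mxE wE => /eqP; rewrite (negbTE wby).
case/eqP: p2y; rewrite /p2 rmorphB !rmorphM /= evalvB !evalvM.
move/rowP: hy => hy; move/rowP: wy => wy.
have := hy i; have := hy l; have := wy i; have := wy l.
rewrite !mxE !hE !wE => -> -> -> ->; ring.
Qed.

End LineFamily.

Section RealLine.
Variable R : realType.
Local Notation iota := (real_complex R).
Local Notation line := (affine_line (real_complex R)).
Local Notation pt t := (affine_line_point (real_complex R) t).

Variables (fam : bir_family line 1) (rho : kpoints line -> Bir 1 R).
Hypothesis fam_rho : forall a, fiber_is fam (set_val a) (rho a).
Variable M : R -> 'M[R]_2.
Hypothesis uM : forall t, M t \in unitmx.
Hypothesis rhoM : forall t, same_ratmap (forms_of (rho (pt t))) (linf (M t)).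

Lemma near_real_root (p : {poly R}) (t0 : R) :
  p.[t0] != 0 -> \forall t \near t0, p.[t] != 0.
Proof.
have pc : p.[t] @[t --> t0] --> p.[t0] by exact: continuous_horner.
by move=> p0; exact: cvgr_neq0 pc p0.
Qed.

Lemma near_complex_root (p : {poly R[i]}) (t0 : R) :
  p.[iota t0] != 0 -> \forall t \near t0, p.[iota t] != 0.
Proof.
move=> p0; pose k : numFieldType := R[i].
have pc : continuous ((horner p : k -> k) \o (iota : R -> k)).
  move=> x; apply: continuous_comp; first exact: real_complex_continuous.
  exact: continuous_horner_num.
exact: cvgr_neq0 (pc t0) p0.
Qed.

Lemma near_sg (p : {poly R}) (t0 : R) : p.[t0] != 0 ->
  \forall t \near t0, Num.sg p.[t] = Num.sg p.[t0].
Proof.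
have pc : p.[t] @[t --> t0] --> p.[t0] by exact: continuous_horner.
rewrite neq_lt => /orP[p0|p0].
  have pl : \forall t \near t0, p.[t] < 0 by apply: (cvgr_lt _ pc).
  by near=> t; rewrite !ltr0_sg //; near: t.
have pg : \forall t \near t0, 0 < p.[t] by apply: (cvgr_gt _ pc).
by near=> t; rewrite !gtr0_sg //; near: t.
Unshelve. all: by end_near. Qed.

(** The orientation of three fixed points under the local forms is a polynomial
    in [t] that does not vanish at [t0]. *)
Lemma sg_det_locally_constant (t0 : R) :
  \forall t \near t0, Num.sg (\det (M t)) = Num.sg (\det (M t0)).
Proof.
have [h [N [[j hj] N0 hrho]]] := local_forms (@infinite_numField R) fam_rho t0.
have [x [y [z [[px py pz] xy yz zx]]]] := exists_three_points hj.
pose ht t : tforms 1 R := [tuple at_time t (h i) | i < 2].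
have htM t : N.[iota t] != 0 -> (exists j, at_time t (h j) != 0) ->
    same_ratmap (ht t) (linf (M t)).
  move=> Nt nz; have [[_ [l wl]] _] := forms_of_birational (rho (pt t)).
  exact: same_ratmap_trans wl (hrho t Nt nz) (rhoM t).
have evE t v i : evalr v (ht t) 0 i = (at_pt v (h i)).[t].
  by rewrite mxE tnth_mktuple at_ptE.
have nz t v : (at_pt v (h j)).[t] != 0 -> evalr v (ht t) != 0.
  by apply: contraNneq => /rowP/(_ j); rewrite evE mxE => ->.
have nzh t : (at_pt x (h j)).[t] != 0 -> exists j, at_time t (h j) != 0.
  by move=> xt; exists j; apply: contraNneq xt => e0; rewrite at_ptE e0 /evalv meval0.
pose d2 u v :=
  at_pt u (h ord0) * at_pt v (h ord_max) - at_pt u (h ord_max) * at_pt v (h ord0).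
pose delta := d2 x y * d2 y z * d2 z x.
have deltaE t : delta.[t] = orient (ht t) x y z.
  by rewrite /orient /det2 !evE !(hornerM, hornerD, hornerN).
have sgE t : N.[iota t] != 0 -> (at_pt x (h j)).[t] != 0 ->
    (at_pt y (h j)).[t] != 0 -> (at_pt z (h j)).[t] != 0 ->
    Num.sg delta.[t] = Num.sg (\det (M t)) * Num.sg (det2 x y * det2 y z * det2 z x).
  move=> Nt xt yt zt; rewrite deltaE.
  by apply: orient_linf => //; [exact: htM (nzh t xt) | exact: nz | exact: nz | exact: nz].
have Delta0 : Num.sg (det2 x y * det2 y z * det2 z x) != 0 by rewrite sgr_eq0 !mulf_neq0.
have x0 : (at_pt x (h j)).[t0] != 0 by rewrite at_ptE.
have y0 : (at_pt y (h j)).[t0] != 0 by rewrite at_ptE.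
have z0 : (at_pt z (h j)).[t0] != 0 by rewrite at_ptE.
have delta0 : delta.[t0] != 0.
  rewrite -sgr_eq0 sgE // mulf_neq0 // sgr_eq0.
  by have := uM t0; rewrite unitmxE unitfE.
near=> t.
apply: (mulIf Delta0); rewrite -!sgE //.
- by near: t; exact: near_sg.
- by near: t; exact: near_complex_root.
- by near: t; exact: near_real_root.
- by near: t; exact: near_real_root.
- by near: t; exact: near_real_root.
Unshelve. all: by end_near. Qed.

Lemma sg_det_constant (t0 t1 : R) : Num.sg (\det (M t0)) = Num.sg (\det (M t1)).
Proof.
pose B := [set t | Num.sg (\det (M t)) = Num.sg (\det (M t1))].
have oB : open B.
  rewrite openE => t /= Bt; rewrite /interior; have := sg_det_locally_constant t.
  by apply: filterS => s; rewrite /B /= Bt.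
have oBC : open (~` B).
  rewrite openE => t /= Bt; rewrite /interior; have := sg_det_locally_constant t.
  by apply: filterS => s; rewrite /B /= => ->.
have cR : connected [set: R] by apply/connected_intervalP => x y _ _ z _.
have BT : B = setT.
  apply: cR; first by exists t1.
  - by exists B => //; rewrite setTI.
  - by exists B; [rewrite -openC | rewrite setTI].
by have : B t0 by rewrite BT.
Qed.

End RealLine.

Lemma complex_algebraic_closure (R : rcfType) : is_algebraic_closure (real_complex R).
Proof.
case=> a b; exists (('X - a%:P) ^+ 2 + (b ^+ 2)%:P).
  apply/eqP => /(congr1 (fun p : {poly R} => p`_2)); rewrite coef0 coefD coefC addr0.
  rewrite sqrrB !coefD !coefN coefMn coefXn mulrC coefCM coefX /= mulr0 mul0rn subr0.
  by rewrite -polyC_exp coefC addr0 => /eqP; rewrite oner_eq0.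
rewrite rmorphD rmorphXn rmorphB /= map_polyX !map_polyC /root.
rewrite hornerD horner_exp hornerD hornerN hornerX !hornerC.
by rewrite expr2 /=; simpc; rewrite expr2 addNr.
Qed.

(** The sign of the determinant separates [x] and [- x]. *)
Lemma no_path_on_real_line (R : realType) : exists f g : Bir 1 R,
  ~ exists rho : kpoints (affine_line (real_complex R)) -> Bir 1 R,
      [/\ is_bir_morphism rho, rho (affine_line_point (real_complex R) 0) = f &
          rho (affine_line_point (real_complex R) 1) = g].
Proof.
pose D : 'M[R]_2 := \matrix_(i, j) ((-1) ^+ (i == ord0) *+ (i == j)).
have detD : \det D = -1.
  by rewrite det_mx2 !mxE /= !mulr0n mulr1n mulr0 subr0 mulr1n expr1 mulr1.
have uD : D \in unitmx by rewrite unitmxE unitfE detD oppr_eq0 oner_eq0.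
have u1 : (1%:M : 'M[R]_2) \in unitmx by exact: unitmx1.
exists (bir_class (linf_birational u1)), (bir_class (linf_birational uD)).
move=> [rho [[fam fam_rho] rho0 rho1]].
have linear t : exists M : 'M[R]_2, M \in unitmx /\
    same_ratmap (forms_of (rho (affine_line_point (real_complex R) t))) (linf M).
  have [M uM MP] := birational_line_linear (real_complex R)
    (forms_of_birational (rho (affine_line_point (real_complex R) t))).
  by exists M.
have [M MP] := choice linear.
have uM t : M t \in unitmx by have [] := MP t.
have rhoM t := proj2 (MP t).
have end_sg t N (uN : N \in unitmx) :
    rho (affine_line_point (real_complex R) t) = bir_class (linf_birational uN) ->
    Num.sg (\det (M t)) = Num.sg (\det N).
  move=> e; apply: sg_det_linf => //.
  have [[_ [l hl]] _] := forms_of_birational (bir_class (linf_birational uN)).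
  apply: same_ratmap_trans hl _ (forms_of_bir_class _).
  by rewrite -e; exact: same_ratmap_sym.
have := sg_det_constant fam_rho uM rhoM 0 1.
rewrite (end_sg _ _ u1 rho0) (end_sg _ _ uD rho1) detD det1 sgrN sgr1 => /eqP.
by rewrite -subr_eq0 opprK -mulr2n mulrn_eq0 oner_eq0.
Qed.

Theorem theorem3 :
  (forall (k : fieldType) (K : closedFieldType) (iota : {rmorphism k -> K})
      (n : nat),
    infinite_set [set: k] -> is_algebraic_closure iota -> (2 <= n)%N ->
    (forall f g : Bir n k,
       exists rho : kpoints (affine_line iota) -> Bir n k,
         [/\ is_bir_morphism rho,
             rho (affine_line_point iota 0) = f &
             rho (affine_line_point iota 1) = g]) /\
    connected [set: bir_zariski n iota])
  /\
  ((forall (k : fieldType) (K : closedFieldType) (iota : {rmorphism k -> K}),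
      infinite_set [set: k] -> is_algebraic_closure iota ->
      connected [set: bir_zariski 1 iota]) /\
   (exists (k : fieldType) (K : closedFieldType) (iota : {rmorphism k -> K}),
      [/\ infinite_set [set: k], is_algebraic_closure iota &
       exists f g : Bir 1 k,
         ~ exists rho : kpoints (affine_line iota) -> Bir 1 k,
             [/\ is_bir_morphism rho,
                 rho (affine_line_point iota 0) = f &
                 rho (affine_line_point iota 1) = g]]))
  /\
  (forall (R : realType) (n : nat), (2 <= n)%N ->
     (path_connected R (bir_euclidean n R) /\
      connected [set: bir_euclidean n R]) /\
     (path_connected R (bir_euclidean n R[i]) /\
      connected [set: bir_euclidean n R[i]])).
Proof.
split=> [k K iota n infk _ n2|].
  have n0 : (0 < n)%N by apply: leq_trans n2.
  split=> [f g|]; last exact: zariski_connected.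
  apply: affine_line_linked => //; apply: linked_all => //.
  - exact: admissible1.
  - by left.
  - exact: forms_of_birational.
  - exact: forms_of_birational.
split; first split.
- by move=> k K iota infk _; exact: zariski_connected.
- exists Rdefinitions.R, _, (real_complex Rdefinitions.R); split.
  + exact: infinite_numField.
  + exact: complex_algebraic_closure.
  + exact: no_path_on_real_line.
move=> R n n2; have pR := @bir_path_connected_real R n n2.
have pC := @bir_path_connected_complex R n n2.
split; split=> //; first exact: path_connected_connected pR.
exact: path_connected_connected pC.
Qed.
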